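(* For every constant integer $k\geq 4$, it is NP-complete to decide, for a given graph $G$, whether $\mathsf{tree}\text{-}\alpha(G)\leq k$.
   Context: A tree decomposition of a graph $G$ is a pair $\mathcal{T}=(T,\{X_t\}_{t\in V(T)})$ where $T$ is a tree and each $X_t\subseteq V(G)$ such that every vertex of $G$ lies in some bag, every edge of $G$ has both endpoints in some bag, and for every vertex $u$ the set of nodes $t$ with $u\in X_t$ induces a connected subtree of $T$. The independence number of $\mathcal{T}$ is the maximum over $t$ of the independence number of $G[X_t]$. The tree-independence number $\mathsf{tree}\text{-}\alpha(G)$ is the minimum independence number of a tree decomposition of $G$. *)

(* Defs.v *)
From HB Require Import structures.
From mathcomp Require Import all_boot all_order all_algebra.
From mathcomp Require Import boolp.

Set Implicit Arguments.
Unset Strict Implicit.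
Unset Printing Implicit Defensive.

Record sgraph := SGraph {
  vertex :> finType;
  adj : rel vertex;
  adj_sym : symmetric adj;
  adj_irr : irreflexive adj }.

Section Induced.
Variables (G : sgraph) (X : {set G}).

Definition induced_adj : rel {x : G | x \in X} :=
  fun x y => adj (val x) (val y).

Lemma induced_sym : symmetric induced_adj.
Proof. by move=> x y; apply: adj_sym. Qed.

Lemma induced_irr : irreflexive induced_adj.
Proof. by move=> x; apply: adj_irr. Qed.

Definition induced : sgraph := SGraph induced_sym induced_irr.

End Induced.

Definition independent (G : sgraph) (S : {set G}) : bool :=
  [forall x in S, forall y in S, ~~ adj x y].

Definition alpha (G : sgraph) : nat :=
  \max_(S : {set G} | independent S) #|S|.

Definition connected (G : sgraph) : Prop :=
  forall x y : G, connect (@adj G) x y.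

Definition acyclic (G : sgraph) : Prop :=
  forall c : seq G, ucycle (@adj G) c -> size c <= 2.

Definition is_tree (G : sgraph) : Prop :=
  [/\ inhabited G, connected G & acyclic G].

Record tree_decomposition (G : sgraph) := TreeDecomposition {
  td_tree : sgraph;
  td_treeP : is_tree td_tree;
  bag : td_tree -> {set G};
  bag_vertex : forall u : G, exists t, u \in bag t;
  bag_edge : forall u v : G, adj u v -> exists t, (u \in bag t) && (v \in bag t);
  bag_connected : forall u : G, connected (induced [set t | u \in bag t]) }.

Definition td_alpha (G : sgraph) (D : tree_decomposition G) : nat :=
  \max_(t : td_tree D) alpha (induced (bag t)).

Definition trivial_tree : sgraph :=
  @SGraph unit (fun _ _ => false) (fun _ _ => erefl) (fun _ => erefl).

Lemma trivial_treeP : is_tree trivial_tree.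
Proof.
split; first exact: (inhabits tt).
  by case; case; apply: connect0.
by case=> [|x [|y c]] //=; rewrite /ucycle.
Qed.

Definition trivial_td (G : sgraph) : tree_decomposition G.
Proof.
apply: (@TreeDecomposition G trivial_tree trivial_treeP (fun _ => setT)).
- by move=> u; exists tt; rewrite inE.
- by move=> u v _; exists tt; rewrite !inE.
- move=> u [[] p] [[] q]; have ->: p = q by apply: bool_irrelevance.
  exact: connect0.
Defined.

Lemma td_alpha_attained (G : sgraph) :
  exists m, `[< exists D : tree_decomposition G, td_alpha D = m >].
Proof.
by exists (td_alpha (trivial_td G)); apply/asboolP; exists (trivial_td G).
Qed.

Definition tree_alpha (G : sgraph) : nat := ex_minn (td_alpha_attained G).

(* Deterministic multi-tape Turing machines over the input alphabet {0,1}.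
   The tapes are infinite in both directions. *)

Inductive move := MLeft | MStay | MRight.

(* A blank cell is [None], the input bit b is [Some (inl b)], and a machine may
   use further work symbols [Some (inr a)] of its own. *)
Definition cell (A : finType) : finType := option (bool + A).

Record TM := MkTM {
  tm_ntapes : nat;  (* one less than the number of tapes *)
  tm_work : finType;
  tm_state : finType;
  tm_start : tm_state;
  tm_halt : pred tm_state;
  tm_delta : tm_state -> {ffun 'I_tm_ntapes.+1 -> cell tm_work} ->
             tm_state * {ffun 'I_tm_ntapes.+1 -> cell tm_work * move} }.

(* In a tape (l, r), the word r starts at the scanned cell and goes right, l
   lists the cells left of the head, nearest first; all cells beyond are
   blank. *)
Definition tape (A : finType) : Type := (seq (cell A) * seq (cell A))%type.

Definition tape_read (A : finType) (t : tape A) : cell A := head None t.2.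

Definition tape_write (A : finType) (a : cell A) (t : tape A) : tape A :=
  (t.1, a :: behead t.2).

Definition tape_move (A : finType) (m : move) (t : tape A) : tape A :=
  match m with
  | MLeft => (behead t.1, head None t.1 :: t.2)
  | MStay => t
  | MRight => (head None t.2 :: t.1, behead t.2)
  end.

Definition config (M : TM) : Type :=
  (tm_state M * {ffun 'I_(tm_ntapes M).+1 -> tape (tm_work M)})%type.

(* Halting configurations are fixed points. *)
Definition step (M : TM) (c : config M) : config M :=
  if tm_halt c.1 then c else
  let: (q, act) := tm_delta c.1 [ffun i => tape_read (c.2 i)] in
  (q, [ffun i => tape_move (act i).2 (tape_write (act i).1 (c.2 i))]).

Definition init (M : TM) (w : seq bool) : config M :=
  (tm_start M,
   [ffun i => ([::], if i == ord0 then [seq Some (inl b) | b <- w] else [::])]).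

Fixpoint leading_bits (A : finType) (s : seq (cell A)) : seq bool :=
  if s is Some (inl b) :: s' then b :: leading_bits s' else [::].

(* The output is the maximal word of bits that starts at the head of tape 0. *)
Definition output (M : TM) (c : config M) : seq bool :=
  leading_bits (c.2 ord0).2.

(* As halting configurations are fixed, the machine is halted after exactly t
   iterations iff it halts in at most t steps. *)
Definition computes_within (M : TM) (t : nat) (x y : seq bool) : Prop :=
  let c := iter t (@step M) (init M x) in tm_halt c.1 /\ output c = y.

Definition polytime (f : seq bool -> seq bool) : Prop :=
  exists (M : TM) (p : {poly nat}),
    forall x, computes_within M p.[size x]%R x (f x).

Definition language := seq bool -> Prop.

Definition polytime_decidable (V : pred (seq bool)) : Prop :=
  polytime (fun x => [:: V x]).

(* Each bit of x is doubled, and 01 separates x from y. *)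
Definition pair_code (x y : seq bool) : seq bool :=
  flatten [seq [:: b; b] | b <- x] ++ [:: false, true & y].

Definition in_NP (L : language) : Prop :=
  exists (V : pred (seq bool)) (q : {poly nat}),
    polytime_decidable V /\
    forall x, L x <->
      exists y, size y <= q.[size x]%R /\ V (pair_code x y).

Definition poly_reduces (L L' : language) : Prop :=
  exists f : seq bool -> seq bool, polytime f /\ forall x, L x <-> L' (f x).

Definition NP_hard (L : language) : Prop :=
  forall L', in_NP L' -> poly_reduces L' L.

Definition NP_complete (L : language) : Prop := in_NP L /\ NP_hard L.

(* A graph with vertex set {0, ..., n-1} is coded by n in unary (1^n 0)
   followed by its adjacency matrix, row by row. *)
Definition graph_code (n : nat) (e : rel 'I_n) : seq bool :=
  nseq n true ++ false :: [seq e i j | i <- enum 'I_n, j <- enum 'I_n].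

(* The decision problem "given a graph G, does P G hold?"; words that code no
   graph are no-instances. *)
Definition graph_problem (P : sgraph -> Prop) : language := fun w =>
  exists (n : nat) (e : rel 'I_n) (es : symmetric e) (ei : irreflexive e),
    w = graph_code e /\ P (SGraph es ei).

(* Main.v *)
Require Import Defs.
From HB Require Import structures.
From mathcomp Require Import all_boot all_order all_algebra.
From mathcomp Require Import boolp zify.

(* Membership: tree-alpha(G) <= k has a certificate consisting of an elimination
   order of a chordal supergraph of G in which every vertex together with its
   later neighbours contains no independent set of size k + 1 of G.

   Hardness: fix a machine verifying a language in NP. Its tableau is described
   by clauses with at most three literals, almost all of them Horn: they force
   the facts that hold in the actual run, so that no uniqueness constraint is
   needed. Clauses become a graph with vertices a_x and b_x for every literal
   occurrence x: the a_x form a clique except for contradictory literals, the b_x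
   form a clique except within a clause, and a_x is adjacent to b_x. Four further
   families L, R, U, V of k-2, k-1, k+1 and k+1 pairwise nonadjacent vertices are
   joined as follows: L to all a_x, to R and to U; R to all b_x and to V; U to all
   a_x; V to all b_x. Since U and V fit into no bag, some bag contains L and all
   a_x, and another one contains R and all b_x. On the path between these bags
   there is an edge st at which L stops being contained in the bag, and there R
   is contained in X_t. Then no clause has all its b_x in X_s (together with L
   there would be k+1 independent vertices) and no two contradictory a_x lie in
   X_t (together with R), while every x has a_x in X_t or b_x in X_s: the
   literals x with a_x in X_t are made true. Conversely a satisfying assignment
   yields a tree decomposition whose bags are covered by k cliques each.

   Both the verifier and the reduction are given by bounded quantification over
   polynomially bounded numbers, and all such predicates are evaluated by
   programs with unary counters, which Turing machines simulate step by step. *)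

Set Implicit Arguments.
Unset Strict Implicit.
Unset Printing Implicit Defensive.

(** * Flowchart programs over registers *)

(** The bound 4 <= k comes from the cliques that cover the bags. As long as false a_x are present,
    the a_x need two cliques, one per sign, each completed by a vertex of L, so |L| = k - 2 must be
    at least 2. In the bags around R, the b_x need one clique for each of the three places in a
    clause, and the true a_x a fourth. The sizes of L and R are tight: L with the three b_x of a
    clause, and R with two contradictory a_x, both make k + 1. A satisfying assignment leaves at
    most two b_x per clause in the bags containing L, and (k - 2) + 2 = k.

    The reduction leads directly from machines to graphs. A clause is a rule of the fixed machine
    placed at a time and a position; hence a vertex is a tag from a constant set together with two
    polynomially bounded numbers, and adjacency is a bounded formula in these numbers. The tableau
    is written in the frame of the heads: they stay at one column and the tapes shift, so no
    variable has to describe a head position. *)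

Inductive instr (L : Type) :=
| IInc of nat & L
| IDec of nat & L & L
| IRead of L & L
| IOut of bool & L.

Definition imap L L' (h : L -> L') (i : instr L) : instr L' :=
  match i with
  | IInc r l => IInc r (h l)
  | IDec r lz l => IDec r (h lz) (h l)
  | IRead l0 l1 => IRead (h l0) (h l1)
  | IOut b l => IOut b (h l)
  end.

Definition regs := nat -> nat.
Definition upd (rho : regs) (r v : nat) : regs :=
  fun i => if i == r then v else rho i.

Definition store := (regs * seq bool)%type.

(* Register 0 is the position of the input head: position 0 carries an end
   marker and position i+1 carries bit i. *)
Definition isem (x : seq bool) L (i : instr L) (s : store) : L * store :=
  match i with
  | IInc r l => (l, (upd s.1 r (s.1 r).+1, s.2))
  | IDec r lz l => if s.1 r is v.+1 then (l, (upd s.1 r v, s.2)) else (lz, s)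
  | IRead l0 l1 => (if nth false (false :: x) (s.1 0) then l1 else l0, s)
  | IOut b l => (l, (s.1, b :: s.2))
  end.

(** [E] is the type of exits. A jump leads to a node or an exit, so fragments are composed by
    renaming labels only. *)
Record frag (E : Type) := Frag {
  fQ : finType;
  fstart : fQ;
  fcode : fQ -> instr (fQ + E) }.

Section Run.
Variables (x : seq bool).

Definition fstep E (A : frag E) (c : (fQ A + E) * store) :=
  match c.1 with
  | inl q => isem x (fcode q) c.2
  | inr _ => c
  end.

(** The number of steps is existential rather than exactly [n]: an exit idles in its own fragment
    but becomes a node of the enclosing one, so padding would not survive [reach_lift]. *)
Definition reach E (A : frag E) n (c c' : (fQ A + E) * store) :=
  exists2 m, m <= n & iter m (@fstep E A) c = c'.

Definition sat E (A : frag E) s n s' e :=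
  @reach E A n (inl (fstart A), s) (inr e, s').

Lemma reach_trans E (A : frag E) n1 n2 c1 c2 c3 :
  @reach E A n1 c1 c2 -> reach n2 c2 c3 -> reach (n1 + n2) c1 c3.
Proof.
move=> [m1 h1 e1] [m2 h2 e2]; exists (m2 + m1); first by rewrite addnC leq_add.
by rewrite iterD e1.
Qed.

Lemma reach_le E (A : frag E) n n' c c' :
  n <= n' -> @reach E A n c c' -> reach n' c c'.
Proof. by move=> h [m hm e]; exists m => //; apply: leq_trans h. Qed.

Lemma isem_map L L' (h : L -> L') i s :
  isem x (imap h i) s = (h (isem x i s).1, (isem x i s).2).
Proof. by case: i => [r l|r lz l|l0 l1|b l] //=; [case: (s.1 r) | case: ifP]. Qed.

Lemma reach_lift E E' (A : frag E) (C : frag E') (hq : fQ A -> fQ C)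
    (h : fQ A + E -> fQ C + E') n q s e s' :
  (forall q, h (inl q) = inl (hq q)) ->
  (forall q, fcode (hq q) = imap h (fcode q)) ->
  @reach E A n (inl q, s) (inr e, s') ->
  @reach E' C n (inl (hq q), s) (h (inr e), s').
Proof.
move=> hl hc [m hm]; elim: m n q s hm => [|m IH] n q s // hm.
rewrite iterSr /fstep /= -/(fstep).
case ei: (isem x (fcode q) s) => [l s1] em.
have step1 : @fstep E' C (inl (hq q), s) = (h l, s1).
  by rewrite /fstep /= hc isem_map ei.
case: l ei em step1 => [q1|e1] ei em step1.
  have [|m' hm' e'] := IH n.-1 q1 s1 _ em; first by case: n hm.
  exists m'.+1; first by case: (n) hm hm'.
  by rewrite iterSr step1 hl.
(* From here on [A] idles at its exit, whereas [C] may go on: the run in [C] is cut after this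
   single step. *)
have ee : iter m (@fstep E A) (inr e1, s1) = (inr e1, s1).
  by elim: (m) => //= k ->.
rewrite ee in em; case: em => <- <-.
by exists 1; [case: n hm | rewrite /= step1].
Qed.

End Run.

Section Combinators.
Variable E : Type.

(** A read with equal targets serves as the no-op. *)
Definition skip (e : E) : frag E :=
  @Frag E unit tt (fun _ => IRead (inr e) (inr e)).

Definition branch_exit (A : frag bool) (B C : frag E) (l : fQ A + bool) :
    fQ A + (fQ B + fQ C) + E :=
  match l with
  | inl q => inl (inl q)
  | inr true => inl (inr (inl (fstart B)))
  | inr false => inl (inr (inr (fstart C)))
  end.

Definition branch (A : frag bool) (B C : frag E) : frag E :=
  @Frag E (fQ A + (fQ B + fQ C))%type (inl (fstart A))
   (fun q => match q with
    | inl a => imap (@branch_exit A B C) (fcode a)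
    | inr (inl b) =>
        imap (fun l => match l with inl q => inl (inr (inl q)) | inr e => inr e end)
          (fcode b)
    | inr (inr c) =>
        imap (fun l => match l with inl q => inl (inr (inr q)) | inr e => inr e end)
          (fcode c)
    end).

Definition loop_exit (A : frag (option E)) (l : fQ A + option E) : fQ A + E :=
  match l with
  | inl q => inl q
  | inr None => inl (fstart A)
  | inr (Some e) => inr e
  end.

Definition loop (A : frag (option E)) : frag E :=
  @Frag E (fQ A) (fstart A) (fun q => imap (@loop_exit A) (fcode q)).

Variable x : seq bool.

Lemma sat_skip e s : sat x (skip e) s 1 s e.
Proof. by exists 1 => //=; rewrite /fstep /= if_same. Qed.

Lemma sat_branch A B C s n1 s1 b n2 s2 e :
  sat x A s n1 s1 b -> sat x (if b then B else C) s1 n2 s2 e ->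
  sat x (branch A B C) s (n1 + n2) s2 e.
Proof.
move=> hA hBC; apply: (@reach_trans x E (branch A B C) n1 n2 _ (branch_exit B C (inr b : fQ A + bool), s1)).
  exact: (@reach_lift x bool E A (branch A B C) inl (@branch_exit A B C) _ _ _ _ _ _ _ hA).
case: b hBC {hA} => hBC.
  by apply: (@reach_lift x _ _ B (branch A B C) (inr \o inl)
      (fun l => match l with inl q => inl (inr (inl q)) | inr e => inr e end)
      _ _ _ _ _ _ _ hBC).
by apply: (@reach_lift x _ _ C (branch A B C) (inr \o inr)
      (fun l => match l with inl q => inl (inr (inr q)) | inr e => inr e end)
      _ _ _ _ _ _ _ hBC).
Qed.

Lemma reach_loop (A : frag (option E)) s1 n s2 o : sat x A s1 n s2 o ->
  reach x (A := loop A) n (inl (fstart A), s1) (loop_exit (inr o), s2).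
Proof. exact: (@reach_lift x _ _ A (loop A) id). Qed.

Lemma sat_loopS (A : frag (option E)) s1 n1 s2 n2 s3 e :
  sat x A s1 n1 s2 None -> sat x (loop A) s2 n2 s3 e ->
  sat x (loop A) s1 (n1 + n2) s3 e.
Proof. by move=> /reach_loop h1 h2; apply: reach_trans h1 h2. Qed.

(** [f i] is the store at the start of round i: the rounds below [m] ask for a repetition, and round
    [m] leaves. *)
Lemma sat_loop (A : frag (option E)) (f : nat -> store) m n s' e :
  (forall i, i < m -> sat x A (f i) n (f i.+1) None) ->
  sat x A (f m) n s' (Some e) ->
  sat x (loop A) (f 0) (m.+1 * n) s' e.
Proof.
move=> hs he; suff H : forall j, j <= m ->
    sat x (loop A) (f (m - j)) (j.+1 * n) s' e by move: (H m); rewrite subnn; apply.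
elim=> [|j IH] hj; first by rewrite subn0 mul1n; apply: reach_loop he.
rewrite mulSn; apply: sat_loopS (hs (m - j.+1) _) _; first by lia.
by rewrite subnSK //; apply: IH; apply: ltnW.
Qed.

End Combinators.

Definition finc r : frag bool := @Frag bool unit tt (fun _ => IInc r (inr true)).
Definition fdec r : frag bool :=
  @Frag bool unit tt (fun _ => IDec r (inr false) (inr true)).
Definition fread : frag bool :=
  @Frag bool unit tt (fun _ => IRead (inr false) (inr true)).
Definition fout b : frag bool := @Frag bool unit tt (fun _ => IOut b (inr true)).
Definition fseq E (A : frag bool) (B : frag E) := branch A B B.

Lemma sat_le x E (A : frag E) s n n' s' e :
  n <= n' -> sat x A s n s' e -> sat x A s n' s' e.
Proof. exact: reach_le. Qed.

Lemma sat_seq x E A (B : frag E) s n1 s1 b n2 s2 e :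
  sat x A s n1 s1 b -> sat x B s1 n2 s2 e -> sat x (fseq A B) s (n1 + n2) s2 e.
Proof. by move=> hA hB; apply: sat_branch hA _; case: b. Qed.

Lemma sat_inc x r rho o :
  sat x (finc r) (rho, o) 1 (upd rho r (rho r).+1, o) true.
Proof. by exists 1. Qed.

Lemma sat_decS x r v rho o : rho r = v.+1 ->
  sat x (fdec r) (rho, o) 1 (upd rho r v, o) true.
Proof. by move=> h; exists 1 => //=; rewrite /fstep /= h. Qed.

Lemma sat_dec0 x r rho o : rho r = 0 ->
  sat x (fdec r) (rho, o) 1 (rho, o) false.
Proof. by move=> h; exists 1 => //=; rewrite /fstep /= h. Qed.

Lemma sat_read x rho o :
  sat x fread (rho, o) 1 (rho, o) (nth false (false :: x) (rho 0)).
Proof. by exists 1 => //=; rewrite /fstep /=; case: ifP. Qed.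

Lemma sat_out x b rho o : sat x (fout b) (rho, o) 1 (rho, b :: o) true.
Proof. by exists 1. Qed.

Definition fmove r r' : frag bool :=
  loop (branch (fdec r) (fseq (finc r') (skip None)) (skip (Some true))).

Lemma sat_move x r r' rho o : r != r' ->
  sat x (fmove r r') (rho, o) (3 * (rho r).+1)
    (upd (upd rho r 0) r' (rho r' + rho r), o) true.
Proof.
move=> rr'.
have -> : (rho, o) = (upd (upd rho r (rho r - 0)) r' (rho r' + 0), o).
  congr (_, _); apply: funext => i; rewrite /upd subn0 addn0.
  by case: eqP => [->|] //; case: eqP => [->|].
set f := fun i => (upd (upd rho r (rho r - i)) r' (rho r' + i), o).
have hr i : (f i).1 r = rho r - i.
  by rewrite /f /upd /= (negPf rr') eqxx.
rewrite -/(f 0) mulnC.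
apply: (@sat_loop _ x _ f) => [i hi|].
  apply: (@sat_branch _ x _ _ _ _ 1 (upd (f i).1 r (rho r - i.+1), o) true 2).
    by apply: sat_decS; apply: etrans (hr i) _; lia.
  apply: (@sat_seq _ _ _ _ _ 1 _ true 1); first exact: sat_inc.
  have -> : f i.+1 = (upd (upd (f i).1 r (rho r - i.+1)) r'
                      ((upd (f i).1 r (rho r - i.+1)) r').+1, o).
    congr (_, _); apply: funext => j; rewrite /f /upd /= eqxx.
    have -> : (r' == r) = false by rewrite eq_sym; apply/negbTE.
    by rewrite addnS; case: (j =P r') => // _; case: (j =P r).
  exact: sat_skip.
have -> : (upd (upd rho r 0) r' (rho r' + rho r), o) = f (rho r).
  by rewrite /f subnn.
apply: (@sat_le _ _ _ _ 2) => //.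
apply: (@sat_branch _ x _ _ _ _ 1 (f (rho r)) false 1); last exact: sat_skip.
by apply: sat_dec0; apply: etrans (hr _) (subnn _).
Qed.

Definition fclear r : frag bool :=
  loop (branch (fdec r) (skip None) (skip (Some true))).

Lemma sat_clear x r rho o :
  sat x (fclear r) (rho, o) (2 * (rho r).+1) (upd rho r 0, o) true.
Proof.
have -> : (rho, o) = (upd rho r (rho r - 0), o).
  by congr (_, _); apply: funext => i; rewrite /upd subn0; case: eqP => [->|].
set f := fun i => (upd rho r (rho r - i), o).
have hr i : (f i).1 r = rho r - i by rewrite /f /upd /= eqxx.
rewrite -/(f 0) mulnC.
apply: (@sat_loop _ x _ f) => [i hi|].
  apply: (@sat_branch _ x _ _ _ _ 1 (upd (f i).1 r (rho r - i.+1), o) true 1).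
    by apply: sat_decS; apply: etrans (hr i) _; lia.
  have -> : f i.+1 = (upd (f i).1 r (rho r - i.+1), o).
    by congr (_, _); apply: funext => j; rewrite /f /upd /=; case: (j =P r).
  exact: sat_skip.
have -> : (upd rho r 0, o) = f (rho r) by rewrite /f subnn.
apply: (@sat_branch _ x _ _ _ _ 1 (f (rho r)) false 1); last exact: sat_skip.
by apply: sat_dec0; apply: etrans (hr _) (subnn _).
Qed.

(** * Predicates and terms computable in polynomial time *)

(** Monotonicity is included because time bounds get evaluated at upper bounds of the measure. The
    base m + 2 is at least 2, so that sums and constants are absorbed by a larger exponent even at m
    = 0. *)
Definition pol (f : nat -> nat) :=
  {homo f : m n / m <= n} /\ exists c, forall m, f m <= (m + 2) ^ c.

Lemma pol_const k : pol (fun _ => k).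
Proof.
split=> //; exists k => m; apply: leq_trans (ltnW (ltn_expl k (ltnSn 1))) _.
by case: k => // k; rewrite leq_exp2r // leq_addl.
Qed.

Lemma pol_id : pol id.
Proof. by split=> //; exists 1 => m; rewrite expn1 leq_addr. Qed.

Lemma pol_add f g : pol f -> pol g -> pol (fun m => f m + g m).
Proof.
move=> [hf [c1 h1]] [hg [c2 h2]]; split=> [m n mn|]; first by rewrite leq_add ?hf ?hg.
exists (maxn c1 c2).+1 => m; rewrite expnS.
have e1 : f m <= (m + 2) ^ maxn c1 c2.
  by apply: leq_trans (h1 m) _; rewrite leq_pexp2l ?leq_maxl // addn2.
have e2 : g m <= (m + 2) ^ maxn c1 c2.
  by apply: leq_trans (h2 m) _; rewrite leq_pexp2l ?leq_maxr // addn2.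
by apply: leq_trans (leq_add e1 e2) _; rewrite addnn -mul2n leq_mul // leq_addl.
Qed.

Lemma pol_mul f g : pol f -> pol g -> pol (fun m => f m * g m).
Proof.
move=> [hf [c1 h1]] [hg [c2 h2]]; split=> [m n mn|]; first by rewrite leq_mul ?hf ?hg.
by exists (c1 + c2) => m; rewrite expnD leq_mul.
Qed.

Lemma pol_comp f g : pol f -> pol g -> pol (fun m => f (g m)).
Proof.
move=> [hf [c1 h1]] [hg [c2 h2]]; split=> [m n mn|]; first exact/hf/hg.
(* For z = (m + 2) ^ c2 >= 1 one has z + 2 <= 4 * z <= (m + 2) ^ c2.+2. *)
exists (c2.+2 * c1) => m; apply: leq_trans (hf _ _ (h2 m)) _.
apply: leq_trans (h1 _) _; case: (c1) => [|c]; first by rewrite muln0.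
rewrite expnM leq_exp2r // !expnS.
have : 0 < (m + 2) ^ c2 by rewrite expn_gt0 addn2.
set z := (m + 2) ^ c2; nia.
Qed.

Ltac pol_tac := repeat first
  [ assumption | exact: pol_id | exact: pol_const | apply: pol_add | apply: pol_mul
  | match goal with H : pol ?f |- pol (fun m => ?f (@?g m)) =>
      apply: (@pol_comp f g H) end ].

(** Registers are unary counters, so the cost is measured by the values of the variables and not by
    their lengths in binary. *)
Definition msr (x : seq bool) (e : seq nat) := size x + sumn e.

Definition okst (x : seq bool) (rho : regs) b :=
  [/\ rho 0 = 0, rho 1 = size x & forall i, b <= i -> rho i = 0].

(* The variables of [phi] are read from the registers [loc]; registers from [b] on
   are zero and serve as work space. A bound variable is a countdown register. *)
Definition PP d (phi : seq bool -> seq nat -> bool) :=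
  forall loc b, size loc = d -> all (fun r => r < b) loc -> 2 <= b ->
  exists (A : frag bool) T, pol T /\ forall x rho o, okst x rho b ->
    sat x A (rho, o) (T (msr x (map rho loc))) (rho, o) (phi x (map rho loc)).

Definition TTc d (t : seq bool -> seq nat -> nat) :=
  forall loc b, size loc = d -> all (fun r => r < b) loc -> 2 <= b ->
  exists (A : frag bool) T, pol T /\ forall x rho o, okst x rho b ->
    sat x A (rho, o) (T (msr x (map rho loc)))
      (upd rho b (t x (map rho loc)), o) true.

(** The value needs a bound besides the running time: a term may control a loop or bound a
    quantified variable, and its value then enters the cost of what follows. *)
Definition TT d (t : seq bool -> seq nat -> nat) :=
  TTc d t /\
  exists T, pol T /\ forall x e, size e = d -> t x e <= T (msr x e).

Lemma upd_ok x rho b v : 2 <= b -> okst x rho b -> okst x (upd rho b v) b.+1.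
Proof.
move=> b2 [h0 h1 hz]; split; rewrite /upd; try by case: eqP => //; lia.
by move=> i hi; case: eqP => [|_]; [lia | apply: hz; apply: ltnW].
Qed.

Lemma map_upd rho b v loc :
  all (fun r => r < b) loc -> map (upd rho b v) loc = map rho loc.
Proof.
by move/allP=> h; apply/eq_in_map => r /h hr; rewrite /upd ltn_eqF.
Qed.

Lemma all_ltS b loc : all (fun r => r < b) loc -> all (fun r => r < b.+1) loc.
Proof. by apply: sub_all => r; apply: ltnW. Qed.

Lemma upd_upd rho r v w : upd (upd rho r v) r w = upd rho r w.
Proof. by apply: funext => i; rewrite /upd; case: eqP. Qed.

Lemma upd_same rho r : upd rho r (rho r) = rho.
Proof. by apply: funext => i; rewrite /upd; case: eqP => [->|]. Qed.

Lemma upd_id rho r v : rho r = v -> upd rho r v = rho.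
Proof. by move=> <-; exact: upd_same. Qed.

Lemma updC rho r s v w : r != s -> upd (upd rho r v) s w = upd (upd rho s w) r v.
Proof.
move=> rs; apply: funext => i; rewrite /upd; case: eqP => // ->.
by case: eqP => // e; move: rs; rewrite e eqxx.
Qed.

Lemma updE rho r v : upd rho r v r = v. Proof. by rewrite /upd eqxx. Qed.
Lemma updN rho r v s : s != r -> upd rho r v s = rho s.
Proof. by rewrite /upd => /negbTE ->. Qed.

Lemma TT_ext d t t' : (forall x e, t x e = t' x e) -> TT d t -> TT d t'.
Proof. by move=> h; have -> : t = t' by apply: funext => x; apply: funext => e. Qed.
Lemma PP_ext d t t' : (forall x e, t x e = t' x e) -> PP d t -> PP d t'.
Proof. by move=> h; have -> : t = t' by apply: funext => x; apply: funext => e. Qed.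

Lemma TT_S d t : TT d t -> TT d (fun x e => (t x e).+1).
Proof.
case=> hc [T [pT hT]]; split; last first.
  exists (fun m => T m + 1); split; first by pol_tac.
  by move=> x e he; rewrite addn1 ltnS hT.
move=> loc b hl hb b2; have [A [U [pU hU]]] := hc loc b hl hb b2.
exists (fseq A (finc b)), (fun m => U m + 1); split; first by pol_tac.
move=> x rho o ok; apply: sat_seq (hU x rho o ok) _.
have := sat_inc x b (upd rho b (t x (map rho loc))) o.
by rewrite updE upd_upd.
Qed.

Lemma TT_0 d : TT d (fun _ _ => 0).
Proof.
split; last by exists (fun=> 0); split => //; exact: pol_const.
move=> loc b hl hb b2; exists (skip true), (fun=> 1); split; first exact: pol_const.
move=> x rho o [_ _ hz]; rewrite upd_id ?hz //; exact: sat_skip.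
Qed.

Lemma TT_const d n : TT d (fun _ _ => n).
Proof. by elim: n => [|n IH]; [exact: TT_0 | exact: TT_S IH]. Qed.

(** A counter is read by emptying it: [r] is drained into [b] and [b.+1] at once and then restored
    from [b.+1]. *)
Definition fcopy r b : frag bool :=
  fseq (loop (branch (fdec r) (fseq (finc b) (fseq (finc b.+1) (skip None)))
                (skip (Some true)))) (fmove b.+1 r).

Lemma sat_copy x r b rho o : r < b -> rho b = 0 -> rho b.+1 = 0 ->
  sat x (fcopy r b) (rho, o) (7 * (rho r).+1) (upd rho b (rho r), o) true.
Proof.
move=> rb z0 z1.
have r0 : (r == b) = false by lia.
have r1 : (r == b.+1) = false by lia.
have r2 : (b == b.+1) = false by lia.
pose f i := (upd (upd (upd rho r (rho r - i)) b i) b.+1 i, o).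
have f0 : f 0 = (rho, o).
  rewrite /f subn0 upd_same upd_id ?upd_id ?z0 ?z1 //.
have hr i : (f i).1 r = rho r - i by rewrite /f /upd /= r1 r0 eqxx.
apply: (@sat_le _ _ _ _ ((rho r).+1 * 4 + 3 * ((rho r).+1))); first by lia.
apply: (@sat_seq _ _ _ _ _ _ (f (rho r)) true).
  rewrite -f0; apply: (@sat_loop _ x _ f) => [i hi|].
    apply: (@sat_branch _ x _ _ _ _ 1 (upd (f i).1 r (rho r - i.+1), o) true 3).
      by apply: sat_decS; apply: etrans (hr i) _; lia.
    apply: (@sat_seq _ _ _ _ _ 1 _ true 2); first exact: sat_inc.
    apply: (@sat_seq _ _ _ _ _ 1 _ true 1); first exact: sat_inc.
    set s := (X in sat _ _ X); have -> : s = f i.+1; last exact: sat_skip.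
    rewrite /s /f /=; congr (_, _); apply: funext => j; rewrite /upd /=.
    rewrite ![b == _]eq_sym ![b.+1 == _]eq_sym ?r0 ?r1 ?eqxx /=.
    have h1 : (b.+1 == b) = false by lia.
    rewrite ?h1 ?r2 /=.
    case: (j =P b.+1) => // _; case: (j =P b) => // _; by case: (j =P r).
  apply: (@sat_le _ _ _ _ 2) => //.
  apply: (@sat_branch _ x _ _ _ _ 1 (f (rho r)) false 1); last exact: sat_skip.
  by apply: sat_dec0; apply: etrans (hr _) (subnn _).
have := @sat_move x b.+1 r (f (rho r)).1 o.
rewrite eq_sym r1 -/(f (rho r)) => /(_ isT).
have -> : (f (rho r)).1 b.+1 = rho r by rewrite /= updE.
suff -> : upd (upd (f (rho r)).1 b.+1 0) r ((f (rho r)).1 r + rho r) =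
          upd rho b (rho r) by [].
rewrite hr subnn add0n /=; apply: funext => j; rewrite /upd.
case: (j =P r) => [->|_]; first by rewrite r0.
by case: (j =P b.+1) => [->|//]; rewrite z1 eq_sym r2.
Qed.

Lemma sumn_nth_le (e : seq nat) i : nth 0 e i <= sumn e.
Proof.
elim: e i => [|a e IH] [|i] //=; first by rewrite leq_addr.
by apply: leq_trans (IH i) _; rewrite leq_addl.
Qed.

Lemma TT_nth d i : i < d -> TT d (fun _ e => nth 0 e i).
Proof.
move=> ltid; split; last first.
  exists id; split; first exact: pol_id.
  by move=> x e _; apply: leq_trans (sumn_nth_le e i) (leq_addl _ _).
move=> loc b hl hb b2; exists (fcopy (nth 0 loc i) b), (fun m => 7 * (m + 1)).
split; first by pol_tac.
move=> x rho o [_ _ hz]; rewrite (nth_map 0) ?hl //.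
have hr : nth 0 loc i < b by apply: (allP hb); rewrite mem_nth ?hl.
apply: sat_le (sat_copy x o hr _ _); try by apply: hz; lia.
rewrite addn1 leq_mul2l ltnS /= -(nth_map 0 0) ?hl //.
exact: leq_trans (sumn_nth_le _ i) (leq_addl _ _).
Qed.

Lemma TT_size d : TT d (fun x e => size x).
Proof.
split; last first.
  exists id; split; first exact: pol_id.
  by move=> x e _; apply: leq_addr.
move=> loc b hl hb b2; exists (fcopy 1 b), (fun m => 7 * (m + 1)).
split; first by pol_tac.
move=> x rho o [_ h1 hz]; rewrite -h1.
apply: sat_le (sat_copy x o _ _ _) => //; try by apply: hz; lia.
by rewrite addn1 leq_mul2l ltnS /= h1 leq_addr.
Qed.

Lemma msr_behead x e : msr x (behead e) <= msr x e.
Proof. by rewrite leq_add2l; case: e => //= a e; apply: leq_addl. Qed.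

Lemma TT_weak d t : TT d t -> TT d.+1 (fun x e => t x (behead e)).
Proof.
case=> hc [T [pT hT]]; split; last first.
  exists T; split=> // x [|a e] //= [he]; apply: leq_trans (hT _ _ he) _.
  by apply: pT.1; apply: (msr_behead x (a :: e)).
move=> [|r loc] b //= [hl] /andP[_ hb] b2.
have [A [U [pU hU]]] := hc loc b hl hb b2; exists A, U; split=> // x rho o ok.
by apply: sat_le (hU x rho o ok); apply: pU.1; apply: (msr_behead x (rho r :: _)).
Qed.

Lemma PP_weak d t : PP d t -> PP d.+1 (fun x e => t x (behead e)).
Proof.
move=> hc [|r loc] b //= [hl] /andP[_ hb] b2.
have [A [U [pU hU]]] := hc loc b hl hb b2; exists A, U; split=> // x rho o ok.
by apply: sat_le (hU x rho o ok); apply: pU.1; apply: (msr_behead x (rho r :: _)).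
Qed.

Lemma TT_weakn n d t : TT d t -> TT (n + d) (fun x e => t x (iter n behead e)).
Proof.
move=> h; elim: n => [|n IH] //; apply: TT_ext (TT_weak IH) => x e.
by rewrite iterSr.
Qed.

(** Variables are de Bruijn indices: each quantifier puts its variable in front of [e], so this is
    the shape in which the n-th variable occurs in goals. *)
Lemma TT_headn n d : TT (n.+1 + d) (fun x e => head 0 (iter n behead e)).
Proof.
apply: TT_ext (@TT_nth _ n _) => [x e|]; last by rewrite addSn leq_addr.
by rewrite -drop_behead -nth0 nth_drop addn0.
Qed.

Lemma TT_add d t1 t2 : TT d t1 -> TT d t2 -> TT d (fun x e => t1 x e + t2 x e).
Proof.
case=> hc1 [T1 [pT1 hT1]] [hc2 [T2 [pT2 hT2]]]; split; last first.
  exists (fun m => T1 m + T2 m); split; first by pol_tac.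
  by move=> x e he; rewrite leq_add ?hT1 ?hT2.
move=> loc b hl hb b2; have [A1 [U1 [pU1 hU1]]] := hc1 loc b hl hb b2.
have [A2 [U2 [pU2 hU2]]] := hc2 loc b.+1 hl (all_ltS hb) (leqW b2).
exists (fseq A1 (fseq A2 (fmove b.+1 b))),
  (fun m => U1 m + (U2 m + 3 * (T2 m + 1))); split; first by pol_tac.
move=> x rho o ok; set m := msr x _; set e := map rho loc.
apply: sat_seq (hU1 x rho o ok) _; set rho1 := upd rho b _.
have ok1 : okst x rho1 b.+1 by apply: upd_ok.
have e1 : map rho1 loc = e by apply: map_upd.
have := hU2 x rho1 o ok1; rewrite e1 -/m => h2.
apply: sat_seq h2 _; set rho2 := upd rho1 b.+1 _.
have hne : b.+1 != b by lia.
have hne' : b != b.+1 by lia.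
have := sat_move x rho2 o hne.
have r2E : rho2 b.+1 = t2 x e := updE _ _ _; rewrite r2E.
have hz : rho b.+1 = 0 by case: ok => _ _; apply.
have -> : upd (upd rho2 b.+1 0) b (rho2 b + t2 x e) = upd rho b (t1 x e + t2 x e).
  rewrite /rho2 upd_upd updN // /rho1 updE.
  by rewrite updC // upd_upd upd_id // updN.
by apply: sat_le; rewrite leq_mul2l addn1 ltnS hT2 ?orbT // size_map.
Qed.

(** Repeated addition: the first factor counts down at [b.+1], and in each round the second one is
    evaluated anew at [b.+2] and moved onto [b]. *)
Lemma TT_mul d t1 t2 : TT d t1 -> TT d t2 -> TT d (fun x e => t1 x e * t2 x e).
Proof.
case=> hc1 [T1 [pT1 hT1]] [hc2 [T2 [pT2 hT2]]]; split; last first.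
  exists (fun m => T1 m * T2 m); split; first by pol_tac.
  by move=> x e he; rewrite leq_mul ?hT1 ?hT2.
move=> loc b hl hb b2.
have [A1 [U1 [pU1 hU1]]] := hc1 loc b.+1 hl (all_ltS hb) (leqW b2).
have [A2 [U2 [pU2 hU2]]] := hc2 loc b.+2 hl (all_ltS (all_ltS hb)) (leqW (leqW b2)).
exists (fseq A1 (loop (branch (fdec b.+1)
          (fseq A2 (fseq (fmove b.+2 b) (skip None))) (skip (Some true))))).
exists (fun m => U1 m + (T1 m + 1) * (1 + (U2 m + (3 * (T2 m + 1) + 1)))).
split; first by pol_tac.
move=> x rho o ok; set m := msr x _; set e := map rho loc.
have okS : okst x rho b.+1 by case: ok => h0 h1 hz; split=> // i hi; apply/hz/ltnW.
apply: sat_seq (hU1 x rho o okS) _; rewrite -/e.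
have he : size e = d by rewrite size_map.
pose f i := (upd (upd rho b.+1 (t1 x e - i)) b (i * t2 x e), o).
have f0 : f 0 = (upd rho b.+1 (t1 x e), o).
  rewrite /f subn0 mul0n [upd (upd _ _ _) b 0]upd_id // updN; last by lia.
  by case: ok => _ _; apply.
set N := 1 + _.
apply: (@sat_le _ _ _ _ ((t1 x e).+1 * N)).
  by rewrite leq_mul2r addn1 ltnS hT1 ?orbT.
have hr i : (f i).1 b.+1 = t1 x e - i.
  by rewrite /f /= updN ?updE //; lia.
rewrite -f0; apply: (@sat_loop _ x _ f) => [i hi|].
  apply: (@sat_branch _ x _ _ _ _ 1 (upd (f i).1 b.+1 (t1 x e - i.+1), o) true).
    by apply: sat_decS; apply: etrans (hr i) _; lia.
  set rho1 := upd _ _ _.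
  have e1 : rho1 = upd (upd rho b.+1 (t1 x e - i.+1)) b (i * t2 x e).
    by rewrite /rho1 /f /= updC ?upd_upd //; lia.
  have ok1 : okst x rho1 b.+2.
    case: ok => h0 h1 hz; rewrite e1; split; rewrite ?updN //; try lia.
    by move=> j hj; rewrite !updN ?hz //; lia.
  have em : map rho1 loc = e by rewrite e1 map_upd // map_upd // all_ltS.
  have := hU2 x rho1 o ok1; rewrite em -/m => h2; apply: sat_seq h2 _.
  set rho2 := upd rho1 b.+2 _; have hne : b.+2 != b by lia.
  have hne' : b != b.+2 by lia.
  have := sat_move x rho2 o hne.
  have r2E : rho2 b.+2 = t2 x e := updE _ _ _; rewrite r2E.
  have -> : (upd (upd rho2 b.+2 0) b (rho2 b + t2 x e), o) = f i.+1.
    rewrite /f; congr (_, _); rewrite /rho2 upd_upd [upd rho1 _ 0]upd_id; last first.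
      by case: ok1 => _ _; apply.
    rewrite updN ?e1; last by lia.
    by rewrite updE upd_upd mulSn addnC.
  move=> h3; apply: sat_seq _ (sat_skip _ _ _); apply: sat_le h3.
  by rewrite leq_mul2l addn1 ltnS hT2 // ?size_map ?orbT.
have -> : (upd rho b (t1 x e * t2 x e), o) = f (t1 x e).
  rewrite /f subnn [upd rho _ 0]upd_id //; by case: ok => _ _; apply; lia.
apply: (@sat_le _ _ _ _ 2); first by rewrite /N; lia.
apply: (@sat_branch _ x _ _ _ _ 1 (f (t1 x e)) false 1); last exact: sat_skip.
by apply: sat_dec0; apply: etrans (hr _) (subnn _).
Qed.

(** Both counters are decremented in turn, [t1] first so that a tie counts as true; what is left is
    cleared to restore the work space. *)
Lemma PP_leq d t1 t2 : TT d t1 -> TT d t2 -> PP d (fun x e => t1 x e <= t2 x e).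
Proof.
case=> hc1 [T1 [pT1 hT1]] [hc2 [T2 [pT2 hT2]]].
move=> loc b hl hb b2; have [A1 [U1 [pU1 hU1]]] := hc1 loc b hl hb b2.
have [A2 [U2 [pU2 hU2]]] := hc2 loc b.+1 hl (all_ltS hb) (leqW b2).
pose clr (r : bool) := fseq (fclear b) (fseq (fclear b.+1) (skip r)).
exists (fseq A1 (fseq A2 (branch (loop (branch (fdec b)
   (branch (fdec b.+1) (skip None) (skip (Some false))) (skip (Some true))))
   (clr true) (clr false)))).
exists (fun m => U1 m + (U2 m + ((T1 m + 1) * 3 +
   (2 * (T1 m + 1) + (2 * (T2 m + 1) + 1))))); split; first by pol_tac.
move=> x rho o ok; set m := msr x _; set e := map rho loc.
apply: sat_seq (hU1 x rho o ok) _; set rho1 := upd rho b _.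
have ok1 : okst x rho1 b.+1 by apply: upd_ok.
have e1 : map rho1 loc = e by apply: map_upd.
have := hU2 x rho1 o ok1; rewrite e1 -/m => h2.
apply: sat_seq h2 _; rewrite -/e in rho1 ok1 e1 *.
have hne : b != b.+1 by lia.
have hne' : b.+1 != b by lia.
pose f i := (upd (upd rho b (t1 x e - i)) b.+1 (t2 x e - i), o).
have he : size e = d by rewrite size_map.
have h1 := hT1 x e he; have h2' := hT2 x e he; rewrite -/m in h1 h2'.
have -> : (upd rho1 b.+1 (t2 x e), o) = f 0 by rewrite /f !subn0.
have hr i : (f i).1 b = t1 x e - i by rewrite /f /= updN ?updE.
have hr' i : (f i).1 b.+1 = t2 x e - i by rewrite /f /= updE.
have hstep i rho' : rho' = upd (f i).1 b (t1 x e - i.+1) -> upd rho' b.+1 (t2 x e - i.+1) = (f i.+1).1.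
  by move=> ->; rewrite /f /= updC // upd_upd updC // !upd_upd updC //.
have hclr rho' r : rho' b <= t1 x e -> rho' b.+1 <= t2 x e ->
    upd (upd rho' b 0) b.+1 0 = rho ->
    sat x (clr r) (rho', o) (2 * (T1 m + 1) + (2 * (T2 m + 1) + 1)) (rho, o) r.
  move=> l1 l2 eqr; apply: (@sat_seq _ _ _ _ _ _ (upd rho' b 0, o) true).
    apply: sat_le (sat_clear _ _ _ _); lia.
  apply: (@sat_seq _ _ _ _ _ _ (rho, o) true); last exact: sat_skip.
  rewrite -eqr; apply: sat_le (sat_clear _ _ _ _).
  by rewrite updN //; lia.
have z0 : rho b = 0 by case: ok => _ _; apply.
have z1 : rho b.+1 = 0 by case: ok => _ _; apply.
have hrho : upd (upd rho b 0) b.+1 0 = rho by rewrite !upd_id.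
case: (leqP (t1 x e) (t2 x e)) => hle.
  apply: (@sat_branch _ x _ _ _ _ _ (f (t1 x e)) true).
    apply: (@sat_le _ _ _ _ ((t1 x e).+1 * 3)); first by lia.
    apply: (@sat_loop _ x _ f) => [i hi|].
      apply: (@sat_branch _ x _ _ _ _ 1 (upd (f i).1 b (t1 x e - i.+1), o) true 2).
        by apply: sat_decS; apply: etrans (hr i) _; lia.
      apply: (@sat_branch _ x _ _ _ _ 1 (f i.+1) true 1); last exact: sat_skip.
      have -> : f i.+1 = ((f i.+1).1, o) by [].
      rewrite -(@hstep i _ erefl); apply: sat_decS.
      by rewrite updN //; apply: etrans (hr' i) _; lia.
    apply: (@sat_le _ _ _ _ 2) => //.
    apply: (@sat_branch _ x _ _ _ _ 1 (f (t1 x e)) false 1); last exact: sat_skip.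
    by apply: sat_dec0; apply: etrans (hr _) (subnn _).
  apply: hclr; rewrite ?[X in X <= _]hr ?[X in X <= _]hr' ?leq_subr //.
  rewrite /f /=.
  by rewrite updC // upd_upd updC // !upd_upd.
apply: (@sat_branch _ x _ _ _ _ _ (upd (f (t2 x e)).1 b (t1 x e - (t2 x e).+1), o) false).
  apply: (@sat_le _ _ _ _ ((t2 x e).+1 * 3)); first by lia.
  apply: (@sat_loop _ x _ f) => [i hi|].
    apply: (@sat_branch _ x _ _ _ _ 1 (upd (f i).1 b (t1 x e - i.+1), o) true 2).
      by apply: sat_decS; apply: etrans (hr i) _; lia.
    apply: (@sat_branch _ x _ _ _ _ 1 (f i.+1) true 1); last exact: sat_skip.
    have -> : f i.+1 = ((f i.+1).1, o) by [].
    rewrite -(@hstep i _ erefl); apply: sat_decS.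
    by rewrite updN //; apply: etrans (hr' i) _; lia.
  set rho3 := upd _ _ _.
  apply: (@sat_branch _ x _ _ _ _ 1 (rho3, o) true 2).
    by apply: sat_decS; apply: etrans (hr _) _; lia.
  apply: (@sat_branch _ x _ _ _ _ 1 (rho3, o) false 1); last exact: sat_skip.
  by apply: sat_dec0; rewrite /rho3 updN //; apply: etrans (hr' _) (subnn _).
apply: hclr; rewrite ?updE ?leq_subr //.
  by rewrite updN //; apply: leq_trans (eq_leq (hr' _)) (leq_subr _ _).
rewrite /f /=.
by rewrite upd_upd updC // upd_upd updC // !upd_upd.
Qed.

Lemma PP_bit d t : TT d t -> PP d (fun x e => nth false x (t x e)).
Proof.
case=> hc [T [pT hT]] loc b hl hb b2; have [A [U [pU hU]]] := hc loc b hl hb b2.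
exists (fseq A (fseq (fmove b 0) (fseq (finc 0) (branch fread
   (fseq (fclear 0) (skip true)) (fseq (fclear 0) (skip false)))))).
exists (fun m => U m + (3 * (T m + 1) + (1 + (1 + (2 * (T m + 2) + 1))))).
split; first by pol_tac.
move=> x rho o ok; set m := msr x _; set e := map rho loc.
have hTm : t x e <= T m by apply: hT; rewrite size_map.
have [h0 h1 hz] := ok.
have b0 : b != 0 by lia.
have b0' : 0 != b by lia.
apply: sat_seq (hU x rho o ok) _; rewrite -/e; set rho1 := upd rho b _.
have := sat_move x rho1 o b0; have r1E : rho1 b = t x e := updE _ _ _; rewrite r1E => hm.
apply: (@sat_seq _ _ _ _ _ _ (upd rho 0 (t x e), o) true).
  have -> : upd rho 0 (t x e) = upd (upd rho1 b 0) 0 (rho1 0 + t x e).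
    have -> : upd rho1 b 0 = rho by rewrite /rho1 upd_upd upd_id ?hz.
    by rewrite /rho1 updN // h0.
  by apply: sat_le hm; lia.
(* The additional increment steps over the end marker at position 0. *)
apply: (@sat_seq _ _ _ _ _ _ (upd rho 0 (t x e).+1, o) true).
  by have := sat_inc x 0 (upd rho 0 (t x e)) o; rewrite updE upd_upd.
apply: sat_branch; first exact: sat_read.
rewrite updE /=.
have hcl r : sat x (fseq (fclear 0) (skip r)) (upd rho 0 (t x e).+1, o)
     (2 * (T m + 2) + 1) (rho, o) r.
  apply: (@sat_seq _ _ _ _ _ _ (rho, o) true); last exact: sat_skip.
  have := sat_clear x 0 (upd rho 0 (t x e).+1) o.
  rewrite updE upd_upd (upd_id h0) => h; apply: sat_le h; lia.
by case: (nth false x (t x e)).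
Qed.

Lemma PP_neg d p : PP d p -> PP d (fun x e => ~~ p x e).
Proof.
move=> h loc b hl hb b2; have [A [U [pU hU]]] := h loc b hl hb b2.
exists (branch A (skip false) (skip true)), (fun m => U m + 1); split; first by pol_tac.
move=> x rho o ok; apply: sat_branch (hU x rho o ok) _.
by case: (p x _); apply: sat_skip.
Qed.

Lemma PP_and d p q : PP d p -> PP d q -> PP d (fun x e => p x e && q x e).
Proof.
move=> h h' loc b hl hb b2; have [A [U [pU hU]]] := h loc b hl hb b2.
have [B [V [pV hV]]] := h' loc b hl hb b2.
exists (branch A B (skip false)), (fun m => U m + (V m + 1)); split; first by pol_tac.
move=> x rho o ok; apply: sat_branch (hU x rho o ok) _.
case: (p x _); last by apply: sat_le (sat_skip _ _ _); rewrite leq_addl.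
by apply: sat_le (hV x rho o ok); rewrite leq_addr.
Qed.

Lemma PP_or d p q : PP d p -> PP d q -> PP d (fun x e => p x e || q x e).
Proof.
move=> h h'; apply: PP_ext (PP_neg (PP_and (PP_neg h) (PP_neg h'))) => x e.
by rewrite negb_and !negbK.
Qed.

Lemma PP_imply d p q : PP d p -> PP d q -> PP d (fun x e => p x e ==> q x e).
Proof.
move=> h h'; apply: PP_ext (PP_or (PP_neg h) h') => x e.
by rewrite implybE.
Qed.

Lemma PP_const d c : PP d (fun _ _ => c).
Proof.
move=> loc b _ _ _; exists (skip c), (fun=> 1); split; first exact: pol_const.
by move=> x rho o _; apply: sat_skip.
Qed.

Lemma PP_eqb d p q : PP d p -> PP d q -> PP d (fun x e => p x e == q x e).
Proof.
move=> h h'; apply: PP_ext (PP_and (PP_imply h h') (PP_imply h' h)) => x e.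
by case: (p x e); case: (q x e).
Qed.

Lemma PP_eqn d t1 t2 : TT d t1 -> TT d t2 -> PP d (fun x e => t1 x e == t2 x e).
Proof.
move=> h h'; apply: PP_ext (PP_and (PP_leq h h') (PP_leq h' h)) => x e.
by rewrite eqn_leq.
Qed.

(** The list [s] does not depend on the input, so this quantifier is unfolded into the program; it
    serves for the finite data of a fixed machine. *)
Lemma PP_has_const (I : Type) d (F : I -> seq bool -> seq nat -> bool) s :
  (forall i, PP d (F i)) -> PP d (fun x e => has (fun i => F i x e) s).
Proof.
move=> h; elim: s => [|i s IH] /=; first exact: PP_const.
exact: PP_or.
Qed.

Definition exb n (P : nat -> bool) := has P (iota 0 n).
Definition allb n (P : nat -> bool) := all P (iota 0 n).

Lemma exbP n (P : nat -> bool) : reflect (exists2 a, a < n & P a) (exb n P).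
Proof.
apply: (iffP hasP) => [[a]|[a h1 h2]]; last by exists a; rewrite ?mem_iota.
by rewrite mem_iota => /andP[_ h] p; exists a.
Qed.

Lemma allbP n (P : nat -> bool) : reflect (forall a, a < n -> P a) (allb n P).
Proof.
apply: (iffP allP) => h a; first by move=> an; apply: h; rewrite mem_iota.
by rewrite mem_iota => /andP[_]; apply: h.
Qed.

Lemma exbS n P : exb n.+1 P = P n || exb n P.
Proof. by rewrite /exb -addn1 iotaD has_cat /= orbF orbC. Qed.

(** The register that counts the rounds down is itself the bound variable; after each decrement it
    holds the next candidate. As it stays within [T m], the body costs at most [V (m + T m)]. *)
Lemma PP_exb d t (G : seq bool -> seq nat -> nat -> bool) : TT d t ->
  PP d.+1 (fun x e => G x (behead e) (head 0 e)) ->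
  PP d (fun x e => exb (t x e) (G x e)).
Proof.
case=> hc [T [pT hT]] hG loc b hl hb b2; have [A [U [pU hU]]] := hc loc b hl hb b2.
have hl1 : size (b :: loc) = d.+1 by rewrite /= hl.
have hb1 : all (fun r => r < b.+1) (b :: loc) by rewrite /= ltnSn all_ltS.
have [B [V [pV hV]]] := hG (b :: loc) b.+1 hl1 hb1 (leqW b2).
exists (fseq A (loop (branch (fdec b)
   (branch B (fseq (fclear b) (skip (Some true))) (skip None))
   (skip (Some false))))).
exists (fun m => U m + (T m + 1) * (1 + (V (m + T m) + (2 * (T m + 1) + 1)))).
split; first by pol_tac; apply: (@pol_comp V (fun m => m + T m)); pol_tac.
move=> x rho o ok; set m := msr x _; set e := map rho loc.
apply: sat_seq (hU x rho o ok) _; rewrite -/e.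
have he : size e = d by rewrite size_map.
have hTm : t x e <= T m by apply: hT.
set N := 1 + _.
have zb : rho b = 0 by case: ok => _ _; apply.
have hB a : a <= t x e -> sat x B (upd rho b a, o) (V (m + T m)) (upd rho b a, o) (G x e a).
  move=> ha; have := hV x (upd rho b a) o (upd_ok a b2 ok).
  rewrite /= map_upd // updE -/e; apply: sat_le; apply: pV.1.
  have -> : msr x (a :: e) = a + m by rewrite /m /msr /= addnCA.
  by lia.
suff H n : n <= t x e -> sat x (loop (branch (fdec b)
   (branch B (fseq (fclear b) (skip (Some true))) (skip None))
   (skip (Some false)))) (upd rho b n, o) (n.+1 * N) (rho, o) (exb n (G x e)).
  by apply: sat_le (H _ (leqnn _)); rewrite leq_mul2r addn1 ltnS hTm orbT.
elim: n => [|n IH] hn.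
  apply: (@sat_loop _ x _ (fun=> (upd rho b 0, o)) 0) => //.
  apply: (@sat_le _ _ _ _ 2); first by rewrite /N; lia.
  apply: (@sat_branch _ x _ _ _ _ 1 (rho, o) false 1); last exact: sat_skip.
  by rewrite upd_id //; apply: sat_dec0.
rewrite exbS; have := hB n (ltnW hn); case: (G x e n) => hBn /=.
  apply: (@sat_le _ _ _ _ (1 * N)); first by rewrite leq_mul2r orbC.
  apply: (@sat_loop _ x _ (fun=> (upd rho b n.+1, o)) 0) => //.
  apply: (@sat_branch _ x _ _ _ _ 1 (upd rho b n, o) true).
    by have := @sat_decS x b n (upd rho b n.+1) o (updE _ _ _); rewrite upd_upd.
  apply: sat_branch hBn _ => /=.
  apply: (@sat_seq _ _ _ _ _ _ (rho, o) true); last exact: sat_skip.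
  have := sat_clear x b (upd rho b n) o; rewrite updE upd_upd (upd_id zb).
  by apply: sat_le; lia.
rewrite mulSn; apply: sat_loopS _ (IH (ltnW hn)).
apply: (@sat_branch _ x _ _ _ _ 1 (upd rho b n, o) true).
  by have := @sat_decS x b n (upd rho b n.+1) o (updE _ _ _); rewrite upd_upd.
apply: sat_branch hBn _ => /=.
by apply: sat_le (sat_skip _ _ _); lia.
Qed.

Lemma PP_allb d t (G : seq bool -> seq nat -> nat -> bool) : TT d t ->
  PP d.+1 (fun x e => G x (behead e) (head 0 e)) ->
  PP d (fun x e => allb (t x e) (G x e)).
Proof.
move=> ht hG; apply: PP_ext (PP_neg (@PP_exb d t (fun x e a => ~~ G x e a) ht (PP_neg hG))).
by move=> x e; rewrite /exb has_predC negbK.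
Qed.

Lemma TT_poly d (p : {poly nat}) t : TT d t -> TT d (fun x e => p.[t x e]%R).
Proof.
move=> ht; elim/poly_ind: p => [|p c IH].
  by apply: TT_ext (TT_0 d) => x e; rewrite horner0.
apply: TT_ext (TT_add (TT_mul IH ht) (TT_const d c)) => x e.
by rewrite hornerD hornerM hornerX hornerC.
Qed.

(** * From flowchart programs to Turing machines *)

Notation ucell := (cell unit).
Definition cbit (b : bool) : ucell := Some (inl b).
Definition cmark : ucell := Some (inr tt).

Definition updc (c : nat -> ucell) r v : nat -> ucell :=
  fun i => if i == r then v else c i.

Lemma updc_same c r : updc c r (c r) = c.
Proof. by apply: funext => i; rewrite /updc; case: eqP => [->|]. Qed.

(* The head of a register tape stands at the value of the register; [c] is the
   fixed content of the tape. *)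
Definition rep (c : nat -> ucell) v (t : tape unit) :=
  t.1 = rev (mkseq c v) /\ forall i, nth None t.2 i = c (v + i).

Lemma rep_read c v t : rep c v t -> tape_read t = c v.
Proof. by case=> _ /(_ 0); rewrite nth0 addn0. Qed.

Lemma mkseq_updc c v a : mkseq (updc c v a) v = mkseq c v.
Proof.
by apply/eq_in_map => i; rewrite mem_iota /updc => /andP[_ h]; rewrite ltn_eqF.
Qed.

Lemma rep_stay c v a t : rep c v t -> rep (updc c v a) v (tape_write a t).
Proof.
case=> h1 h2; split; first by rewrite mkseq_updc.
move=> [|i] /=; first by rewrite addn0 /updc eqxx.
by rewrite nth_behead h2 /updc ifN //; lia.
Qed.

Lemma rep_right c v a t :
  rep c v t -> rep (updc c v a) v.+1 (tape_move MRight (tape_write a t)).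
Proof.
case=> h1 h2; split => /=.
  by rewrite mkseqS rev_rcons mkseq_updc h1 /updc eqxx.
by move=> i; rewrite nth_behead h2 /updc ifN ?addSnnS //; lia.
Qed.

Lemma rep_left c v t : rep c v.+1 t ->
  rep c v (tape_move MLeft (tape_write (c v.+1) t)).
Proof.
case=> h1 h2; split => /=; first by rewrite h1 mkseqS rev_rcons.
move=> [|[|i]] /=; first by rewrite h1 mkseqS rev_rcons /= addn0.
  by rewrite addn1.
by rewrite nth_behead h2 addSnnS.
Qed.

(* Register r is kept on tape r + 1, with a mark at the origin; the tape of
   register 0 also carries the copy of the input. *)
Definition content (w : seq bool) (r : nat) : nat -> ucell :=
  fun j => if j is j'.+1 then
             (if r == 0 then nth None (map cbit w) j' else None)
           else cmark.

Definition blank (s : seq ucell) := all (pred1 None) s.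

(* The output is written from right to left. *)
Definition outinv (o : seq bool) (t : tape unit) :=
  [/\ blank t.1, head None t.2 = None &
      exists2 s, blank s & behead t.2 = map cbit o ++ s].

Definition ireg L (i : instr L) : nat :=
  match i with
  | IInc r _ => r | IDec r _ _ => r | IRead _ _ => 0 | IOut _ _ => 0
  end.

Section Compile.
Variables (A : frag bool) (K : nat).
Hypothesis K2 : 2 <= K.
Hypothesis KA : forall q : fQ A, ireg (fcode q) < K.

(* Phases: 0 mark the origins, 1 copy the input and count its length, 2 rewind
   the copy, 3 move back onto the output, 4 halt. *)
Definition mstate : finType := ('I_5 + fQ A)%type.
Definition phase n : mstate := inl (inord n).

Definition lab (l : fQ A + bool) : mstate :=
  match l with inl q => inr q | inr _ => phase 3 end.

Notation reads := {ffun 'I_K.+1 -> ucell}.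
Notation acts := {ffun 'I_K.+1 -> ucell * move}.

Definition move_at (r : nat) (m : move) (s : reads) : acts :=
  [ffun i => (s i, if i == r :> nat then m else MStay)].

Definition tapen (r : nat) : 'I_K.+1 := inord r.

(** Phase 1 erases the input from tape 0, which becomes the output tape, while copying it to tape 1;
    tape 2 moves along, so register 1 ends with the length of the input. *)
Definition mdelta (q : mstate) (s : reads) : mstate * acts :=
  match q with
  | inl p =>
    match val p with
    | 0 => (phase 1, [ffun i : 'I_K.+1 => if i == 0 :> nat then (s i, MStay) else
              (cmark, if i == 1 :> nat then MRight else MStay)])
    | 1 => if s ord0 is Some (inl b) then
             (phase 1, [ffun i : 'I_K.+1 => if i == 0 :> nat then (None, MRight) else
                if i == 1 :> nat then (cbit b, MRight) else
                (s i, if i == 2 :> nat then MRight else MStay)])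
           else (phase 2, move_at 0 MStay s)
    | 2 => if s (tapen 1) == cmark then (inr (fstart A), move_at 0 MStay s)
           else (phase 2, move_at 1 MLeft s)
    | _ => (phase 4, move_at 0 MRight s)
    end
  | inr q =>
    match fcode q with
    | IInc r l => (lab l, move_at r.+1 MRight s)
    | IDec r lz l => if s (tapen r.+1) == cmark then (lab lz, move_at 0 MStay s)
                     else (lab l, move_at r.+1 MLeft s)
    | IRead l0 l1 => (lab (if s (tapen 1) == cbit true then l1 else l0),
                      move_at 0 MStay s)
    | IOut b l => (lab l, [ffun i : 'I_K.+1 => if i == 0 :> nat then (cbit b, MLeft)
                                     else (s i, MStay)])
    end
  end.

Definition mtm : TM :=
  @MkTM K unit mstate (phase 0) (fun q => q == phase 4) mdelta.

Definition regsok (w : seq bool) (rho : regs) (c : config mtm) :=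
  forall i : 'I_K.+1, 0 < i -> rep (content w i.-1) (rho i.-1) (c.2 i).

Definition simr x (l : fQ A + bool) (s : store) (c : config mtm) :=
  [/\ c.1 = lab l, regsok x s.1 c & outinv s.2 (c.2 ord0)].

Lemma phase_neq m n : m < 5 -> n < 5 -> m != n -> (phase m == phase n) = false.
Proof.
move=> hm hn mn; apply/eqP => -[] /(congr1 val) /=.
by rewrite !inordK // => /eqP; rewrite (negPf mn).
Qed.

Lemma tapenE r : r <= K -> tapen r = r :> nat.
Proof. exact: inordK. Qed.

Lemma outinv_stay o t :
  outinv o t -> outinv o (tape_write (tape_read t) t).
Proof. by case=> h1 h2 h3; split. Qed.

Lemma content_mark w r v : (content w r v == cmark) = (v == 0).
Proof.
case: v => [|v] /=; first by rewrite eqxx.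
apply/eqP; case: (r == 0) => //.
have [h|h] := ltnP v (size w); first by rewrite (nth_map false).
by rewrite nth_default ?size_map.
Qed.

Lemma content_bit w v : (content w 0 v == cbit true) = nth false (false :: w) v.
Proof.
case: v => [|v] //=.
have [h|h] := ltnP v (size w); last by rewrite !nth_default ?size_map.
by rewrite (nth_map false) //; case: (nth false w v).
Qed.

Lemma step_move (c : config mtm) q r m :
  (c.1 == phase 4) = false ->
  mdelta c.1 [ffun i => tape_read (c.2 i)] =
    (q, move_at r m [ffun i => tape_read (c.2 i)]) ->
  step c = (q, [ffun i : 'I_K.+1 => tape_move (if i == r :> nat then m else MStay)
                 (tape_write (tape_read (c.2 i)) (c.2 i))]).
Proof.
move=> hh e; rewrite /step /= hh e; congr (_, _); apply/ffunP => i.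
by rewrite !ffunE.
Qed.

Lemma rep_move c v t m : rep c v t -> (m = MLeft -> 0 < v) ->
  rep c (match m with MLeft => v.-1 | MStay => v | MRight => v.+1 end)
    (tape_move m (tape_write (tape_read t) t)).
Proof.
move=> h hm; rewrite (rep_read h); case: m hm => hm.
- by move/(_ erefl): hm; case: v h => // v h _; apply: rep_left h.
- by rewrite -{1}(updc_same c v); apply: rep_stay.
by rewrite -{1}(updc_same c v); apply: rep_right.
Qed.

Lemma regsok_move w rho (c : config mtm) q r m : regsok w rho c -> 
  (m = MLeft -> 0 < rho r) ->
  regsok w (upd rho r (match m with
     MLeft => (rho r).-1 | MStay => rho r | MRight => (rho r).+1 end))
   (q, [ffun i : 'I_K.+1 => tape_move (if i == r.+1 :> nat then m else MStay)
                 (tape_write (tape_read (c.2 i)) (c.2 i))]).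
Proof.
move=> h hm i i0; rewrite ffunE; have := h i i0.
case: i i0 => [[|i] hi] //= _ h'; rewrite /upd eqSS.
case: (i =P r) => [e|_]; first by move: hm; rewrite -e => hm; apply: rep_move.
exact: (rep_move (m := MStay)).
Qed.

Lemma regsok_stay w rho (c : config mtm) q m : regsok w rho c ->
  regsok w rho
   (q, [ffun i : 'I_K.+1 => tape_move (if i == 0 :> nat then m else MStay)
                 (tape_write (tape_read (c.2 i)) (c.2 i))]).
Proof.
move=> h i i0; rewrite ffunE; have := h i i0.
case: i i0 => [[|i] hi] //= _ h'; exact: (rep_move (m := MStay)).
Qed.

Lemma sim_step x q s c : simr x (inl q) s c ->
  simr x (isem x (fcode q) s).1 (isem x (fcode q) s).2 (step c).
Proof.
case: s => rho o [hq hr ho]; have hh : (c.1 == phase 4) = false by rewrite hq.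
have rd r : r < K -> tape_read (c.2 (tapen r.+1)) = content x r (rho r).
  move=> rK; have := hr (tapen r.+1); rewrite tapenE // => /(_ isT).
  exact: rep_read.
have ostay r m : outinv o ([ffun i : 'I_K.+1 =>
   tape_move (if i == r.+1 :> nat then m else MStay)
    (tape_write (tape_read (c.2 i)) (c.2 i))] ord0).
  by rewrite ffunE; apply: outinv_stay.
have ostay0 : outinv o ([ffun i : 'I_K.+1 =>
   tape_move (if i == 0 :> nat then MStay else MStay)
    (tape_write (tape_read (c.2 i)) (c.2 i))] ord0).
  by rewrite ffunE; apply: outinv_stay.
have := KA q; case ec: (fcode q) => [r l|r lz l|l0 l1|b l] /= rK.
- rewrite (@step_move c (lab l) r.+1 MRight) ?hq //=; last by rewrite ec.
  by split=> //=; exact: (@regsok_move _ _ c _ r MRight).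
- have := rd r rK; case ev: (rho r) => [|v] hrd.
    rewrite (@step_move c (lab lz) 0 MStay) ?hq //=; last first.
      by rewrite ec ffunE hrd content_mark.
    by split=> //=; exact: regsok_stay.
  rewrite (@step_move c (lab l) r.+1 MLeft) ?hq //=; last first.
    by rewrite ec ffunE hrd content_mark.
  split=> //=.
  by have := (@regsok_move _ _ c (lab l) r MLeft hr); rewrite /= ev; apply.
- rewrite (@step_move c (lab (if nth false (false :: x) (rho 0) then l1 else l0))
     0 MStay) ?hq //=; last first.
    by rewrite ec ffunE rd ?content_bit //; lia.
  by split=> //=; exact: regsok_stay.
have -> : step c = (lab l, [ffun i : 'I_K.+1 =>
   if i == 0 :> nat then tape_move MLeft (tape_write (cbit b) (c.2 i))
   else tape_write (tape_read (c.2 i)) (c.2 i)]).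
  rewrite /step /= hh hq /= ec; congr (_, _); apply/ffunP => i; rewrite !ffunE.
  by case: (i == 0 :> nat).
split=> //=.
  move=> i i0; rewrite ffunE ifN -?lt0n //.
  exact: (rep_move (m := MStay) (hr i i0)).
rewrite ffunE /=; case: ho => h1 h2 [s' h3 h4]; split=> /=.
- by case: ((c.2 ord0).1) h1 => //= a t1 /andP[].
- by case: ((c.2 ord0).1) h1 => //= a t1 /andP[/eqP].
by exists s'; rewrite ?h4.
Qed.

Lemma sim_reach x n s s' e c :
  sat x A s n s' e -> simr x (inl (fstart A)) s c ->
  exists2 m, m <= n & simr x (inr e) s' (iter m (@step mtm) c).
Proof.
move=> [m hm]; elim: m n (fstart A) s c hm => [|m IH] n q s c hm //.
rewrite iterSr /= => em hc; have := sim_step hc; move: em; rewrite /fstep /=.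
case: (isem x (fcode q) s) => l s1 /= em hs.
case: l em hs => [q1|e1] em hs.
  case: n hm => // n hm; have [m' hm' h] := IH n q1 s1 _ hm em hs.
  by exists m'.+1; rewrite ?iterSr.
have ee : iter m (@fstep x _ A) (inr e1, s1) = (inr e1, s1).
  by elim: (m) => //= k ->.
move: em; rewrite -/(@fstep x _ A) ee => -[<- <-].
by exists 1; [apply: leq_trans hm | ].
Qed.

(** The state after copying j bits. Register 0 is at [j.+1] since the origin of its tape is taken by
    the mark. *)
Definition phase1 x j (c : config mtm) :=
  [/\ c.1 = phase 1,
      blank (c.2 ord0).1,
      exists2 s, blank s & (c.2 ord0).2 = map cbit (drop j x) ++ s &
      regsok (take j x) (fun r => if r == 0 then j.+1 else if r == 1 then j else 0) c].

Lemma content_upd0 r : updc (fun _ => None) 0 cmark = content [::] r.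
Proof. by apply: funext => -[|i] //; rewrite /updc /= nth_nil if_same. Qed.

Lemma rep_blank : rep (fun _ => None) 0 ([::], [::]).
Proof. by split=> //= i; rewrite nth_nil. Qed.

Lemma phase1_start x : phase1 x 0 (step (init mtm x)).
Proof.
rewrite /step /= phase_neq // inordK //=; split=> //=.
- by rewrite !ffunE.
- rewrite !ffunE /= drop0; case: x => [|b x] /=; first by exists [:: None].
  by exists [::]; rewrite ?cats0.
move=> i i0; have i1 : (i == 0 :> nat) = false by rewrite eqn0Ngt i0.
have i2 : (i == ord0) = false by rewrite -(inj_eq val_inj).
rewrite !ffunE i1 i2 take0 -(content_upd0 i.-1).
case: i i0 {i1 i2} => [[|[|i]] hi] //= _; first by have := rep_right cmark rep_blank.
by have := rep_stay cmark rep_blank; rewrite if_same.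
Qed.

Lemma content_take x j : j < size x ->
  updc (content (take j x) 0) j.+1 (cbit (nth false x j)) = content (take j.+1 x) 0.
Proof.
move=> hj; apply: funext => -[|i] //; rewrite /updc /= eqSS.
rewrite (take_nth false) // map_rcons nth_rcons size_map size_takel; last exact: ltnW.
case: (ltngtP i j) => [h|h|_] //.
by rewrite nth_default // size_map size_takel ltnW.
Qed.

Lemma phase1_step x j c : j < size x -> phase1 x j c -> phase1 x j.+1 (step c).
Proof.
move=> hj [hq hb [s hs h2] hr].
rewrite (drop_nth false) //= in h2.
have -> : step c = (phase 1, [ffun i : 'I_K.+1 =>
   if i == 0 :> nat then tape_move MRight (tape_write None (c.2 i)) else
   if i == 1 :> nat then tape_move MRight (tape_write (cbit (nth false x j)) (c.2 i))
   else tape_move (if i == 2 :> nat then MRight else MStay)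
          (tape_write (tape_read (c.2 i)) (c.2 i))]).
  rewrite /step /= hq phase_neq //= inordK //= !ffunE /tape_read h2 /=.
  congr (_, _); apply/ffunP => i; rewrite !ffunE.
  by case: (i == 0 :> nat) => //; case: (i == 1 :> nat).
split=> //=.
- by rewrite ffunE /= hb.
- by exists s => //; rewrite ffunE /= h2.
move=> i i0; have i1 : (i == 0 :> nat) = false by rewrite eqn0Ngt i0.
rewrite ffunE i1; have := hr i i0.
case: i i0 {i1} => [[|[|[|i]]] hi] //= _ h.
- by have := rep_right (cbit (nth false x j)) h; rewrite content_take.
- by apply: (rep_move (m := MRight) h).
by apply: (rep_move (m := MStay) h).
Qed.

Definition phase2 x v (c : config mtm) :=
  [/\ c.1 = phase 2, blank (c.2 ord0).1, blank (c.2 ord0).2 &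
      regsok x (fun r => if r == 0 then v else if r == 1 then size x else 0) c].

Lemma blank_stay t : blank t.1 -> blank t.2 ->
  blank (tape_write (tape_read t) t).1 /\ blank (tape_write (tape_read t) t).2.
Proof. by case: t => t1 [|a t2]. Qed.

Lemma phase1_end x c : phase1 x (size x) c -> phase2 x (size x).+1 (step c).
Proof.
move=> [hq hb [s hs h2] hr].
rewrite drop_size /= in h2; rewrite take_size in hr.
rewrite (@step_move c (phase 2) 0 MStay) ?hq ?phase_neq //=; last first.
  rewrite inordK //= ffunE /tape_read h2.
  by case: s hs {h2} => //= a s /andP[/eqP ->].
have [] := @blank_stay (c.2 ord0) hb; first by rewrite h2.
by move=> b1 b2; split=> //=; rewrite ?ffunE //; apply: regsok_stay.
Qed.

Lemma phase2_step x v c : phase2 x v.+1 c -> phase2 x v (step c).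
Proof.
move=> [hq hb hb' hr].
have K1 : 1 <= K by apply: ltnW.
have := hr (tapen 1); rewrite tapenE // => /(_ isT) /rep_read /= rd.
rewrite (@step_move c (phase 2) 1 MLeft) ?hq ?phase_neq //=; last first.
  by rewrite inordK //= ffunE rd (content_mark _ 0 v.+1).
have [b1 b2] := @blank_stay (c.2 ord0) hb hb'.
split=> //=; rewrite ?ffunE //.
have := (@regsok_move _ _ c (phase 2) 0 MLeft hr (fun=> isT)).
by set f := upd _ _ _; have -> : f = (fun r => if r == 0 then v else if r == 1 then size x else 0) by apply: funext => -[|[|r]].
Qed.

Definition regs0 (x : seq bool) : regs := fun r => if r == 1 then size x else 0.

Lemma phase2_end x c : phase2 x 0 c ->
  simr x (inl (fstart A)) (regs0 x, [::]) (step c).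
Proof.
move=> [hq hb hb' hr].
have K1 : 1 <= K by apply: ltnW.
have := hr (tapen 1); rewrite tapenE // => /(_ isT) /rep_read /= rd.
rewrite (@step_move c (inr (fstart A)) 0 MStay) ?hq ?phase_neq //=; last first.
  by rewrite inordK //= ffunE rd (content_mark _ 0 0).
have [b1 b2] := @blank_stay (c.2 ord0) hb hb'.
split=> //=.
  have := (@regsok_stay _ _ c (inr (fstart A)) MStay hr).
  by have <- : (fun r => if r == 0 then 0 else if r == 1 then size x else 0) = regs0 x by apply: funext => -[|[|r]].
rewrite ffunE /=; split=> //=; first by rewrite /tape_read; case: ((c.2 ord0).2) hb' => //= a t /andP[/eqP].
by exists (behead (c.2 ord0).2) => //; case: ((c.2 ord0).2) hb' => //= a t /andP[].
Qed.

Lemma leading_bitsE o s : blank s -> leading_bits (map cbit o ++ s) = o.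
Proof.
by elim: o => [|b o IH] hs /=; [case: s hs => //= a s /andP[/eqP ->] | rewrite IH].
Qed.

Lemma finish x b rho o c : simr x (inr b) (rho, o) c ->
  tm_halt (step c).1 /\ output (step c) = o.
Proof.
case=> hq _ [h1 h2 [s h3 h4]].
rewrite (@step_move c (phase 4) 0 MRight) ?hq ?phase_neq //= ?inordK //.
by rewrite /output /= eqxx ffunE /= h4 leading_bitsE.
Qed.

Lemma halt_iter (c : config mtm) n : tm_halt c.1 -> iter n (@step mtm) c = c.
Proof. by move=> h; elim: n => //= n ->; rewrite /step h. Qed.

(** The count of steps: 1 for the marks, [size x] for copying and 1 to end it, [size x + 1] for
    rewinding and 1 to end it, at most [n] for the program, and 1 to return to the output. *)
Lemma mtm_correct x n rho o b :
  sat x A (regs0 x, [::]) n (rho, o) b ->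
  computes_within mtm (2 * size x + n + 5) x o.
Proof.
move=> hA.
have P1 : forall j, j <= size x -> phase1 x j (iter j.+1 (@step mtm) (init mtm x)).
  elim=> [|j IH] hj; first exact: phase1_start.
  by rewrite iterS; apply: phase1_step => //; apply: IH; apply: ltnW.
have P2 : forall v, v <= (size x).+1 ->
    phase2 x ((size x).+1 - v) (iter (v + (size x).+2) (@step mtm) (init mtm x)).
  elim=> [|v IH] hv; first by rewrite subn0 add0n iterS; apply/phase1_end/P1.
  by rewrite addSn iterS; apply: phase2_step; rewrite subnSK //; apply/IH/ltnW.
have := P2 _ (leqnn _); rewrite subnn => /phase2_end; rewrite -iterS => h.
have [m hm /finish []] := sim_reach hA h; rewrite -iterD -iterS => h1 h2.
rewrite /computes_within; set N := (X in iter X _ _ ) in h1 h2.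
have -> : 2 * size x + n + 5 = (2 * size x + n + 5 - N) + N by rewrite /N; lia.
by rewrite iterD halt_iter.
Qed.

End Compile.

Lemma pol_poly T : pol T -> exists p : {poly nat}, forall n, T n <= p.[n]%R.
Proof.
case=> _ [c hc]; exists (('X + 2%:P) ^+ c)%R => n.
by rewrite horner_exp hornerD hornerX hornerC; apply: leq_trans (hc n) _.
Qed.

Lemma polytime_frag (A : frag bool) T (f : seq bool -> seq bool) : pol T ->
  (forall x, exists rho b, sat x A (regs0 x, [::]) (T (size x)) (rho, f x) b) ->
  polytime f.
Proof.
move=> pT hA; pose K := (\max_(q : fQ A) ireg (fcode q)).+2.
have KA (q : fQ A) : ireg (fcode q) < K.
  have h : ireg (fcode q) <= \max_(q : fQ A) ireg (fcode q).
    exact: leq_bigmax.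
  by rewrite /K ltnS leqW.
have [p hp] : exists p : {poly nat}, forall n, 2 * n + T n + 5 <= p.[n]%R.
  by apply: pol_poly (fun m => 2 * m + T m + 5) _; pol_tac.
exists (mtm A K), p => x; have [rho [b h]] := hA x.
have [h1 h2] := mtm_correct (K := K) isT KA h.
rewrite /computes_within -(subnK (hp (size x))) iterD halt_iter //.
Qed.

(** The countdown visits the indices in decreasing order, as an output that grows at its front
    requires. *)
Definition fenum (B : frag bool) : frag bool :=
  loop (branch (fdec 2) (branch B (fseq (fout true) (skip None))
          (fseq (fout false) (skip None))) (skip (Some true))).

Theorem polytime_mkseq (phi : seq bool -> seq nat -> bool) t :
  TT 0 t -> PP 1 phi ->
  polytime (fun x => mkseq (fun m => phi x [:: m]) (t x [::])).
Proof.
case=> ht [T [pT hT]] hp.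
have [A [U [pU hU]]] := ht [::] 2 erefl erefl isT.
have [B [V [pV hV]]] := hp [:: 2] 3 erefl erefl isT.
apply: (@polytime_frag (fseq A (fenum B))
   (fun m => U m + (T m + 1) * (V (m + T m) + 3))).
  by pol_tac; apply: (@pol_comp V (fun m => m + T m)); pol_tac.
move=> x; exists (regs0 x), true.
have ok : okst x (regs0 x) 2 by split=> // -[|[|i]].
have := hU x (regs0 x) [::] ok; rewrite /= {1}/msr addn0 => h.
apply: sat_seq h _; have := hT x [::] erefl; rewrite /msr addn0.
set N := t x [::] => hN.
pose f i := (upd (regs0 x) 2 (N - i),
  drop (N - i) (mkseq (fun m => phi x [:: m]) N)).
have f0 : f 0 = (upd (regs0 x) 2 N, [::]).
  by rewrite /f subn0 drop_oversize // size_mkseq.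
have fN : f N = (regs0 x, mkseq (fun m => phi x [:: m]) N).
  by rewrite /f subnn drop0 upd_id.
apply: (@sat_le _ _ _ _ (N.+1 * (V (size x + T (size x)) + 3))).
  by rewrite leq_mul2r; lia.
rewrite -f0; apply: (@sat_loop _ x _ f) => [i hi|].
  apply: (@sat_le _ _ _ _ (1 + (V (size x + T (size x)) + 2))); first by lia.
  have e : N - i = (N - i.+1).+1 by lia.
  apply: (@sat_branch _ x _ _ _ _ 1 (upd (regs0 x) 2 (N - i.+1), (f i).2) true).
    have := @sat_decS x 2 (N - i.+1) (f i).1 (f i).2.
    by rewrite /= updE upd_upd; apply.
  have hok : okst x (upd (regs0 x) 2 (N - i.+1)) 3 by apply: upd_ok.
  have := hV x _ (f i).2 hok; rewrite /= updE => hB.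
  apply: (@sat_branch _ _ _ _ _ _ _ _ (phi x [:: N - i.+1])).
    apply: sat_le hB; apply: pV.1; rewrite /msr /= addn0; lia.
  have -> : f i.+1 = (upd (regs0 x) 2 (N - i.+1), phi x [:: N - i.+1] :: (f i).2).
    rewrite /f /=; congr (_, _); rewrite {1}(drop_nth false) ?size_mkseq; last by lia.
    by rewrite nth_mkseq -?e //; lia.
  by case: (phi x [:: N - i.+1]);
    apply: (@sat_seq _ _ _ _ _ 1 _ true 1) (sat_skip _ _ _); apply: sat_out.
rewrite fN; apply: (@sat_le _ _ _ _ 2); first by lia.
apply: (@sat_branch _ x _ _ _ _ 1 (regs0 x, mkseq (fun m => phi x [:: m]) N) false 1).
  exact: sat_dec0.
exact: sat_skip.
Qed.

(** * Trees and tree decompositions *)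

Lemma connect_cross (T : finType) (e : rel T) (P : pred T) x y :
  connect e x y -> P x -> ~~ P y -> exists a b, [/\ e a b, P a & ~~ P b].
Proof.
case/connectP=> p; elim: p x => [|z p IH] x /= => [_ -> -> //|].
case/andP=> xz pz ly px; case: (boolP (P z)) => pz'; first exact: (IH z).
by move=> _; exists x, z.
Qed.

Section Tree.
Variables (T : sgraph) (tT : is_tree T).
Implicit Types s t x y z : T.

(** Adjacency in the tree without the edge st; [side s t] is then the component of s. *)
Definition cutrel s t : rel T :=
  fun x y => [&& adj x y, ~~ ((x == s) && (y == t)) & ~~ ((x == t) && (y == s))].

Definition side s t : {set T} := [set z | connect (cutrel s t) s z].

Lemma cutrelC s t : cutrel s t =2 cutrel t s.
Proof. by move=> x y; rewrite /cutrel andbCA andbC -andbA andbC -andbA andbCA. Qed.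

Lemma cutrel_sym s t : symmetric (cutrel s t).
Proof.
move=> x y; rewrite /cutrel adj_sym; congr (_ && _).
by rewrite andbC [(x == t) && _]andbC [(x == s) && _]andbC.
Qed.

Lemma side_refl s t : s \in side s t.
Proof. by rewrite inE. Qed.

(** A simple path from s to t without the edge st would be closed by it to a cycle. Acyclicity
    leaves only length 2, that is the edge st itself. *)
Lemma side_cut s t : adj s t -> t \notin side s t.
Proof.
move=> st; rewrite inE; apply/negP=> /connectP[p0 hp0 e0].
move: e0; case: (shortenP hp0) => p hp up _ lt.
have ap : path (@adj T) s p by apply: sub_path hp => x y /and3P[].
have cyc : ucycle (@adj T) (s :: p).
  by rewrite /ucycle /= rcons_path ap -lt adj_sym st.
have [_ _ /(_ _ cyc)] := tT; case: p hp up lt {ap cyc} => [|x [|y p]] //=.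
  by move=> _ _ ts; rewrite ts adj_irr in st.
by move=> /andP[h _] _ tx; rewrite /cutrel tx !eqxx /= andbF in h.
Qed.

Lemma cross s t y z : y \in side s t -> z \notin side s t -> adj y z ->
  y = s /\ z = t.
Proof.
move=> hy hz yz; case: (boolP (cutrel s t y z)) => [cyz|].
  case/negP: hz; rewrite !inE in hy *; apply: connect_trans hy _; exact: connect1.
rewrite /cutrel yz /= negb_and !negbK => /orP[/andP[/eqP -> /eqP ->]//|].
by case/andP => _ /eqP zs; rewrite zs side_refl in hz.
Qed.

Lemma sideC s t : adj s t -> side t s = ~: side s t.
Proof.
move=> st; apply/setP=> z; rewrite in_setC; apply/idP/idP => hz.
  apply/negP=> hz'; rewrite !inE in hz hz'; case/negP: (side_cut st).
  rewrite inE; apply: connect_trans hz' _.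
  by rewrite (sym_connect_sym (@cutrel_sym s t)) (eq_connect (cutrelC s t)).
have [_ /(_ s z) ct _] := tT; case: (boolP (z \in side t s)) => // hz'.
have [||a [b [ab]]] := @connect_cross _ _ (mem (side s t :|: side t s)) _ _ ct.
- by rewrite /= in_setU side_refl.
- by rewrite /= in_setU negb_or hz hz'.
rewrite /= !in_setU negb_or => /orP[ha|ha] /andP[hb1 hb2].
  by have [_ bt] := cross ha hb1 ab; rewrite bt side_refl in hb2.
by have [_ bt] := cross ha hb2 ab; rewrite bt side_refl in hb1.
Qed.

(** The edge st is the only link between its two sides, so a connected set meeting both has to use
    it. *)
Lemma conn_cross (C : {set T}) s t a b : connected (induced C) ->
  a \in C -> b \in C -> a \in side s t -> b \notin side s t -> s \in C /\ t \in C.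
Proof.
move=> hC aC bC ha hb.
have [x [y [xy hx hy]]] := @connect_cross _ _
  (fun z : induced C => val z \in side s t) _ _
  (hC (exist _ a aC) (exist _ b bC)) ha hb.
by have [<- <-] := cross hx hy xy; split; apply: valP.
Qed.

Lemma path_avoid s t x p : path (@adj T) x p -> (s \notin x :: p) || (t \notin x :: p) ->
  path (cutrel s t) x p.
Proof.
elim: p x => //= y p IH x /andP[xy hp] hs; rewrite IH //; last first.
  by case/orP: hs => h; apply/orP; [left|right]; move: h; rewrite inE negb_or => /andP[].
rewrite andbT /cutrel xy /=.
by case/orP: hs; rewrite !inE !negb_or => /and3P[h1 h2 _];
  rewrite !(eq_sym x) !(eq_sym y) ?(negPf h1) ?(negPf h2) ?andbF.
Qed.

Lemma simple_path x y : exists p, [/\ path (@adj T) x p, uniq (x :: p) & last x p = y].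
Proof.
have [_ /(_ x y) /connectP[p0 hp0 e0] _] := tT.
by move: e0; case: (shortenP hp0) => p hp up _ ->; exists p.
Qed.

(** w is the first step of a simple path from z to C; as C misses z, it cannot cross the edge zw. *)
Lemma direction (C : {set T}) z : connected (induced C) -> C != set0 -> z \notin C ->
  exists2 w, adj z w & C \subset side w z.
Proof.
move=> hC /set0Pn[c cC] zC; have [p [hp up lp]] := simple_path z c.
case: p hp up lp => [|w p] /=; first by move=> _ _ zc; rewrite zc cC in zC.
case/andP=> zw hp /andP[hz up] lp; exists w => //.
have hc : c \in side w z.
  rewrite inE; apply/connectP; exists p => //.
  by apply: path_avoid hp _; rewrite hz orbT.
apply/subsetP=> c' c'C; apply/negPn/negP => hc'.
by have [_ zC'] := conn_cross hC cC c'C hc hc'; rewrite zC' in zC.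
Qed.

(** Iteration in a finite tree becomes periodic. An orbit of least period is a simple cycle, so the
    period is at most 2, and it is not 1 because adjacency is irreflexive. *)
Lemma sink (g : T -> T) : (forall z, adj z (g z)) -> exists s, g (g s) = s.
Proof.
move=> hg; have [[z0] _ acyc] := tT.
have [z [n n0 hn]] : exists z, exists2 n, 0 < n & iter n g z = z.
  have /(trajectP)[i hi ei] := looping_order g z0.
  exists (iter i g z0), (order g z0 - i); first by rewrite subn_gt0.
  by rewrite -iterD subnK // ltnW.
have ex : exists n, (0 < n) && (iter n g z == z) by exists n; rewrite n0 hn eqxx.
case: (ex_minnP ex) => m /andP[m0 /eqP hm] mmin {n n0 hn ex}.
have cyc : ucycle (@adj T) (traject g z m).
  case: m m0 hm mmin => // m _ hm mmin; apply/andP; split.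
    rewrite trajectS /= -{3}hm iterSr -trajectSr.
    by apply: sub_path (fpath_traject g z m.+1) => x y /= /eqP <-.
  rewrite looping_uniq; apply/negP => /trajectP[k km ek].
  have := mmin k.+1; rewrite /= -ek -iterS hm eqxx => /(_ isT); lia.
have := acyc _ cyc; rewrite size_traject.
case: m m0 hm {mmin cyc} => [|[|[|m]]] //= _ hm _; last by exists z.
by have := hg z; rewrite hm adj_irr.
Qed.

(** On a simple path from x to y, t is the first node violating [P] and s its predecessor;
    simplicity keeps the two remaining pieces of the path off the edge st. *)
Lemma crossing_edge (P : pred T) x y : P x -> ~~ P y ->
  exists s t, [/\ adj s t, x \in side s t, y \in side t s, P s & ~~ P t].
Proof.
have [p [hp up lp]] := simple_path x y; move=> px py.
have [t [p1 [p2 [ep nt ps]]]] : exists t p1 p2,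
    [/\ p = p1 ++ t :: p2, ~~ P t & P (last x p1)].
  elim: p x px lp {hp up} => [|t p IH] x px /= lp; first by rewrite -lp px in py.
  case: (boolP (P t)) => pt; last by exists t, [::], p.
  by have [t' [p1 [p2 [-> h1 h2]]]] := IH t pt lp; exists t', (t :: p1), p2.
exists (last x p1), t; move: hp up lp; rewrite ep cat_path last_cat /=.
case/and3P=> h1 h2 h3; rewrite mem_cat inE cat_uniq /= !negb_or.
case/andP=> /and3P[n1 n2 n3] /and3P[u1 /andP[n4 n5] /andP[n6 u2]] lp.
split=> //.
  rewrite inE (sym_connect_sym (@cutrel_sym _ _)); apply/connectP; exists p1 => //.
  by apply: path_avoid => //; rewrite orbC inE negb_or eq_sym n2 n4.
rewrite inE; apply/connectP; exists p2 => //; apply: path_avoid => //.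
rewrite orbC inE negb_or; case: (eqVneq (last x p1) t) => [e|_] /=; last first.
  have := mem_last x p1; rewrite inE => /orP[/eqP ->|hl]; first by rewrite n3.
  by case: (boolP (_ \in p2)) => // hl2; case/hasP: n5; exists (last x p1).
by rewrite -e ps in nt.
Qed.

Lemma rooted r : exists d : T -> nat, forall z, z != r -> exists2 y, adj y z & d y < d z.
Proof.
have [_ ct _] := tT.
have ex z : exists n, `[< exists2 p, path (@adj T) r p & last r p = z /\ size p = n >].
  by have /connectP[p hp e] := ct r z; exists (size p); apply/asboolP; exists p.
exists (fun z => ex_minn (ex z)) => z zr.
case: (ex_minnP (ex z)) => n /asboolP[p hp [lp sp]] _.
case/lastP: p hp lp sp => [|p z' hp]; first by move=> _ /= e; rewrite e eqxx in zr.
rewrite last_rcons size_rcons => ez <-; move: hp; rewrite ez rcons_path.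
case/andP=> hp lz; exists (last r p) => //.
case: (ex_minnP (ex (last r p))) => m _ /(_ (size p)) h; rewrite ltnS; apply: h.
by apply/asboolP; exists p.
Qed.

End Tree.

Section Rooted.
Variables (T : sgraph) (tT : is_tree T) (r : T) (d : T -> nat).
Hypothesis hd : forall z, z != r -> exists2 y, adj y z & d y < d z.

Lemma root_min z : d z <= d r -> z = r.
Proof.
have [n] := ubnP (d z); elim: n z => // n IH z; rewrite ltnS => hn hz.
apply/eqP/negPn/negP => zr; have [y _ yz] := hd zr.
have yr : y = r by apply: IH; lia.
by rewrite yr in yz; lia.
Qed.

(** The descent from y to the root could enter the side of s only at s, where [d] is already too
    large. *)
Lemma above_root s t y : y \notin side s t -> d y < d s -> r \notin side s t.
Proof.
have [n] := ubnP (d y); elim: n y => // n IH y; rewrite ltnS => hn hy ys.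
case: (eqVneq y r) => [<-//|/hd [y' yy' ly]].
apply: (IH y'); [by apply: leq_trans hn| |by apply: ltn_trans ys].
apply/negP=> hy'; have [e _] := cross hy' hy yy'; by rewrite e in ly; lia.
Qed.

(** The descent from z to the root has to leave the side of s, and it can do so only at s. *)
Lemma below_top s t z : r \notin side s t -> z \in side s t -> d z <= d s -> z = s.
Proof.
move=> hr; have [n] := ubnP (d z); elim: n z => // n IH z; rewrite ltnS => hn hz zs.
have zr : z != r by apply: contraNneq hr => <-.
have [y yz ly] := hd zr; case: (boolP (y \in side s t)) => hy; last first.
  by have [] := cross hz hy _; rewrite 1?adj_sym.
have ys : y = s by apply: IH => //; lia.
by rewrite ys in ly; lia.
Qed.

(* The node of C nearest to the root separates C from the root. *)
Lemma top_shared (C C' : {set T}) s z : connected (induced C) -> connected (induced C') ->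
  s \in C -> (forall c, c \in C -> d s <= d c) -> z \in C -> z \in C' ->
  (exists2 c, c \in C' & d c <= d s) -> s \in C'.
Proof.
move=> cC cC' sC smin zC zC' [c cc' cs].
case: (eqVneq s r) => [sr|/hd [t ts lt]].
  by rewrite sr -(root_min (z := c)) // -sr.
have tC : t \notin C by apply/negP => /smin; lia.
have st : adj s t by rewrite adj_sym.
have hz : z \in side s t.
  apply/negPn/negP => hz; case/negP: tC.
  by have [] := conn_cross cC sC zC (side_refl s t) hz.
have hr := above_root (side_cut tT st) lt.
case: (boolP (c \in side s t)) => hc; first by rewrite -(below_top hr hc).
by have [] := conn_cross cC' zC' cc' hz hc.
Qed.

End Rooted.

Lemma alpha_leP (G : sgraph) (X : {set G}) k :
  reflect (forall S : {set G}, independent S -> S \subset X -> #|S| <= k)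
          (alpha (induced X) <= k).
Proof.
apply: (iffP idP) => [h S iS SX|h].
  pose S' : {set induced X} := [set x | val x \in S].
  have -> : #|S| = #|S'|.
    rewrite -(card_imset _ val_inj); apply: eq_card => x.
    apply/idP/imsetP => [xS|[y]]; last by rewrite inE => yS ->.
    by exists (Sub x (subsetP SX x xS) : {x | x \in X}); rewrite ?inE.
  apply: leq_trans h; rewrite /alpha.
  apply: (@leq_bigmax_cond _ _ (fun S : {set induced X} => #|S|)).
  apply/forall_inP => x; rewrite inE => xS; apply/forall_inP => y; rewrite inE => yS.
  exact: (forall_inP (forall_inP iS _ xS) _ yS).
apply/bigmax_leqP => S iS; rewrite -(card_imset _ val_inj); apply: h.
  apply/forall_inP => _ /imsetP[x xS ->]; apply/forall_inP => _ /imsetP[y yS ->].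
  exact: (forall_inP (forall_inP iS _ xS) _ yS).
by apply/subsetP => _ /imsetP[x _ ->]; apply: valP.
Qed.

Lemma tree_alphaP (G : sgraph) k :
  tree_alpha G <= k <-> exists D : tree_decomposition G, td_alpha D <= k.
Proof.
rewrite /tree_alpha; case: ex_minnP => m /asboolP[D <-] mn; split=> [h|[D' h]].
  by exists D.
by apply: leq_trans h; apply: mn; apply/asboolP; exists D'.
Qed.

Lemma td_alpha_leP (G : sgraph) (D : tree_decomposition G) k :
  td_alpha D <= k <-> (forall (t : td_tree D) (S : {set G}), independent S -> S \subset bag t -> #|S| <= k).
Proof.
split=> [/bigmax_leqP h t|h]; first by apply/alpha_leP; apply: h.
by apply/bigmax_leqP => t _; apply/alpha_leP; apply: h.
Qed.

Section Decomposition.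
Variables (G : sgraph) (D : tree_decomposition G).

Definition nodes (u : G) : {set td_tree D} := [set t : td_tree D | u \in bag t].

(** If no bag contains N, then every node z misses some n in N and points to the neighbour towards
    the bags of n. By [sink] two adjacent nodes point at each other, because of n1 and n2 with bags
    on opposite sides. Every u in U shares a bag with n1 and one with n2, so its subtree contains
    the edge. *)
Lemma biclique (U N : {set G}) :
  (forall u n, u \in U -> n \in N -> adj u n) ->
  (exists t : td_tree D, N \subset bag t) \/ (exists t : td_tree D, U \subset bag t).
Proof.
move=> hUN; case: (pselect (exists t : td_tree D, N \subset bag t)) => [|noN]; [by left|right].
have tT := td_treeP D.
have /choice [g hg] : forall z : td_tree D, exists w,
    adj z w /\ exists2 n, n \in N & nodes n \subset side w z.
  move=> z; have /subsetPn[n nN nz] : ~~ (N \subset bag z).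
    by apply/negP=> h; apply: noN; exists z.
  have [||w zw hw] := direction tT (@bag_connected G D n) _ (z := z).
  - by have [t ht] := @bag_vertex G D n; apply/set0Pn; exists t; rewrite inE.
  - by rewrite inE.
  by exists w; split=> //; exists n.
have [s hs] := sink tT (fun z => (hg z).1).
have [st [n1 n1N h1]] := hg s; have [ts [n2 n2N h2]] := hg (g s); rewrite hs in h2.
exists s; apply/subsetP => u uU.
have [z1 /andP[u1 /[dup] n1z]] := bag_edge D (hUN _ _ uU n1N).
have [z2 /andP[u2 n2z]] := bag_edge D (hUN _ _ uU n2N) => _.
have z1s : z1 \in side (g s) s by apply: (subsetP h1); rewrite inE.
have z2s : z2 \in side s (g s) by apply: (subsetP h2); rewrite inE.
rewrite sideC // in_setC in z1s.
have [] := conn_cross (@bag_connected G D u) _ _ z2s z1s; rewrite ?inE //.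
Qed.

End Decomposition.

(** * Elimination orders *)

(* [ord u v]: u is eliminated before v; [up v w]: w is a later vertex in the
   bag of v. *)
Record elimination (T : finType) (e : rel T) (ord up : rel T) : Prop := Elimination {
  el_irr : forall u, ~~ ord u u;
  el_trans : forall u v w, ord u v -> ord v w -> ord u w;
  el_total : forall u v, [|| u == v, ord u v | ord v u];
  el_up : forall u v, up u v -> ord u v;
  el_edge : forall u v, e u v -> ord u v -> up u v;
  el_chordal : forall v i j, up v i -> up v j -> ord i j -> up i j }.

Definition elbag (T : finType) (up : rel T) v : {set T} := [set w | (w == v) || up v w].

Section ParentTree.
Variables (T : finType) (rank : T -> nat) (r : T) (par : T -> T).
Hypothesis hpar : forall v, v != r -> rank v < rank (par v).

Definition padj : rel T :=
  fun v w => (v != w) && ((v != r) && (par v == w) || (w != r) && (par w == v)).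

Lemma padj_sym : symmetric padj.
Proof. by move=> v w; rewrite /padj eq_sym orbC. Qed.

Lemma padj_irr : irreflexive padj.
Proof. by move=> v; rewrite /padj eqxx. Qed.

Definition ptree : sgraph := SGraph padj_sym padj_irr.

Lemma padj_par v : v != r -> padj v (par v).
Proof.
move=> vr; rewrite /padj vr eqxx /= andbT; apply/eqP => e.
by have := hpar vr; rewrite -e ltnn.
Qed.

Lemma padj_up v w : padj v w -> rank v <= rank w -> par v = w.
Proof.
case/andP=> _ /orP[/andP[_ /eqP //]|/andP[wr /eqP e]] le.
by have := hpar wr; rewrite e ltnNge le.
Qed.

Lemma up_ind (P : T -> Prop) :
  (forall v, (forall w, rank v < rank w -> P w) -> P v) -> forall v, P v.
Proof.
move=> h v; pose m := \max_w rank w; have [n] := ubnP (m - rank v).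
elim: n v => // n IH v; rewrite ltnS => hn; apply: h => w vw; apply: IH.
have : rank w <= m by apply: leq_bigmax.
by lia.
Qed.

Lemma ptree_tree : is_tree ptree.
Proof.
split; first exact: (inhabits r).
  have cr v : connect padj v r.
    elim/up_ind: v => v IH; case: (eqVneq v r) => [->|vr]; first exact: connect0.
    by apply: connect_trans (IH _ (hpar vr)); apply/connect1/padj_par.
  move=> x y; apply: connect_trans (cr x) _.
  by rewrite (sym_connect_sym padj_sym).
move=> c /andP[cyc uc]; rewrite leqNgt; apply/negP => sc.
have [v0 v0c] : exists v, v \in c by case: c sc {cyc uc} => // v c _; exists v; rewrite mem_head.
(* Both neighbours on the cycle of a vertex of least rank would have to be its parent. *)
have [v vc vmin] := @arg_minnP T v0 (fun v => v \in c) rank v0c.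
have [i c' ec] := rot_to vc.
have : cycle padj (rot i c) by rewrite rot_cycle.
have : uniq (rot i c) by rewrite rot_uniq.
have : size (rot i c) > 2 by rewrite size_rot.
have hm w : w \in rot i c -> rank v <= rank w by rewrite mem_rot; apply: vmin.
rewrite ec in hm *; case: c' hm {ec} => [|w c'] //= hm sz.
rewrite rcons_path => /and3P[_ wc _] /andP[vw /andP[_ lv]].
rewrite padj_sym in lv.
have lc : last w c' \in c' by clear -sz; case: c' sz => //= a c' _; apply: mem_last.
have e1 : par v = w by apply: padj_up vw (hm w _); rewrite !inE eqxx orbT.
have e2 : par v = last w c' by apply: padj_up lv (hm _ _); rewrite !inE lc !orbT.
by rewrite -e1 e2 lc in wc.
Qed.

End ParentTree.

Section Certificate.
Variable G : sgraph.

Section FromElimination.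
Variables (ord up : rel G).
Hypothesis el : elimination (@adj G) ord up.

Let rank v := #|[set w | ord w v]|.

Lemma rank_ord u v : ord u v -> rank u < rank v.
Proof.
move=> uv; apply: proper_card; apply/properP; split.
  by apply/subsetP => w; rewrite !inE => wu; apply: el_trans el _ _ _ wu uv.
by exists u; rewrite !inE ?uv ?(el_irr el).
Qed.

(** The tree has the vertices as nodes; the parent of v is the first later vertex in its bag, or the
    last vertex r of the order if there is none. By chordality a later u in the bag of v is also in
    the bag of the parent, so all nodes whose bag contains u climb to u. *)
Lemma elimination_td (g : G) : exists D : tree_decomposition G,
  forall t : td_tree D, exists v, bag t = elbag up v.
Proof.
have [r _ rmax0] := @arg_maxnP G g xpredT rank isT.
have rmax j : rank j <= rank r by apply: rmax0.
have rmax' v : v != r -> ord v r.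
  move=> vr; case/or3P: (el_total el v r) => [/eqP e|//|/rank_ord].
    by rewrite e eqxx in vr.
  by rewrite ltnNge rmax.
pose par v := if [pick w | up v w] is Some w then [arg min_(u < w | up v u) rank u] else r.
have parP v w : up v w -> up v (par v) /\ rank (par v) <= rank w.
  rewrite /par; case: pickP => [w' uw'|->//] uw.
  by case: arg_minnP => // u uu /(_ _ uw).
have hpar v : v != r -> rank v < rank (par v).
  rewrite /par; case: pickP => [w' uw'|no] vr; last by apply/rank_ord/rmax'.
  by case: arg_minnP => // u uu _; apply/rank_ord/(el_up el).
have upr v w : up v w -> v != r.
  move=> /(el_up el) vw; apply/eqP => e; have := rank_ord vw.
  by rewrite ltnNge e rmax.
have bv (u : G) : exists t : ptree r par, u \in elbag up t by exists u; rewrite inE eqxx.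
have be (u v : G) : adj u v -> exists t : ptree r par, (u \in elbag up t) && (v \in elbag up t).
  move=> uv; case/or3P: (el_total el u v) => [/eqP e|h|h].
  - by rewrite e adj_irr in uv.
  - by exists u; rewrite !inE eqxx (el_edge el uv h) orbT.
  - by exists v; rewrite adj_sym in uv; rewrite !inE eqxx (el_edge el uv h) orbT.
have bc (u : G) : connected (induced [set t : ptree r par | u \in elbag up t]).
  set C := [set t | _]; have uC : u \in C by rewrite !inE eqxx.
  suff H : forall v, forall vC : v \in C,
      connect (@induced_adj _ C) (exist _ v vC) (exist _ u uC).
    move=> [x xC] [y yC]; apply: connect_trans (H x xC) _.
    rewrite (sym_connect_sym (@induced_sym _ C)); exact: H.
  elim/(up_ind (rank := rank)) => v IH vC.
  case: (eqVneq u v) => [e|uv].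
    have -> : exist _ v vC = exist (fun x => x \in C) u uC by apply: val_inj.
    exact: connect0.
  have vu : up v u by move: vC; rewrite !inE (negPf uv).
  have [vp pu] := parP _ _ vu; have vr := upr _ _ vu.
  have pC : par v \in C.
    rewrite !inE; case: (eqVneq u (par v)) => //= pne.
    apply: (el_chordal el vp vu); case/or3P: (el_total el (par v) u) => [/eqP e|//|].
      by rewrite e eqxx in pne.
    by move/rank_ord; rewrite ltnNge pu.
  apply: connect_trans (IH _ (hpar _ vr) pC); apply: connect1.
  exact: (padj_par hpar vr).
exists (TreeDecomposition (ptree_tree hpar) bv be bc) => t.
by exists t.
Qed.

End FromElimination.

Lemma elimination_tree_alpha k ord up : elimination (@adj G) ord up ->
  (forall v (S : {set G}), independent S -> S \subset elbag up v -> #|S| <= k) ->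
  tree_alpha G <= k.
Proof.
move=> el hk; apply/tree_alphaP; case: (pickP (@predT G)) => [g _|G0].
  have [D hD] := elimination_td el g; exists D; apply/td_alpha_leP => t S iS.
  by have [v ->] := hD t; apply: hk.
(* The empty graph has no vertex that could serve as a node. *)
exists (trivial_td G); apply/td_alpha_leP => t S _ _.
by rewrite (leq_trans (max_card _)) // (eq_card0 G0).
Qed.

(** Root the tree and let [top v] be the node nearest to the root whose bag contains v. Vertices
    with deeper top nodes are eliminated first; a later vertex sharing a bag with v then lies in the
    bag of [top v], so this bag contains the elimination bag of v. *)
Lemma tree_alpha_elimination k : tree_alpha G <= k ->
  exists ord up, elimination (@adj G) ord up /\
  (forall v (S : {set G}), independent S -> S \subset elbag up v -> #|S| <= k).
Proof.
case/tree_alphaP=> D /td_alpha_leP hD; have tT := td_treeP D.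
have [[r] _ _] := tT; have [d hd] := rooted tT r.
have ex (v : G) : exists t : td_tree D, v \in bag t by exact: bag_vertex.
pose top v := [arg min_(t < xchoose (ex v) | v \in bag t) d t].
have topP v : v \in bag (top v) /\ forall t, v \in bag t -> d (top v) <= d t.
  by rewrite /top; case: arg_minnP => [|t vt tmin]; [apply: (xchooseP (ex v)) | split].
pose h v := d (top v).
have shared v w (z : td_tree D) : h w <= h v -> v \in bag z -> w \in bag z -> w \in bag (top v).
  move=> wv vz wz; have [tv tmin] := topP v; have [tw _] := topP w.
  suff : top v \in nodes D w by rewrite inE.
  apply: (top_shared tT hd (C := nodes D v) (z := z)); rewrite ?inE //.
  - exact: bag_connected.
  - exact: bag_connected.
  - by move=> c; rewrite inE; apply: tmin.
  - by exists (top w); rewrite ?inE.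
pose ord v w := (h w < h v) || (h w == h v) && (enum_rank v < enum_rank w).
pose up v w := ord v w && [exists t : td_tree D, (v \in bag t) && (w \in bag t)].
have ordh v w : ord v w -> h w <= h v by rewrite /ord; lia.
have upbag v w : up v w -> w \in bag (top v).
  by case/andP=> /ordh vw /existsP[t /andP[vt wt]]; apply: shared vt wt.
exists ord, up; split; last first.
  move=> v S iS SB; apply: (hD (top v) S iS); apply: subset_trans SB _.
  apply/subsetP => w; rewrite inE => /orP[/eqP ->|/upbag //].
  by have [] := topP v.
split.
- by move=> u; rewrite /ord !ltnn andbF.
- by move=> u v w; rewrite /ord; lia.
- move=> u v; rewrite /ord; have [->|uv] := eqVneq u v; first by [].
  have : enum_rank u != enum_rank v :> nat.
    by rewrite (inj_eq val_inj) (inj_eq enum_rank_inj).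
  by rewrite /=; lia.
- by move=> u v /andP[].
- move=> u v /(bag_edge D) [t ht] uv; rewrite /up uv; apply/existsP; by exists t.
- move=> v i j /upbag vi /upbag vj ij; rewrite /up ij; apply/existsP; exists (top v).
  by rewrite vi vj.
Qed.

End Certificate.

(** * Membership in NP *)

(** Syntax-directed derivations: [tt] solves goals [TT] and [pp] goals [PP]. A term known outside is
    weakened under up to six binders. *)
Ltac tt_leaf :=
  first
  [ exact: TT_const | exact: TT_size
  | exact (TT_headn 0 _) | exact (TT_headn 1 _) | exact (TT_headn 2 _)
  | exact (TT_headn 3 _) | exact (TT_headn 4 _) | exact (TT_headn 5 _)
  | match goal with
    | H : TT _ _ |- TT _ _ =>
      first [ exact H | exact (TT_weakn 1 H) | exact (TT_weakn 2 H)
            | exact (TT_weakn 3 H) | exact (TT_weakn 4 H) | exact (TT_weakn 5 H)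
            | exact (TT_weakn 6 H) ]
    end ].

Ltac tt :=
  cbv beta;
  first
  [ tt_leaf
  | lazymatch goal with
    | |- TT ?d (fun x e => addn (@?p x e) (@?q x e)) =>
        refine (@TT_add d p q _ _); tt
    | |- TT ?d (fun x e => muln (@?p x e) (@?q x e)) =>
        refine (@TT_mul d p q _ _); tt
    | |- TT ?d (fun x e => S (@?p x e)) => refine (@TT_S d p _); tt
    end ].

Ltac pp :=
  cbv beta;
  first
  [ exact: PP_const
  | match goal with
    | H : forall d, _ |- PP _ _ => apply: H; tt
    end
  | lazymatch goal with
    | |- PP ?d (fun x e => andb (@?p x e) (@?q x e)) =>
        refine (@PP_and d p q _ _); pp
    | |- PP ?d (fun x e => orb (@?p x e) (@?q x e)) =>
        refine (@PP_or d p q _ _); pp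
    | |- PP ?d (fun x e => implb (@?p x e) (@?q x e)) =>
        refine (@PP_imply d p q _ _); pp
    | |- PP ?d (fun x e => negb (@?p x e)) => refine (@PP_neg d p _); pp
    | |- PP ?d (fun x e => exb (@?t x e) (@?G x e)) =>
        refine (@PP_exb d t G _ _); [tt | pp]
    | |- PP ?d (fun x e => allb (@?t x e) (@?G x e)) =>
        refine (@PP_allb d t G _ _); [tt | pp]
    | |- PP ?d (fun x e => leq (@?p x e) (@?q x e)) =>
        refine (@PP_leq d p q _ _); tt
    | |- PP ?d (fun x e => @nth _ false x (@?p x e)) => refine (@PP_bit d p _); tt
    | |- PP ?d (fun x e => eq_op (@?p x e) (@?q x e)) =>
        first [ refine (@PP_eqn d p q _ _); tt | refine (@PP_eqb d p q _ _); pp ]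
    | |- _ => idtac
    end ].

(** [ws] holds the vertices chosen so far. The recursion unfolds to m nested bounded quantifiers,
    which is polynomial since m is the constant [k.+1]. *)
Fixpoint extend (e up : nat -> nat -> bool) n v m (ws : seq nat) : bool :=
  if m is m'.+1 then
    exb n (fun w => [&& (w == v) || up v w, all (fun u => (u != w) && ~~ e u w) ws
                      & extend e up n v m' (w :: ws)])
  else true.

Section Formula.
Implicit Types (w : seq bool) (n : nat).

(** The layout of a pair code: the graph code of length [gsize n], doubled; the separator; then the
    matrices of [ord] and [up]. *)
Definition gsize n := n.+1 + n * n.
Definition ebit w n i j := nth false w (2 * (n.+1 + (i * n + j))).
Definition obit w n i j := nth false w (2 * gsize n + 2 + (i * n + j)).
Definition hbit w n i j := nth false w (2 * gsize n + 2 + (n * n + (i * n + j))).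

(** Doubled bits followed by 01 fix the place of the separator and thereby the length of the first
    component; the prefix 1^n 0 ties that length to n. *)
Definition wf w n :=
  [&& allb (gsize n) (fun i => nth false w (2 * i) == nth false w (2 * i).+1),
      ~~ nth false w (2 * gsize n), nth false w (2 * gsize n).+1,
      allb n (fun i => nth false w (2 * i)) & ~~ nth false w (2 * n)].

Definition sgraph_ok w n :=
  allb n (fun i => ~~ ebit w n i i && allb n (fun j => ebit w n i j == ebit w n j i)).

Definition elim_ok w n :=
  allb n (fun i => ~~ obit w n i i && allb n (fun j =>
    [&& [|| i == j, obit w n i j | obit w n j i],
        hbit w n i j ==> obit w n i j,
        ebit w n i j && obit w n i j ==> hbit w n i j &
        allb n (fun l => (obit w n i j && obit w n j l ==> obit w n i l) &&
          ([&& hbit w n i j, hbit w n i l & obit w n j l] ==> hbit w n j l))])).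

Definition alpha_ok k w n :=
  allb n (fun v => ~~ extend (ebit w n) (hbit w n) n v k.+1 [::]).

Definition vcheck k w :=
  exb (size w) (fun n => [&& wf w n, sgraph_ok w n, elim_ok w n & alpha_ok k w n]).

End Formula.

Lemma PP_ebit d n i j : TT d n -> TT d i -> TT d j ->
  PP d (fun x e => ebit x (n x e) (i x e) (j x e)).
Proof. by move=> hn hi hj; rewrite /ebit; pp. Qed.

Lemma PP_obit d n i j : TT d n -> TT d i -> TT d j ->
  PP d (fun x e => obit x (n x e) (i x e) (j x e)).
Proof. by move=> hn hi hj; rewrite /obit /gsize; pp. Qed.

Lemma PP_hbit d n i j : TT d n -> TT d i -> TT d j ->
  PP d (fun x e => hbit x (n x e) (i x e) (j x e)).
Proof. by move=> hn hi hj; rewrite /hbit /gsize; pp. Qed.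

Lemma PP_all_terms d (s : seq (seq bool -> seq nat -> nat))
    (F : seq bool -> seq nat -> nat -> bool) :
  List.Forall (TT d) s -> (forall t, TT d t -> PP d (fun x e => F x e (t x e))) ->
  PP d (fun x e => all (F x e) [seq t x e | t <- s]).
Proof.
move=> hs hF; elim: hs => [|t {}s ht _ IH] /=; first exact: PP_const.
by apply: PP_and => //; apply: hF.
Qed.

(** The chosen vertices are variables bound at different depths, so [ws] is a list of terms, all
    weakened at each new binder. *)
Lemma PP_extend d n v m (ws : seq (seq bool -> seq nat -> nat)) :
  TT d n -> TT d v -> List.Forall (TT d) ws ->
  PP d (fun x e => extend (ebit x (n x e)) (hbit x (n x e)) (n x e) (v x e) m
                     [seq t x e | t <- ws]).
Proof.
elim: m d n v ws => [|m IH] d n v ws hn hv hws /=; first exact: PP_const.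
pose weak := fun (t : seq bool -> seq nat -> nat) x e => t x (behead e).
pose hd := fun (x : seq bool) (e : seq nat) => head 0 e.
have hd1 : TT d.+1 hd by exact (TT_headn 0 d).
have hws1 : List.Forall (TT d.+1) [seq weak t | t <- ws].
  elim: hws => [|t s ht _ IHs] /=; constructor => //; exact: TT_weak.
apply: PP_exb => //; apply: PP_and; first apply: PP_or.
- by pp.
- by apply: PP_hbit; tt.
apply: PP_and.
  pose F (x : seq bool) e u := (u != head 0 e) && ~~ ebit x (n x (behead e)) u (head 0 e).
  apply: PP_ext (@PP_all_terms _ _ F hws1 _) => [x e|t ht].
    by rewrite /F /weak -map_comp.
  apply: PP_and; first by pp.
  by apply: PP_neg; apply: PP_ebit; tt.
apply: PP_ext (IH _ (weak n) (weak v) (hd :: [seq weak t | t <- ws]) _ _ _) => [x e| | |].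
- by rewrite /= -map_comp.
- exact: TT_weak.
- exact: TT_weak.
- by constructor.
Qed.

Lemma PP_alpha_ok k d n : TT d n -> PP d (fun x e => alpha_ok k x (n x e)).
Proof.
move=> hn; rewrite /alpha_ok.
refine (@PP_allb d n (fun x e v => ~~ extend (ebit x (n x e)) (hbit x (n x e))
  (n x e) v k.+1 [::]) hn (PP_neg _)).
apply: (@PP_extend d.+1 (fun x e => n x (behead e)) (fun x e => head 0 e) k.+1 [::]).
- by tt.
- by tt.
- by constructor.
Qed.

Lemma PP_vcheck k : PP 0 (fun x e => vcheck k x).
Proof.
have He := PP_ebit; have Ho := PP_obit; have Hh := PP_hbit.
have Ha := @PP_alpha_ok k.
by rewrite /vcheck /wf /sgraph_ok /elim_ok /gsize; pp.
Qed.

Lemma nth_double (x z : seq bool) i : i < size x ->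
  nth false (flatten [seq [:: b; b] | b <- x] ++ z) (2 * i) = nth false x i /\
  nth false (flatten [seq [:: b; b] | b <- x] ++ z) (2 * i).+1 = nth false x i.
Proof.
elim: x i => // b x IH [|i] hi; first by rewrite muln0.
rewrite (_ : 2 * i.+1 = (2 * i).+2); [exact: (IH i hi) | lia].
Qed.

Lemma size_double (x : seq bool) : size (flatten [seq [:: b; b] | b <- x]) = 2 * size x.
Proof. by elim: x => //= b x ->; rewrite mulnS. Qed.

Lemma nth_pair_sep x y :
  nth false (pair_code x y) (2 * size x) = false /\
  nth false (pair_code x y) (2 * size x).+1 = true.
Proof.
by rewrite !nth_cat size_double ltnn subnn ifN ?subSnn // -leqNgt.
Qed.

Lemma nth_pair_y x y i : nth false (pair_code x y) (2 * size x + 2 + i) = nth false y i.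
Proof.
rewrite nth_cat size_double ifN; last by lia.
by rewrite (_ : _ - _ = i.+2) //; lia.
Qed.

Lemma nth_allpairs (f : nat -> nat -> bool) (s t : seq nat) i j :
  i < size s -> j < size t ->
  nth false [seq f a b | a <- s, b <- t] (i * size t + j) = f (nth 0 s i) (nth 0 t j).
Proof.
elim: s i => [|a s IH] [|i] //= hi hj; rewrite nth_cat size_map.
  by rewrite mul0n add0n hj (nth_map 0).
rewrite mulSn -addnA ifN; last by rewrite -leqNgt leq_addr.
by rewrite addKn IH.
Qed.

Definition bits n (e : rel 'I_n) : seq bool := [seq e i j | i <- enum 'I_n, j <- enum 'I_n].

Lemma size_bits n (e : rel 'I_n) : size (bits e) = n * n.
Proof. by rewrite size_allpairs !size_enum_ord. Qed.

Lemma nth_bits n (e : rel 'I_n) (i j : 'I_n) : nth false (bits e) (i * n + j) = e i j.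
Proof.
have n0 : 0 < n by apply: leq_ltn_trans (ltn_ord i).
case: n n0 e i j => // n _ e i j.
pose f a b := e (inord a) (inord b).
have -> : bits e = [seq f a b | a <- iota 0 n.+1, b <- iota 0 n.+1].
  rewrite /bits -val_enum_ord allpairs_mapl allpairs_mapr.
  by apply: eq_allpairs => a b; rewrite /f !inord_val.
have := @nth_allpairs f (iota 0 n.+1) (iota 0 n.+1) i j.
rewrite !size_iota => -> //; rewrite !nth_iota // !add0n /f; congr (e _ _); exact: inord_val.
Qed.

Lemma size_code n (e : rel 'I_n) : size (graph_code e) = gsize n.
Proof. by rewrite size_cat size_nseq /= -/(bits e) size_bits addnS. Qed.

Lemma nth_code n (e : rel 'I_n) :
  [/\ forall i, i < n -> nth false (graph_code e) i = true,
      nth false (graph_code e) n = false &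
      forall i, nth false (graph_code e) (n.+1 + i) = nth false (bits e) i].
Proof.
split=> [i hi||i]; rewrite nth_cat size_nseq.
- by rewrite hi nth_nseq hi.
- by rewrite ltnn subnn.
rewrite ifN; last by rewrite -leqNgt addSn leqW // leq_addr.
by rewrite addSn -addnS addKn.
Qed.

Lemma allb_ord n (P : nat -> bool) : reflect (forall i : 'I_n, P i) (allb n P).
Proof.
apply: (iffP (allbP _ _)) => [h i|h a an]; first exact: h.
exact: (h (Ordinal an)).
Qed.

Section Extend.
Variables (n : nat) (e up : nat -> nat -> bool) (v : 'I_n).
Let compat (u w : 'I_n) := (u != w) && ~~ e u w.

Lemma extendP m (ws : seq 'I_n) :
  reflect (exists s : seq 'I_n, [/\ size s = m,
             all (fun w : 'I_n => (w == v) || up v w) s,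
             allrel compat ws s & pairwise compat s])
          (extend e up n v m (map val ws)).
Proof.
elim: m ws => [|m IH] ws /=.
  by constructor; exists [::]; rewrite /= allrel0r.
apply: (iffP (exbP _ _)) => [[w wn /and3P[hb hc]]|[s [sz hb hc hp]]].
  rewrite -[w :: _]/([seq val i | i <- Ordinal wn :: ws]) => /IH[s [sz hs hr hp]].
  exists (Ordinal wn :: s); split=> /=.
  - by rewrite sz.
  - by rewrite hs andbT.
  - rewrite allrel_consr; move: hr; rewrite allrel_consl => /andP[_ ->].
    by rewrite andbT; move: hc; rewrite all_map.
  - by move: hr; rewrite allrel_consl => /andP[-> _].
case: s sz hb hc hp => // w s [sz] /= /andP[hw hb] hc /andP[hws hp].
exists w => //; move: hc; rewrite allrel_consr => /andP[hc1 hc2].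
apply/and3P; split=> //; first by rewrite all_map.
rewrite -[val w :: _]/([seq val i | i <- w :: ws]); apply/IH; exists s; split=> //.
by rewrite allrel_consl hws.
Qed.

End Extend.

Section Valid.
Variables (n : nat) (e ord up : rel 'I_n) (k : nat) (w : seq bool).
Hypotheses (es : symmetric e) (ei : irreflexive e).
Hypothesis eE : forall i j : 'I_n, ebit w n i j = e i j.
Hypothesis oE : forall i j : 'I_n, obit w n i j = ord i j.
Hypothesis hE : forall i j : 'I_n, hbit w n i j = up i j.

Lemma elim_okP : reflect (elimination e ord up) (elim_ok w n).
Proof.
apply: (iffP (allb_ord _ _)) => [h|[h1 h2 h3 h4 h5 h6] i].
  have h0 i j := (allb_ord _ _ (proj2 (andP (h i)))) j.
  split=> [i|u v z uv vz|u v|u v|u v|v i j].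
  - by case/andP: (h i); rewrite oE.
  - have /and4P[_ _ _ /allb_ord /(_ z) /andP[]] := h0 u v.
    by rewrite !oE uv vz.
  - by have /and4P[] := h0 u v; rewrite !oE.
  - by have /and4P[_] := h0 u v; rewrite !oE hE => /implyP.
  - by have /and4P[_ _] := h0 u v; rewrite oE eE hE => /implyP h' _ uv o; apply: h'; rewrite uv.
  - have /and4P[_ _ _ /allb_ord /(_ j) /andP[_]] := h0 v i.
    by rewrite !hE !oE => /implyP h' vi vj ij; apply: h'; rewrite vi vj.
rewrite oE h1; apply/allb_ord => j; rewrite !oE hE eE; apply/and4P; split.
- exact: h3.
- by apply/implyP/h4.
- by apply/implyP => /andP[]; apply: h5.
apply/allb_ord => l; rewrite !oE !hE; apply/andP; split; apply/implyP.
  by case/andP; apply: h2.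
by case/and3P; apply: h6.
Qed.

Lemma sgraph_okP : sgraph_ok w n.
Proof.
apply/allb_ord => i; rewrite eE ei; apply/allb_ord => j.
by rewrite !eE es.
Qed.

Lemma alpha_okP : reflect (forall v (S : {set SGraph es ei}),
    independent S -> S \subset elbag up v -> #|S| <= k) (alpha_ok k w n).
Proof.
pose compat (u w : 'I_n) := (u != w) && ~~ e u w.
have compatE (s : seq 'I_n) : pairwise (fun u z : 'I_n => (u != z) && ~~ ebit w n u z) s =
    pairwise compat s.
  by apply: eq_pairwise => u z; rewrite eE.
apply: (iffP (allb_ord _ _)) => h v.
  move=> S iS SB; rewrite leqNgt; apply/negP => hS; case/negP: (h v).
  apply/(@extendP _ _ _ v _ [::]); exists (take k.+1 (enum S)); split=> //.
  - by rewrite size_takel // -cardE.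
  - apply/allP => z /mem_take; rewrite mem_enum => /(subsetP SB).
    by rewrite inE hE.
  rewrite compatE; apply: (subseq_pairwise (take_subseq _ _)).
  rewrite /compat (pairwise_relI (fun u z => u != z)) -uniq_pairwise enum_uniq.
  apply/(pairwiseP v) => i j; rewrite !inE => hi hj _.
  apply: (forall_inP (forall_inP iS _ _)); by rewrite -mem_enum mem_nth.
apply/negP => /(@extendP _ _ _ v _ [::]) [s [sz hb _ hp]].
move: hp; rewrite compatE (pairwise_relI (fun u z => u != z)) -uniq_pairwise.
case/andP=> us hp.
have := h v [set z in s]; rewrite cardsE (card_uniqP us) sz ltnn => /(_ _ _)/negP[] //.
  apply/forall_inP => a; rewrite inE => sa; apply/forall_inP => b; rewrite inE => sb.
  have sym : symmetric (fun u z => ~~ e u z) by move=> x y; rewrite es.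
  have := nth_index v sa; have := nth_index v sb => <- <-.
  case: (ltngtP (index a s) (index b s)) => [hab|hab|->]; last by rewrite /= ei.
    by apply: (pairwiseP v hp); rewrite ?inE ?index_mem.
  by rewrite /= es; apply: (pairwiseP v hp); rewrite ?inE ?index_mem.
apply/subsetP => z; rewrite !inE => /(allP hb).
by rewrite hE.
Qed.

End Valid.

Theorem tree_alpha_in_NP k :
  in_NP (graph_problem (fun G : sgraph => tree_alpha G <= k)).
Proof.
(* The certificate consists of two n by n matrices, each shorter than the graph code. *)
exists (vcheck k), ('X + 'X)%R; split.
  have := @polytime_mkseq (fun x e => vcheck k x) (fun _ _ => 1).
  apply; first exact: TT_const.
  by have := PP_weak (PP_vcheck k).
move=> x; rewrite hornerD hornerX; split.
  case=> n [e [es [ei [-> /tree_alpha_elimination[ord [up [el hk]]]]]]].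
  exists (bits ord ++ bits up); split.
    by rewrite size_cat !size_bits size_code leq_add // leq_addl.
  set w := pair_code _ _.
  have [c1 c2 c3] := nth_code e.
  have eE (i j : 'I_n) : ebit w n i j = e i j.
    have h : n.+1 + (i * n + j) < size (graph_code e).
      rewrite size_code ltn_add2l; have := ltn_ord i; have := ltn_ord j; nia.
    by rewrite /ebit (nth_double _ h).1 c3 nth_bits.
  have oE (i j : 'I_n) : obit w n i j = ord i j.
    rewrite /obit -(size_code e) nth_pair_y nth_cat size_bits ifT ?nth_bits //.
    have := ltn_ord i; have := ltn_ord j; nia.
  have hE (i j : 'I_n) : hbit w n i j = up i j.
    rewrite /hbit -(size_code e) nth_pair_y nth_cat size_bits ifN -?leqNgt ?leq_addr //.
    by rewrite addKn nth_bits.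
  apply/exbP; exists n.
    by rewrite size_cat size_double size_code /gsize /=; lia.
  apply/and4P; split.
  - rewrite /wf -(size_code e) (nth_pair_sep _ _).1 (nth_pair_sep _ _).2 /=.
    have hn i : i <= n -> i < size (graph_code e) by rewrite size_code /gsize; lia.
    rewrite (nth_double _ (hn n (leqnn n))).1 c2 andbT.
    apply/andP; split; apply/allbP => i hi.
      by rewrite (nth_double _ hi).1 (nth_double _ hi).2.
    by rewrite (nth_double _ (hn i (ltnW hi))).1 c1.
  - exact: (sgraph_okP es ei eE).
  - exact: (introT (@elim_okP n e ord up w eE oE hE) el).
  - exact: (introT (@alpha_okP n e up k w es ei eE hE) hk).
case=> y [_ /exbP[n _ /and4P[hwf hs hel hal]]].
set w := pair_code x y in hwf hs hel hal.
have /and5P[/allbP w1 w2 w3 /allbP w4 w5] := hwf.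
(* The separator consists of two different bits, so it can neither lie among the doubled bits
   required by [wf] nor leave the 01 of [wf] among the doubled bits of x. *)
have sx : size x = gsize n.
  case: (ltngtP (size x) (gsize n)) => [h|h|//].
    by have := w1 _ h; rewrite (nth_pair_sep x y).1 (nth_pair_sep x y).2.
  by have [e1 e2] := nth_double [:: false, true & y] h; rewrite -/w -/(pair_code x y) -/w e1 in w2; rewrite e2 (negPf w2) in w3.
have xE i : i < gsize n -> nth false x i = nth false w (2 * i).
  by rewrite -sx => hi; have [] := nth_double [:: false, true & y] hi.
pose e : rel 'I_n := fun i j => ebit w n i j.
pose ord : rel 'I_n := fun i j => obit w n i j.
pose up : rel 'I_n := fun i j => hbit w n i j.
have ei : irreflexive e.
  by move=> i; apply/negbTE; have /allb_ord /(_ i) /andP[] := hs.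
have es : symmetric e.
  by move=> i j; apply/eqP; have /allb_ord /(_ i) /andP[_ /allb_ord] := hs; apply.
exists n, e, es, ei; split; last first.
  apply: (@elimination_tree_alpha (SGraph es ei) k ord up).
    exact: (elimT (@elim_okP n e ord up w (fun _ _ => erefl) (fun _ _ => erefl) (fun _ _ => erefl)) hel).
  exact: (elimT (@alpha_okP n e up k w es ei (fun _ _ => erefl) (fun _ _ => erefl)) hal).
have [c1 c2 c3] := nth_code e.
apply: (@eq_from_nth _ false); rewrite ?size_code // sx => i hi.
case: (ltngtP i n) => [h|h|->].
- by rewrite c1 // xE // w4.
- have [i' ei'] : exists i', i = n.+1 + i' by exists (i - n.+1); lia.
  move: hi; rewrite ei' ltn_add2l c3 => hi.
  have n0 : 0 < n by case: (n) hi.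
  have h1 : i' %/ n < n by rewrite ltn_divLR.
  have h2 : i' %% n < n by rewrite ltn_mod.
  rewrite (divn_eq i' n) (nth_bits e (Ordinal h1) (Ordinal h2)) /= /e /ebit /= xE //.
  by rewrite -divn_eq ltn_add2l.
by rewrite c2 xE ?(negPf w5) // /gsize; lia.
Qed.

(** * The gadget graph *)

(** Tags depend on the machine and on k only, so the reduction can enumerate them; everything that
    grows with the input is in the second component of a vertex. *)
Inductive gtag (R : Type) (k : nat) :=
| GA of R & 'I_3 | GB of R & 'I_3
| GL of 'I_(k - 2) | GR of 'I_(k - 1) | GU of 'I_k.+1 | GV of 'I_k.+1.
Arguments GA {R k}. Arguments GB {R k}. Arguments GL {R k}.
Arguments GR {R k}. Arguments GU {R k}. Arguments GV {R k}.

Section TagFinite.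
Variables (R : finType) (k : nat).

Definition gtag_code (s : gtag R k) :
    (R * 'I_3 + R * 'I_3) + (('I_(k - 2) + 'I_(k - 1)) + ('I_k.+1 + 'I_k.+1)) :=
  match s with
  | GA r j => inl (inl (r, j)) | GB r j => inl (inr (r, j))
  | GL i => inr (inl (inl i)) | GR i => inr (inl (inr i))
  | GU i => inr (inr (inl i)) | GV i => inr (inr (inr i))
  end.

Definition gtag_decode c : gtag R k :=
  match c with
  | inl (inl (r, j)) => GA r j | inl (inr (r, j)) => GB r j
  | inr (inl (inl i)) => GL i | inr (inl (inr i)) => GR i
  | inr (inr (inl i)) => GU i | inr (inr (inr i)) => GV i
  end.

Lemma gtag_codeK : cancel gtag_code gtag_decode.
Proof. by case. Qed.

HB.instance Definition _ := Finite.copy (gtag R k) (can_type gtag_codeK).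

End TagFinite.

(* Two tags determine the adjacency of two vertices up to the bits [same] (equal
   second components) and [conf] (the two literals contradict each other). *)
Definition tag_adj (R : finType) k (s s' : gtag R k) (same conf : bool) : bool :=
  match s, s' with
  | GA _ _, GA _ _ => ~~ conf
  | GB r _, GB r' _ => ~~ ((r == r') && same)
  | GA r j, GB r' j' | GB r j, GA r' j' => [&& r == r', j == j' & same]
  | GA _ _, GL _ | GL _, GA _ _ | GA _ _, GU _ | GU _, GA _ _
  | GB _ _, GR _ | GR _, GB _ _ | GB _ _, GV _ | GV _, GB _ _
  | GL _, GR _ | GR _, GL _ | GL _, GU _ | GU _, GL _ | GR _, GV _ | GV _, GR _ => true
  | GL i, GL i' => i == i'
  | GR i, GR i' => i == i'
  | GU i, GU i' => i == i'
  | GV i, GV i' => i == i'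
  | _, _ => false
  end.

Section Gadget.
Variables (R Y : finType) (V : eqType) (k : nat).
Variables (guard : R -> Y -> bool) (lit : R -> 'I_3 -> Y -> bool * V).
Hypothesis k4 : 4 <= k.

(** Pairs (r, y) with a failing guard have vertices too, which keeps the vertex set a full product;
    as they conflict with nothing, they impose no constraint. *)
Definition tag_conf (s s' : gtag R k) (y y' : Y) : bool :=
  match s, s' with
  | GA r j, GA r' j' =>
      [&& guard r y, guard r' y', (lit r j y).1 != (lit r' j' y').1 &
          (lit r j y).2 == (lit r' j' y').2]
  | _, _ => false
  end.

(* A clause is a pair (r, y). For the tags [GL] to [GV] the component in [Y] only
   produces true twins; it makes all vertices have the same shape. *)
Notation vert := (gtag R k * Y)%type.

Definition gadj (v w : vert) : bool :=
  (v != w) && tag_adj v.1 w.1 (v.2 == w.2) (tag_conf v.1 w.1 v.2 w.2).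

Lemma gadj_sym : symmetric gadj.
Proof.
move=> [s y] [s' y']; rewrite /gadj eq_sym /=; congr (_ && _).
case: s s' => [r j|r j|i|i|i|i] [r' j'|r' j'|i'|i'|i'|i'] //=; try by rewrite eq_sym.
- congr (~~ _); rewrite andbCA; congr [&& _, _, ~~ _ & _]; exact: eq_sym.
- by congr [&& _, _ & _]; exact: eq_sym.
- by congr [&& _, _ & _]; exact: eq_sym.
- by congr (~~ (_ && _)); exact: eq_sym.
Qed.

Lemma gadj_irr : irreflexive gadj.
Proof. by move=> v; rewrite /gadj eqxx. Qed.

Definition gadget : sgraph := SGraph gadj_sym gadj_irr.

Definition satisfies (A : V -> bool) :=
  forall r y, guard r y -> exists j, A (lit r j y).2 == (lit r j y).1.

Section Upper.
Variable A : V -> bool.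
Hypothesis satA : satisfies A.

Let P r j y := ~~ guard r y || (A (lit r j y).2 == (lit r j y).1).

Lemma P_hit r y : exists j, P r j y.
Proof.
rewrite /P; case: (boolP (guard r y)) => [/satA [j hj]|_]; last by exists ord0.
by exists j.
Qed.

Let hit r y : 'I_3 := xchoose (P_hit r y).

Lemma P_conf r j y r' j' y' : P r j y -> P r' j' y' ->
  tag_conf (GA r j) (GA r' j') y y' = false.
Proof.
move=> h h'; apply/negbTE/negP => /and4P[g g' ne /eqP e].
move: h h' ne; rewrite /P g g' /= e => /eqP -> /eqP ->.
by rewrite eqxx.
Qed.

(* Elimination proceeds by stages: U and V, the false a_x, L, everything else.
   The bag of v consists of v and the later vertices in [core v]. *)
Definition stage (v : vert) : nat :=
  match v.1 with
  | GU _ | GV _ => 0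
  | GA r j => if P r j v.2 then 3 else 1
  | GL _ => 2
  | GB _ _ | GR _ => 3
  end.

Definition core (v w : vert) : bool :=
  match v.1, w.1 with
  | GU i, GU i' | GV i, GV i' => i == i'
  | GU _, (GA _ _ | GL _) => true
  | GV _, (GB _ _ | GR _) => true
  | (GU _ | GV _), _ => false
  | _, (GU _ | GV _) => false
  | _, GA r j => (stage v == 1) || P r j w.2
  | _, GB r j => (stage v == 3) || ~~ P r j w.2
  | _, GL _ => stage v != 3
  | _, GR _ => stage v != 1
  end.

Definition gord (v w : vert) :=
  (stage v < stage w) || (stage v == stage w) && (enum_rank v < enum_rank w).

Definition gup v w := gord v w && core v w.

Lemma gord_stage v w : gord v w -> stage v <= stage w.
Proof. by rewrite /gord; lia. Qed.

Lemma gadget_elimination : elimination gadj gord gup.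
Proof.
split.
- by move=> u; rewrite /gord !ltnn andbF.
- by move=> u v w; rewrite /gord; lia.
- move=> u v; rewrite /gord; have [->|uv] := eqVneq u v; first by [].
  have : enum_rank u != enum_rank v :> nat.
    by rewrite (inj_eq val_inj) (inj_eq enum_rank_inj).
  by rewrite /=; lia.
- by move=> u v /andP[].
- move=> [s y] [s' y'] /andP[_ h] uv; rewrite /gup uv; move/gord_stage: uv; move: h.
  rewrite /core /stage.
  case: s s' => [r j|r j|i|i|i|i] [r' j'|r' j'|i'|i'|i'|i'] //=.
  all: try by case/and3P=> /eqP -> /eqP -> /eqP ->; case: (P _ _ _).
  all: try by repeat match goal with |- context [P ?r ?j ?y] => case: (P r j y) end.
- move=> [s y] [s1 y1] [s2 y2] /andP[_ h1] /andP[_ h2] u12; rewrite /gup u12.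
  move/gord_stage: u12; move: h1 h2; rewrite /core /stage.
  case: s s1 s2 => [r j|r j|i|i|i|i] [r1 j1|r1 j1|i1|i1|i1|i1] [r2 j2|r2 j2|i2|i2|i2|i2] //=;
    try (by move=> /eqP <- /eqP <-);
    by repeat match goal with |- context [P ?r ?j ?y] => case: (P r j y) end.
Qed.

(** The index of the clique covering w in the bag of v. The a_x get 0 if only true ones occur,
    otherwise their sign 0 or 1. The b_x get 1 to 3 by their place; where only false ones occur,
    they get [k - 2] or [k - 1] by their place among the two left by [hit]. Vertices of L and R
    complete these cliques. *)
Definition color (v w : vert) : nat :=
  match w.1 with
  | GA r j => match v.1 with
              | GU _ => (lit r j w.2).1
              | _ => if stage v == 1 then (lit r j w.2).1 : nat else 0
              end
  | GB r j => match v.1 with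
              | GV _ => j.+1
              | _ => if stage v == 3 then j.+1 else k - 2 + unbump (hit r w.2) j
              end
  | GL i => i
  | GR i => i.+1
  | GU _ | GV _ => 0
  end.

Lemma color_lt v w : core v w -> color v w < k.
Proof.
have hP r y : P r (hit r y) y by exact: (xchooseP (P_hit r y)).
have sl r j y : ~~ P r j y -> unbump (hit r y) j < 2.
  move=> np; have : j != hit r y by apply: contraNneq np => ->.
  rewrite -(inj_eq val_inj) /unbump /=; have := ltn_ord j; have := ltn_ord (hit r y).
  by case: ltnP; lia.
have s1 (b : bool) : b < k by case: b; lia.
case: v w => [s y] [s' y']; rewrite /core /color /stage /=.
case: s' => [r' j'|r' j'|i'|i'|i'|i'] /=; try (by move=> _; lia);
  try (by move=> _; have := ltn_ord i'; lia).
  have k0 : 0 < k by lia.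
  by case: s => [r j|r j|i|i|i|i] //= _; case: ifP; rewrite ?s1 ?k0.
have := ltn_ord j'; have := sl r' j' y'; set u := unbump _ _.
case: s => [r j|r j|i|i|i|i] //=; try (by move=> ? ? _; lia).
- by case: (P r j y) => /= h h'; [lia|]; move/h; lia.
- by move=> h h' /h; lia.
Qed.

Lemma core_refl v : core v v.
Proof.
case: v => [[r j|r j|i|i|i|i] y]; rewrite /core /stage //=.
by case: (P r j y).
Qed.

Lemma unbump_hit r j j' y : ~~ P r j y -> ~~ P r j' y ->
  unbump (hit r y) j = unbump (hit r y) j' -> j = j'.
Proof.
have hP : P r (hit r y) y by exact: (xchooseP (P_hit r y)).
move=> np np' e; apply: val_inj; apply: (can_in_inj (@unbumpK (hit r y))) e;
  rewrite inE; first by apply: contraNneq np => /val_inj ->.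
by apply: contraNneq np' => /val_inj ->.
Qed.

Lemma color_adj v w w' : core v w -> core v w' ->
  color v w = color v w' -> w != w' -> gadj w w'.
Proof.
move=> hw hw' hc ne; rewrite /gadj ne; move: hw hw' hc ne.
have conf1 r j y r' j' y' : nat_of_bool (lit r j y).1 = (lit r' j' y').1 ->
    ~~ tag_conf (GA r j) (GA r' j') y y'.
  move=> e; apply/negP=> /and4P[_ _]; move: e.
  by case: (lit r j y).1; case: (lit r' j' y').1.
have conf3 r j y r' j' y' : P r j y -> P r' j' y' ->
    ~~ tag_conf (GA r j) (GA r' j') y y'.
  by move=> p p'; rewrite P_conf.
have sb (b : bool) (u : nat) : nat_of_bool b = k - 2 + u -> False by case: b; lia.
have sb' (b : bool) (u : nat) : k - 2 + u = nat_of_bool b -> False by case: b; lia.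
have il (i : 'I_(k - 2)) (u : nat) : i = k - 2 + u :> nat -> False.
  by have := ltn_ord i; lia.
have il' (i : 'I_(k - 2)) (u : nat) : k - 2 + u = i -> False.
  by have := ltn_ord i; lia.
have bb (r r' : R) (j j' : 'I_3) (y y' : Y) : (r = r' -> y = y' -> j = j') ->
    (GB r j : gtag R k, y) != (GB r' j', y') -> ~~ ((r == r') && (y == y')).
  move=> h ne; apply/negP => /andP[/eqP er /eqP ey].
  by rewrite er ey (h er ey) eqxx in ne.
case: v w w' => [s y] [s1 y1] [s2 y2]; rewrite /core /color /stage /=.
case: s => [r j|r j|i|i|i|i] /=; last 4 first.
all: try case: (P r j y) => /=.
all: case: s1 => [r1 j1|r1 j1|i1|i1|i1|i1] //=;
     case: s2 => [r2 j2|r2 j2|i2|i2|i2|i2] //=.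
all: try by move=> _ _ /val_inj ->.
all: try by move=> _ _ [/val_inj ->].
all: try by move=> /eqP <- /eqP <-.
all: try by move=> _ _ /conf1.
all: try by move=> h1 h2 _ _; apply: conf3.
all: try by move=> _ _ /sb.
all: try by move=> _ _ /sb'.
all: try by move=> _ _ /il.
all: try by move=> _ _ /il'.
all: try by move=> _ _; lia.
all: try by move=> _ _ [/val_inj ->]; apply: bb.
(* What remains are two false b_x with the same colour, which within one clause are equal by
   injectivity of [unbump] away from [hit]. *)
all: move=> h1 h2 /addnI e; apply: bb => er ey; move: h2 e; rewrite -er -ey.
all: exact: unbump_hit.
Qed.

Lemma gadget_upper : tree_alpha gadget <= k.
Proof.
apply: (@elimination_tree_alpha gadget k gord gup gadget_elimination) => v S iS SB.
have core_in w : w \in S -> core v w.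
  by move/(subsetP SB); rewrite inE => /orP[/eqP ->|/andP[_ ->]]; rewrite ?core_refl.
rewrite cardE -(size_map (color v)); apply: leq_trans (eq_leq (size_iota 0 k)).
apply: uniq_leq_size.
  rewrite map_inj_in_uniq ?enum_uniq // => w w'; rewrite !mem_enum => wS w'S e.
  apply/eqP/negPn/negP => ne.
  have := forall_inP (forall_inP iS _ wS) _ w'S; rewrite /=.
  by rewrite (color_adj (core_in _ wS) (core_in _ w'S) e ne).
move=> c /mapP[w]; rewrite mem_enum => wS ->; rewrite mem_iota /= add0n.
exact: color_lt (core_in _ wS).
Qed.

End Upper.

Section Lower.
Variables (r0 : R) (y0 : Y).
Variable D : tree_decomposition gadget.
Hypothesis hD : forall (t : td_tree D) (S : {set gadget}),
  independent S -> S \subset bag t -> #|S| <= k.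

Definition fan m (f : 'I_m -> gtag R k) (y : Y) : {set gadget} :=
  [set ((f i, y) : vert) | i : 'I_m].

Lemma fanP m (f : 'I_m -> gtag R k) y (v : gadget) :
  reflect (exists i, v = (f i, y)) (v \in fan f y).
Proof. by apply: (iffP imsetP) => [[i _ ->]|[i ->]]; exists i. Qed.

Lemma card_fan m (f : 'I_m -> gtag R k) y : injective f -> #|fan f y| = m.
Proof.
move=> fi; rewrite card_imset ?card_ord // => i j [e]; exact: fi.
Qed.

Lemma fan_sub m (f : 'I_m -> gtag R k) y (X : {set gadget}) :
  (forall i, ((f i, y) : gadget) \in X) -> fan f y \subset X.
Proof. by move=> h; apply/subsetP => v /fanP[i ->]. Qed.

Lemma independent_union (S S' : {set gadget}) (t : td_tree D) :
  (forall v w, v \in S -> w \in S -> ~~ gadj v w) ->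
  (forall v w, v \in S' -> w \in S' -> ~~ gadj v w) ->
  (forall v w, v \in S -> w \in S' -> (v != w) && ~~ gadj v w) ->
  S \subset bag t -> S' \subset bag t -> #|S| + #|S'| <= k.
Proof.
move=> h1 h2 h3 s1 s2; have dis : S :&: S' = set0.
  apply/setP=> v; rewrite !inE; apply/negbTE/negP => /andP[a b].
  by have := h3 v v a b; rewrite eqxx.
have := cardsU S S'; rewrite dis cards0 subn0 => <-.
apply: (hD (t := t)); last by rewrite subUset s1.
apply/forall_inP => v /setUP hv; apply/forall_inP => w /setUP hw.
case: hv hw => hv [] hw; rewrite /=; [exact: h1| |  |exact: h2].
  by case/andP: (h3 v w hv hw).
by rewrite gadj_sym; case/andP: (h3 w v hw hv).
Qed.

Lemma fan_ind m (f : 'I_m -> gtag R k) y :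
  (forall i j, i != j -> tag_adj (f i) (f j) true (tag_conf (f i) (f j) y y) = false) ->
  forall v w, v \in fan f y -> w \in fan f y -> ~~ gadj v w.
Proof.
move=> h v w /fanP[i ->] /fanP[j ->]; rewrite /gadj /= eqxx.
by case: (eqVneq i j) => [->|/h ->]; rewrite ?eqxx ?andbF.
Qed.

Lemma fan_GL_ind v w : v \in fan (@GL R k) y0 -> w \in fan (@GL R k) y0 -> ~~ gadj v w.
Proof. by apply: fan_ind => i j /negbTE. Qed.

Lemma fan_GR_ind v w : v \in fan (@GR R k) y0 -> w \in fan (@GR R k) y0 -> ~~ gadj v w.
Proof. by apply: fan_ind => i j /negbTE. Qed.

Lemma fan_GB_ind r y v w : v \in fan (@GB R k r) y -> w \in fan (@GB R k r) y -> ~~ gadj v w.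
Proof. by apply: fan_ind => i j _ /=; rewrite eqxx. Qed.

Lemma clause_not_full (t : td_tree D) r y : fan (@GL R k) y0 \subset bag t ->
  exists j, ((GB r j, y) : gadget) \notin bag t.
Proof.
move=> hL; apply: contrapT => no.
have hB : fan (@GB R k r) y \subset bag t.
  by apply: fan_sub => j; apply/negPn/negP => h; apply: no; exists j.
have hX (v w : gadget) : v \in fan (@GL R k) y0 -> w \in fan (@GB R k r) y ->
    (v != w) && ~~ gadj v w.
  by move=> /fanP[i ->] /fanP[j ->]; rewrite /gadj.
have := independent_union fan_GL_ind (@fan_GB_ind r y) hX hL hB.
have -> : #|fan (@GL R k) y0| = k - 2 by apply: card_fan => ? ? [].
have -> : #|fan (@GB R k r) y| = 3 by apply: card_fan => ? ? [].
by clear -k4; lia.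
Qed.

Lemma no_conflict (t : td_tree D) r j y r' j' y' : fan (@GR R k) y0 \subset bag t ->
  ((GA r j, y) : gadget) \in bag t -> ((GA r' j', y') : gadget) \in bag t ->
  ~~ tag_conf (GA r j) (GA r' j') y y'.
Proof.
move=> hR ha ha'; apply/negP => hc.
pose a : gadget := (GA r j, y); pose a' : gadget := (GA r' j', y').
have ne : a != a'.
  by apply/eqP => -[er ej ey]; case/and4P: hc; rewrite er ej ey eqxx.
have na : ~~ gadj a a' by rewrite /gadj /= -/(tag_conf (GA r j) (GA r' j') y y') hc andbF.
have hS : [set a; a'] \subset bag t.
  by apply/subsetP => v; rewrite !inE => /orP[] /eqP ->.
have hi (v w : gadget) : v \in [set a; a'] -> w \in [set a; a'] -> ~~ gadj v w.
  by rewrite !inE => /orP[] /eqP -> /orP[] /eqP ->;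
    rewrite ?gadj_irr // gadj_sym.
have hX (v w : gadget) : v \in [set a; a'] -> w \in fan (@GR R k) y0 ->
    (v != w) && ~~ gadj v w.
  by rewrite !inE => /orP[] /eqP -> /fanP[i ->].
have := independent_union hi fan_GR_ind hX hS hR.
have -> : #|fan (@GR R k) y0| = k - 1 by apply: card_fan => ? ? [].
by rewrite cards2 ne; clear -k4; lia.
Qed.

Lemma fan_big (t : td_tree D) (f : 'I_k.+1 -> gtag R k) : injective f ->
  (forall i j y y', i != j -> tag_adj (f i) (f j) true (tag_conf (f i) (f j) y y') = false) ->
  ~~ (fan f y0 \subset bag t).
Proof.
move=> fi hf; apply/negP => h; have : #|fan f y0| <= k.
  apply: (hD (t := t)) => //; apply/forall_inP => v hv; apply/forall_inP => w hw.
  by apply: (fan_ind _ hv hw) => i j; apply: hf.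
by rewrite card_fan // ltnn.
Qed.

Definition Lside : {set gadget} :=
  [set v : vert | match v.1 with GA _ _ | GL _ => true | _ => false end].
Definition Rside : {set gadget} :=
  [set v : vert | match v.1 with GB _ _ | GR _ => true | _ => false end].

Lemma Lside_bag : exists t : td_tree D, Lside \subset bag t.
Proof.
case: (@biclique gadget D (fan (@GU R k) y0) Lside) => [u v /fanP[i ->]| |[t]] //.
  by rewrite inE; case: v => [[]].
have inj : injective (@GU R k) by move=> ? ? [].
have ind (i j : 'I_k.+1) (y y' : Y) : i != j ->
  tag_adj (@GU R k i) (@GU R k j) true (tag_conf (@GU R k i) (@GU R k j) y y') = false by move/negbTE.
by rewrite (negPf (fan_big t inj ind)).
Qed.

Lemma Rside_bag : exists t : td_tree D, Rside \subset bag t.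
Proof.
case: (@biclique gadget D (fan (@GV R k) y0) Rside) => [u v /fanP[i ->]| |[t]] //.
  by rewrite inE; case: v => [[]].
have inj : injective (@GV R k) by move=> ? ? [].
have ind (i j : 'I_k.+1) (y y' : Y) : i != j ->
  tag_adj (@GV R k i) (@GV R k j) true (tag_conf (@GV R k i) (@GV R k j) y y') = false by move/negbTE.
by rewrite (negPf (fan_big t inj ind)).
Qed.

Lemma gadget_lower : exists A, satisfies A.
Proof.
have tT := td_treeP D.
have [t1 /subsetP h1] := Lside_bag; have [t2 /subsetP h2] := Rside_bag.
have hB2 r j y : ((GB r j, y) : gadget) \in bag t2 by apply: h2; rewrite inE.
have [||s [t [st s1 s2 Ls Lt]]] :=
  crossing_edge tT (P := fun t : td_tree D => fan (@GL R k) y0 \subset bag t) (x := t1) (y := t2).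
- by apply: fan_sub => i; apply: h1; rewrite inE.
(* The bag of [t2] contains all b_x of the clause (r0, y0) and therefore not all of L. *)
- by apply/negP => h; have [j] := clause_not_full r0 y0 h; rewrite hB2.
have s2' : t2 \notin side s t by rewrite sideC // in_setC in s2.
have push (v : gadget) z : v \in bag t1 -> v \in bag z -> z \notin side s t -> v \in bag t.
  move=> v1 vz hz; have [] := conn_cross (C := nodes D v) (@bag_connected _ D v) _ _ s1 hz;
  by rewrite ?inE.
have pull (v : gadget) z : v \in bag t2 -> v \in bag z -> z \in side s t ->
    v \in bag s /\ v \in bag t.
  move=> v2 vz hz; have [] := conn_cross (C := nodes D v) (@bag_connected _ D v) _ _ hz s2';
  by rewrite ?inE.
(* Some vertex of L in the bag of [t1] misses the bag of t, so all its bags lie on the side of s. A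
   vertex of R shares one of them and also lies in the bag of [t2], hence in that of t. *)
have hR : fan (@GR R k) y0 \subset bag t.
  have [i hi] : exists i, ((GL i, y0) : gadget) \notin bag t.
    by case/subsetPn: Lt => v /fanP[i ->]; exists i.
  apply: fan_sub => j.
  have [z /andP[z1 z2]] := @bag_edge _ D ((GL i, y0) : gadget) ((GR j, y0) : gadget) isT.
  have zs : z \in side s t.
    by apply/negPn/negP => hz; rewrite (push _ _ _ z1 hz) // in hi; apply: h1; rewrite inE.
  by have [] := pull _ _ _ z2 zs; first by apply: h2; rewrite inE.
have hab r j y : ((GA r j, y) : gadget) \in bag t \/ ((GB r j, y) : gadget) \in bag s.
  have ab : @adj gadget ((GA r j, y) : gadget) (GB r j, y) by rewrite /= /gadj /= !eqxx.
  have [z /andP[z1 z2]] := bag_edge D ab.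
  case: (boolP (z \in side s t)) => hz.
    by right; have [] := pull _ _ (hB2 _ _ _) z2 hz.
  by left; apply: push z1 hz; apply: h1; rewrite inE.
(* A variable is true iff a positive occurrence of it has its a_x in the bag of t; [no_conflict]
   then makes every negative occurrence with a_x in that bag true. *)
pose A v := [exists r, exists j, exists y,
  [&& guard r y, ((GA r j, y) : gadget) \in bag t & lit r j y == (true, v)]].
exists A => r y g; have [j hj] := clause_not_full r y Ls; exists j.
have aj : ((GA r j, y) : gadget) \in bag t.
  by case: (hab r j y) => // h; rewrite h in hj.
case el: (lit r j y) => [[] v] /=.
  rewrite eqb_id; apply/existsP; exists r; apply/existsP; exists j; apply/existsP; exists y.
  by rewrite g aj el eqxx.
rewrite eqbF_neg; apply/negP => /existsP[r' /existsP[j' /existsP[y' /and3P[g' a' /eqP e']]]].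
by have := no_conflict hR aj a'; rewrite /tag_conf g g' el e' /= eqxx.
Qed.

End Lower.

Theorem gadget_tree_alpha (r0 : R) (y0 : Y) :
  tree_alpha gadget <= k <-> exists A, satisfies A.
Proof.
split=> [/tree_alphaP[D /td_alpha_leP hD]|[A /gadget_upper //]].
exact: gadget_lower r0 y0 D hD.
Qed.

End Gadget.

(** * Tableaux of computations *)

Lemma poly_mono (p : {poly nat}) m n : m <= n -> p.[m]%R <= p.[n]%R.
Proof.
move=> mn; elim/poly_ind: p => [|p c IH]; first by rewrite !horner0.
rewrite !hornerD !hornerM !hornerX !hornerC.
exact: (leq_add (leq_mul IH mn) (leqnn c)).
Qed.

(* [m] is the move carried out by the machine: the content of position [msrc m p]
   relative to the old head becomes that of [mdst m p] relative to the new one. *)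
Definition msrc (m : move) : bool := if m is MRight then true else false.
Definition mdst (m : move) : bool := if m is MLeft then true else false.

(** Positions are relative to the head, which is always at o; a move of the head shifts the contents
    instead. *)
Definition tcell (W : finType) (o : nat) (t : tape W) (P : nat) : cell W :=
  if o <= P then nth None t.2 (P - o) else nth None t.1 (o - P.+1).

Lemma tcell_move (W : finType) o (t : tape W) a m p : 0 < o ->
  tcell o (tape_move m (tape_write a t)) (p + mdst m) =
  if p + msrc m == o then a else tcell o t (p + msrc m).
Proof.
move=> o0; rewrite /tcell; case: m; rewrite /= ?addn0 ?addn1.
- case: (ltngtP p o) => h.
  + case: (ltngtP p.+1 o) => h'; [|by lia|].
      by rewrite nth_behead; congr (nth _ _ _); lia.
    by rewrite -h' !subnn /= nth0.
  + rewrite ifT; last by lia.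
    have -> : p.+1 - o = (p - o.+1).+2 by lia.
    by rewrite /= nth_behead; congr (nth _ _ _); lia.
  + by rewrite h leqnSn subSnn.
- case: (ltngtP p o) => h //=; last by rewrite h subnn.
  have -> : p - o = (p - o.+1).+1 by lia.
  by rewrite /= nth_behead.
case: (ltngtP p.+1 o) => h /=.
- rewrite ifN; last by lia.
  by have -> : o - p.+1 = (o - p.+2).+1 by lia.
- rewrite ifT; last by lia.
  by rewrite nth_behead; have -> : p.+1 - o = (p - o).+1 by lia.
- by rewrite -h ltnn subnn.
Qed.

Section Tableau.
Variables (M : TM) (pV qV : {poly nat}).

Notation Q := (tm_state M).
Notation I := 'I_(tm_ntapes M).+1.
Notation Gam := (cell (tm_work M)).
Notation F := {ffun I -> Gam}.

Definition trans (q : Q) (s : F) : Q * {ffun I -> Gam * move} :=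
  if tm_halt q then (q, [ffun i => (s i, MStay)]) else tm_delta q s.

Definition reads (c : config M) : F := [ffun i => tape_read (c.2 i)].

Lemma step_trans o (c : config M) : 0 < o ->
  (step c).1 = (trans c.1 (reads c)).1 /\
  forall i p, let am := (trans c.1 (reads c)).2 i in
    tcell o ((step c).2 i) (p + mdst am.2) =
    if p + msrc am.2 == o then am.1 else tcell o (c.2 i) (p + msrc am.2).
Proof.
move=> o0; rewrite /step /trans; case: ifP => hh.
  split=> // i p; rewrite !ffunE /= addn0; case: eqP => // ->.
  by rewrite /tcell leqnn subnn nth0.
rewrite /reads; case: (tm_delta _ _) => q' act /=.
by split=> // i p; rewrite ffunE tcell_move.
Qed.

(** A transition depends on all tapes at once. Each possible s is offered in advance and confirmed
    tape by tape, which keeps clauses at three literals for any number of tapes. *)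
Definition kind : finType := ('I_(tm_ntapes M).+3 * Q * F + I * Gam)%type.

(* [KD j q s]: the state is q and the first j heads read s; [KC i a]: the cell
   carries a on tape i. *)
Definition KD j (q : Q) (s : F) : kind := inl (inord j, q, s).
Definition KC (i : I) (a : Gam) : kind := inr (i, a).

Definition rule : finType := ('I_11 * Q * F * F * I * Gam)%type.

(* Sign, kind, time offset, and position: [None] is the position of the head,
   [Some b] is p + b. *)
Definition literal : Type := bool * (kind * bool * option bool).

Definition bitc (b : bool) : Gam := Some (inl b).
Notation ntap := (tm_ntapes M).

(* Tags: 0 initial state, 1 collect the symbols read, 2 next state, 3 untouched
   cells, 4 the written cell, 5 initial blanks, 6 and 7 the initial bits before the
   certificate, 8 every certificate cell carries a bit or a blank, 9 blanks
   propagate to the right, 10 the output is not 0. *)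
Definition lits (r : rule) : seq literal :=
  let: (tag, q, s, s', i, a) := r in
  match val tag with
  | 0 => [:: (true, (KD 0 (tm_start M) s, false, None))]
  | 1 => [:: (false, (KD i q s, false, None)); (false, (KC i (s i), false, None));
             (true, (KD i.+1 q s, false, None))]
  | 2 => [:: (false, (KD ntap.+1 q s, false, None));
             (true, (KD 0 (trans q s).1 s', true, None))]
  | 3 => [:: (false, (KD ntap.+1 q s, false, None));
             (false, (KC i a, false, Some (msrc ((trans q s).2 i).2)));
             (true, (KC i a, true, Some (mdst ((trans q s).2 i).2)))]
  | 4 => [:: (false, (KD ntap.+1 q s, false, None));
             (true, (KC i ((trans q s).2 i).1, true, Some (mdst ((trans q s).2 i).2)))]
  | 5 => [:: (true, (KC i None, false, Some false))]
  | 6 => [:: (true, (KC ord0 (bitc false), false, Some false))]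
  | 7 => [:: (true, (KC ord0 (bitc true), false, Some false))]
  | 8 => [:: (true, (KC ord0 (bitc false), false, Some false));
             (true, (KC ord0 (bitc true), false, Some false));
             (true, (KC ord0 None, false, Some false))]
  | 9 => [:: (false, (KC ord0 None, false, Some false));
             (true, (KC ord0 None, false, Some true))]
  | _ => [:: (false, (KC ord0 (bitc false), false, None))]
  end.

Definition ylen n := qV.[n]%R.
(** The argument of [pV] is the largest length of a pair code, so every relevant run has halted by
    then. *)
Definition tlen n := pV.[2 * n + 2 + ylen n]%R.
(* Far enough from 0 for the head never to leave the tableau. *)
Definition ctr n := (tlen n).+1.
(** The part of the tableau known to be correct loses a column at each end per step; this width
    keeps column [ctr n] in it up to time [tlen n]. *)
Definition npos n := ctr n + (2 * n + 2 + ylen n) + tlen n + 2.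

(** The last disjunct is the separator 01, where bit b stands at offset b. *)
Definition bitpos (x : seq bool) p (b : bool) : bool :=
  exb (size x) (fun i => ((p == ctr (size x) + 2 * i) || (p == ctr (size x) + (2 * i).+1)) &&
     (nth false x i == b)) || (p == ctr (size x) + 2 * size x + b).

Definition guard (x : seq bool) (r : rule) (t p : nat) : bool :=
  let: (tag, q, s, s', i, a) := r in
  let n := size x in
  match val tag with
  | 0 => t == 0
  | 1 | 2 => true
  | 3 => p + msrc ((trans q s).2 i).2 != ctr n
  | 4 => p + msrc ((trans q s).2 i).2 == ctr n
  | 5 => (t == 0) && [|| i != ord0, p < ctr n | ctr n + (2 * n + 2 + ylen n) <= p]
  | 6 => (t == 0) && bitpos x p false
  | 7 => (t == 0) && bitpos x p true
  | 8 => (t == 0) && ((ctr n + (2 * n + 2) <= p) && (p < ctr n + (2 * n + 2 + ylen n)))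
  | 9 => (t == 0) && (ctr n + (2 * n + 2) <= p)
  | _ => t == tlen n
  end.

Definition var : Type := kind * nat * nat.

Definition place n (t p : nat) (l : literal) : bool * var :=
  (l.1, (l.2.1.1, t + l.2.1.2, if l.2.2 is Some b then p + b else ctr n)).

(** Clauses with fewer than three literals are filled up with copies of the first one. *)
Definition lit_at n (r : rule) (j : 'I_3) (t p : nat) : bool * var :=
  let l := lits r in place n t p (nth (head (true, (KC ord0 None, false, None)) l) l j).

Definition holds (A : var -> bool) n t p (l : literal) : bool :=
  A (place n t p l).2 == (place n t p l).1.

Lemma holds_lit A n r t p :
  (exists j, A (lit_at n r j t p).2 == (lit_at n r j t p).1) <->
  has (holds A n t p) (lits r).
Proof.
have [s0 s3] : 0 < size (lits r) /\ size (lits r) <= 3.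
  case: r => [[[[[[tag h] q] s] s'] i] a] /=.
  by do 10?[case: tag h => [|tag] h //].
rewrite /lit_at /=; set l := lits r in s0 s3 *; set d := head _ _; split.
  case=> j hj; apply/hasP; exists (nth d l j) => //.
  have [h|h] := ltnP j (size l); first exact: mem_nth.
  by rewrite nth_default // /d; case: (l) s0 => // a l' _; rewrite mem_head.
case/(has_nthP d) => j jl hj.
by exists (Ordinal (leq_trans jl s3)).
Qed.

Definition tabsat x (A : var -> bool) := forall (r : rule) t p,
  t < (tlen (size x)).+1 -> p < npos (size x) -> guard x r t p ->
  has (holds A (size x) t p) (lits r).

Variable V : pred (seq bool).
Hypothesis hV : forall w, computes_within M pV.[size w]%R w [:: V w].

Lemma run_output x y : size y <= ylen (size x) ->
  output (iter (tlen (size x)) (@step M) (init M (pair_code x y))) = [:: V (pair_code x y)].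
Proof.
move=> hy; have [h1 h2] := hV (pair_code x y).
have hle : pV.[size (pair_code x y)]%R <= tlen (size x).
  apply: poly_mono; rewrite size_cat size_double /=.
  by lia.
rewrite -(subnK hle) iterD; set c := iter pV.[_]%R _ _ in h1 h2 *.
have -> : iter (tlen (size x) - pV.[size (pair_code x y)]%R) (@step M) c = c.
  by elim: (_ - _) => //= m ->; rewrite /step h1.
exact: h2.
Qed.

Lemma ctr_gt0 n : 0 < ctr n. Proof. by []. Qed.

Lemma tcell_ctr (W : finType) o (t : tape W) : tcell o t o = tape_read t.
Proof. by rewrite /tcell leqnn subnn nth0. Qed.

Lemma out_cell (c : config M) (b : bool) o :
  output c = [:: b] -> tcell o (c.2 ord0) o = bitc b.
Proof.
by rewrite /output tcell_ctr /tape_read; case: (c.2 ord0).2 => [|[[b'|a]|] s] //= [->].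
Qed.

Lemma init_cell x y i p :
  tcell (ctr (size x)) ((init M (pair_code x y)).2 i) p =
  if (i == ord0) && (ctr (size x) <= p)
  then nth None [seq bitc b | b <- pair_code x y] (p - ctr (size x)) else None.
Proof.
rewrite /tcell /= ffunE /=; case: (i == ord0) => /=; last by rewrite !nth_nil if_same.
by case: ifP => // _; rewrite nth_nil.
Qed.

Lemma nth_bitc (s : seq bool) j : j < size s ->
  nth None [seq bitc b | b <- s] j = bitc (nth false s j).
Proof. exact: nth_map. Qed.

Lemma size_pair x y : size (pair_code x y) = 2 * size x + 2 + size y.
Proof. by rewrite size_cat size_double /=; lia. Qed.

Lemma bitpos_cell x y p b : bitpos x p b ->
  ctr (size x) <= p /\
  nth None [seq bitc b | b <- pair_code x y] (p - ctr (size x)) = bitc b.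
Proof.
case/orP=> [/exbP[i ix /andP[hp /eqP <-]]|/eqP ->].
  have [e1 e2] := nth_double [:: false, true & y] ix.
  by case/orP: hp => /eqP ->; rewrite leq_addr addKn nth_bitc ?size_pair;
    [|lia| |lia]; rewrite ?e1 ?e2.
have [e1 e2] := nth_pair_sep x y.
rewrite -addnA leq_addr addKn nth_bitc ?size_pair; last by case: b; lia.
by case: b; rewrite ?addn0 ?addn1 ?e1 ?e2.
Qed.

Section Complete.
Variables (x y : seq bool).
Hypothesis hy : size y <= ylen (size x).

Let n := size x.
Let cf t := iter t (@step M) (init M (pair_code x y)).

Definition tabA (v : var) : bool :=
  let: (kd, t, p) := v in
  match kd with
  | inl (j, q, s) => ((cf t).1 == q) && [forall i : I, (i < j) ==> (reads (cf t) i == s i)]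
  | inr (i, a) => tcell (ctr n) ((cf t).2 i) p == a
  end.
Arguments tabA : simpl never.

Lemma tabA_D j q s t p : j < ntap.+3 -> tabA (KD j q s, t, p) =
  ((cf t).1 == q) && [forall i : I, (i < j) ==> (reads (cf t) i == s i)].
Proof. by move=> hj; rewrite /tabA /KD inordK. Qed.

Lemma tabA_full q s t p : tabA (KD ntap.+1 q s, t, p) -> (cf t).1 = q /\ reads (cf t) = s.
Proof.
rewrite tabA_D // => /andP[/eqP -> /forallP h]; split=> //; apply/ffunP => i.
by have := h i; rewrite ltn_ord => /eqP.
Qed.

Lemma tabA_C i a t p : tabA (KC i a, t, p) = (tcell (ctr n) ((cf t).2 i) p == a).
Proof. by []. Qed.

Lemma tableau_complete : V (pair_code x y) -> tabsat x tabA.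
Proof.
move=> hVy; have hy' : size y <= ylen n by [].
have sw : size (pair_code x y) = 2 * n + 2 + size y by exact: size_pair.
have cell0 i p : tcell (ctr n) ((cf 0).2 i) p =
    if (i == ord0) && (ctr n <= p)
    then nth None [seq bitc b | b <- pair_code x y] (p - ctr n) else None.
  exact: init_cell.
move=> [[[[[[tag htag] q] s] s'] i] a] t p tT pP; rewrite -/n in tT pP *.
rewrite /guard /holds /place -/n.
case: tag htag => [|[|[|[|[|[|[|[|[|[|tag]]]]]]]]]] htag /=; rewrite ?orbF ?addn0.
- by move=> /eqP ->; rewrite tabA_D // eqxx /=; apply/eqP/forallP.
- move=> _; have hi := ltn_ord i; rewrite tabA_C !tabA_D; try lia.
  rewrite tcell_ctr !eqbF_neg eqb_id; case: eqP => //= _.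
  case: (boolP [forall i0, _]) => //= /forallP h; case: eqP => //= hr.
  apply/forallP => i0; apply/implyP; rewrite ltnS leq_eqVlt => /orP[/eqP e|lt].
    by rewrite (val_inj e) /reads ffunE hr.
  by have := h i0; rewrite lt.
- move=> _; case: (boolP (tabA _)) => //= /tabA_full[h1 h2].
  rewrite tabA_D // eqb_id addn1 [cf _]iterS.
  have [e _] := step_trans (cf t) (ctr_gt0 n); rewrite e h1 h2 eqxx.
  by apply/forallP.
- move=> hne; case: (boolP (tabA _)) => //= /tabA_full[h1 h2].
  rewrite !tabA_C addn1 [cf t.+1]iterS.
  have [_ e] := step_trans (cf t) (ctr_gt0 n); rewrite h1 h2 in e.
  by rewrite e (negPf hne) /=; case: (_ == a).
- move=> heq; case: (boolP (tabA _)) => //= /tabA_full[h1 h2].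
  rewrite !tabA_C addn1 [cf t.+1]iterS.
  have [_ e] := step_trans (cf t) (ctr_gt0 n); rewrite h1 h2 in e.
  by rewrite e heq eqxx.
- case/andP=> /eqP -> h; rewrite tabA_C cell0; case: (eqVneq i ord0) h => //= _ h.
  case: ifP => // hp; rewrite nth_default ?eqxx // size_map sw; move: h; lia.
- case/andP=> /eqP -> /(bitpos_cell y)[h1 h2]; rewrite tabA_C cell0 /= h1 h2.
  by rewrite eqxx.
- case/andP=> /eqP -> /(bitpos_cell y)[h1 h2]; rewrite tabA_C cell0 /= h1 h2.
  by rewrite eqxx.
- case/and3P=> /eqP -> h1 h2; rewrite !tabA_C cell0 /= ifT; last by lia.
  case: (ltnP (p - ctr n) (size (pair_code x y))) => h.
    by rewrite nth_bitc //; case: (nth _ _ _).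
  by rewrite nth_default ?size_map.
- case/andP=> /eqP -> h1; rewrite !tabA_C !cell0 /= !ifT; try lia.
  case: (ltnP (p - ctr n) (size (pair_code x y))) => h.
    by rewrite nth_bitc.
  by rewrite orbC nth_default // size_map; lia.
move=> /eqP ->; have := run_output hy; rewrite hVy => /(@out_cell _ _ (ctr n)).
by rewrite tabA_C => ->.
Qed.

End Complete.

Section Sound.
Variables (x : seq bool) (A : var -> bool).
Hypothesis hA : tabsat x A.
Let n := size x.
Let q0 := tm_start M.
Let s0 : F := [ffun=> None].

Lemma fire tag q s s' i a t p (lt : tag < 11) : t < (tlen n).+1 -> p < npos n ->
  guard x (Ordinal lt, q, s, s', i, a) t p ->
  has (holds A n t p) (lits (Ordinal lt, q, s, s', i, a)).
Proof. exact: hA. Qed.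

Let blk j := A (KC ord0 None, 0, ctr n + (2 * n + 2) + j).
Let len := find blk (iota 0 (ylen n)).

(** Under [A] a cell may carry several symbols. A blank takes precedence and ends the certificate,
    and 1 takes precedence over 0. *)
Definition guess := mkseq (fun j => A (KC ord0 (bitc true), 0, ctr n + (2 * n + 2) + j)) len.

Lemma size_guess : size guess <= ylen n.
Proof. by rewrite size_mkseq; have := find_size blk (iota 0 (ylen n)); rewrite size_iota. Qed.

Lemma guess_cell j : j < size guess ->
  A (KC ord0 (bitc (nth false guess j)), 0, ctr n + (2 * n + 2) + j).
Proof.
have := size_guess; rewrite size_mkseq => hl jl.
have nb : ~~ blk j.
  have := @before_find _ 0 blk (iota 0 (ylen n)) j jl.
  by rewrite nth_iota ?add0n => [->|]//; apply: leq_trans hl.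
rewrite nth_mkseq //; case: (boolP (A (KC ord0 (bitc true), _, _))) => // h1.
have h := @fire 8 q0 s0 s0 ord0 None 0 (ctr n + (2 * n + 2) + j) isT isT.
move: h; rewrite /guard /= -/n /holds /place /= !addn0 !eqb_id (negPf h1) -/(blk j) (negPf nb) !orbF.
by apply; rewrite /npos; lia.
Qed.

Lemma blank_cell i p : p < npos n ->
  [|| i != ord0, p < ctr n | ctr n + (2 * n + 2 + ylen n) <= p] ->
  A (KC i None, 0, p).
Proof.
move=> hp hi; have := @fire 5 q0 s0 s0 i None 0 p isT isT hp.
by rewrite /guard /= -/n hi /holds /place /= !addn0 orbF eqb_id; apply.
Qed.

(** Beyond the [ylen n] reserved cells this is rule 5; among them the first blank spreads by rule
    9. *)
Lemma guess_blank j : size guess <= j -> ctr n + (2 * n + 2) + j < npos n -> blk j.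
Proof.
rewrite size_mkseq; have [hj _ jn|jl] := leqP (ylen n) j.
  by apply: blank_cell => //=; lia.
elim: j jl => [|j IH] jl lj jn; last case: (ltngtP len j.+1) lj => // lj _.
- have e0 : len = 0 by lia.
  have := nth_find 0 (a := blk) (s := iota 0 (ylen n)); rewrite -/len e0.
  by rewrite nth_iota // add0n; apply; rewrite has_find -/len e0 size_iota.
- have bj : blk j by apply: IH; lia.
  have := @fire 9 q0 s0 s0 ord0 None 0 (ctr n + (2 * n + 2) + j) isT isT.
  rewrite /guard /= -/n /holds /place /= !addn0 addn1 -/(blk j) bj /= orbF eqb_id /blk (addnS _ j).
  by apply; lia.
have := nth_find 0 (a := blk) (s := iota 0 (ylen n)); rewrite -/len lj.
by rewrite nth_iota // add0n; apply; rewrite has_find -/len lj size_iota.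
Qed.

Lemma bit_cell p b : p < npos n -> bitpos x p b -> A (KC ord0 (bitc b), 0, p).
Proof.
move=> hp hb; case: b hb => hb.
  have := @fire 7 q0 s0 s0 ord0 None 0 p isT isT hp.
  by rewrite /guard /= hb /holds /place /= !addn0 orbF eqb_id; apply.
have := @fire 6 q0 s0 s0 ord0 None 0 p isT isT hp.
by rewrite /guard /= hb /holds /place /= !addn0 orbF eqb_id; apply.
Qed.

Lemma bitposE p b : ctr n <= p -> p < ctr n + (2 * n + 2) ->
  nth false (pair_code x guess) (p - ctr n) = b -> bitpos x p b.
Proof.
move=> hp hp2 <-; rewrite /bitpos -/n.
have [j ej] : exists j, p = ctr n + j by exists (p - ctr n); lia.
rewrite ej addKn in hp hp2 *.
have [s1 s2] := nth_pair_sep x guess; rewrite -/n in s1 s2.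
case: (ltnP j (2 * n)) => hj; last first.
  have [->|->] : j = 2 * n \/ j = (2 * n).+1 by lia.
    by rewrite s1 addn0 eqxx orbT.
  by rewrite s2 addn1 addnS eqxx orbT.
apply/orP; left; apply/exbP; exists j./2; first by lia.
have hj2 : j./2 < size x by rewrite -/n; lia.
have [e1 e2] := nth_double [:: false, true & guess] hj2.
have [ee|ee] : j = 2 * j./2 \/ j = (2 * j./2).+1 by lia.
  have -> : nth false (pair_code x guess) j = nth false x j./2 by rewrite {1}ee -e1.
  by rewrite eqxx andbT -ee eqxx.
have -> : nth false (pair_code x guess) j = nth false x j./2 by rewrite {1}ee -e2.
by rewrite eqxx andbT -ee eqxx orbT.
Qed.

Let cf t := iter t (@step M) (init M (pair_code x guess)).

Lemma start_cell i p : p < npos n -> A (KC i (tcell (ctr n) ((cf 0).2 i) p), 0, p).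
Proof.
move=> hp; rewrite (init_cell x guess i p) -/n.
case: ifP => [/andP[/eqP -> h1]|]; last first.
  by move=> h; apply: blank_cell => //; move: h; case: (i == ord0) => //=; lia.
case: (ltnP (p - ctr n) (size (pair_code x guess))) => h.
  rewrite nth_bitc //; case: (ltnP p (ctr n + (2 * n + 2))) => h2.
    by apply: bit_cell => //; apply: bitposE.
  have [j ej] : exists j, p = ctr n + (2 * n + 2) + j by exists (p - (ctr n + (2 * n + 2))); lia.
  rewrite size_pair -/n in h; rewrite ej -addnA addKn nth_pair_y addnA.
  by apply: guess_cell; lia.
rewrite nth_default ?size_map //; rewrite size_pair -/n in h.
have [j ej] : exists j, p = ctr n + (2 * n + 2) + j by exists (p - (ctr n + (2 * n + 2))); lia.
by rewrite ej; apply: guess_blank; lia.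
Qed.

(** Forward chaining along the Horn clauses: whatever else [A] makes true, it contains the facts of
    the run. A step uses a column at distance at most one, which costs one column at each end. *)
Lemma trace t : t <= tlen n -> (forall s, A (KD 0 (cf t).1 s, t, ctr n)) /\
  forall i p, t <= p -> p + t < npos n -> A (KC i (tcell (ctr n) ((cf t).2 i) p), t, p).
Proof.
elim: t => [_|t IH ht].
  split=> [s|i p _ hp]; last by apply: start_cell; lia.
  have := @fire 0 q0 s s0 ord0 None 0 0 isT isT isT.
  by rewrite /guard /= /holds /place /= !addn0 orbF eqb_id; apply.
have [hD hC] := IH (ltnW ht); set s := reads (cf t); set q := (cf t).1.
have tl : t < (tlen n).+1 by lia.
have n0 : 0 < npos n by rewrite /npos; lia.
have full : forall j, j <= ntap.+1 -> A (KD j q s, t, ctr n).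
  elim=> [|j IHj] hj; first exact: hD.
  have := @fire 1 q s s0 (Ordinal hj) None t 0 isT tl n0 isT.
  rewrite /= /holds /place /= addn0 -/n IHj /=; last by lia.
  have hc : A (KC (Ordinal hj) (s (Ordinal hj)), t, ctr n).
    by rewrite /s ffunE -(tcell_ctr (ctr n)); apply: hC; rewrite /npos /ctr; lia.
  by rewrite hc orbF eqb_id.
have {}full := full _ (leqnn _).
have [e1 e2] := step_trans (cf t) (ctr_gt0 n); rewrite -/s -/q in e1 e2.
have ecf : cf t.+1 = step (cf t) by [].
rewrite {}ecf; split=> [s'|i p tp pt].
  rewrite e1; have := @fire 2 q s s' ord0 None t 0 isT tl n0 isT.
  by rewrite /= /holds /place /= addn0 addn1 -/n full /= orbF eqb_id.
set am := (trans q s).2 i.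
have [p' ep] : exists p', p = p' + mdst am.2 by exists (p - mdst am.2); case: (am.2) => /=; lia.
rewrite ep e2 -/am.
have hm := leq_b1 (msrc am.2); have hm' := leq_b1 (mdst am.2).
have hmm : mdst am.2 + msrc am.2 <= 1 by case: (am.2).
case: eqP => he.
  have := @fire 4 q s s0 i None t p' isT tl.
  rewrite /guard /= -/n -/am he eqxx /holds /place /= addn0 addn1 -/n full /= orbF eqb_id.
  by apply; lia.
have := @fire 3 q s s0 i (tcell (ctr n) ((cf t).2 i) (p' + msrc am.2)) t p' isT tl.
rewrite /guard /= -/n -/am (introF eqP he) /holds /place /= addn0 addn1 -/n full /=.
rewrite hC; [|by lia|by lia].
by rewrite orbF eqb_id; apply=> //; lia.
Qed.

Lemma tableau_sound : size guess <= ylen n /\ V (pair_code x guess).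
Proof.
split; first exact: size_guess.
apply/negPn/negP => nV; have [_ hC] := trace (leqnn (tlen n)).
have := run_output size_guess; rewrite (negPf nV) => /(@out_cell _ _ (ctr n)) ho.
have := hC ord0 (ctr n); rewrite /cf ho => h.
have := @fire 10 q0 s0 s0 ord0 None (tlen n) 0 isT (ltnSn _) isT (eqxx _).
by rewrite /= /holds /place /= addn0 -/n h // /npos /ctr; lia.
Qed.

End Sound.

Theorem tableauP x : (exists A, tabsat x A) <->
  exists y, size y <= qV.[size x]%R /\ V (pair_code x y).
Proof.
split=> [[A /tableau_sound h]|[y [hy hVy]]]; first by eexists; exact: h.
by exists (tabA x y); apply: tableau_complete.
Qed.

End Tableau.

(** * The reduction *)

Lemma tree_alpha_iso (G H : sgraph) (f : G -> H) k : bijective f ->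
  (forall u v, adj (f u) (f v) = adj u v) -> tree_alpha H <= k -> tree_alpha G <= k.
Proof.
move=> [g gK fK] hf /tree_alphaP[D /td_alpha_leP hD].
pose bg (t : td_tree D) : {set G} := [set u | f u \in bag t].
have bv u : exists t, u \in bg t by have [t h] := bag_vertex D (f u); exists t; rewrite inE.
have be u v : adj u v -> exists t, (u \in bg t) && (v \in bg t).
  by rewrite -hf => /(bag_edge D)[t h]; exists t; rewrite !inE.
have bc u : connected (induced [set t | u \in bg t]).
  have -> : [set t | u \in bg t] = [set t : td_tree D | f u \in bag t].
    by apply/setP => t; rewrite !inE.
  exact: bag_connected.
apply/tree_alphaP; exists (TreeDecomposition (td_treeP D) bv be bc).
apply/td_alpha_leP => t S iS SB; rewrite -(card_imset _ (can_inj gK)).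
apply: (hD t).
  apply/forall_inP => _ /imsetP[u uS ->]; apply/forall_inP => _ /imsetP[v vS ->].
  by rewrite hf; exact: (forall_inP (forall_inP iS _ uS) _ vS).
by apply/subsetP => _ /imsetP[u /(subsetP SB) uB ->]; move: uB; rewrite inE.
Qed.

Lemma graph_code_inj n n' (e : rel 'I_n) (e' : rel 'I_n') :
  graph_code e = graph_code e' ->
  exists h : n = n', forall i j, e i j = e' (cast_ord h i) (cast_ord h j).
Proof.
move=> ec; have [a1 a2 a3] := nth_code e; have [b1 b2 b3] := nth_code e'.
have h : n = n'.
  case: (ltngtP n n') => // h; first by rewrite ec b1 in a2.
  by rewrite -ec a1 in b2.
exists h; case: n' / h e' ec {b1 b2} b3 => e' ec b3 i j; rewrite !cast_ord_id.
by rewrite -nth_bits -a3 ec b3 nth_bits.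
Qed.

Lemma PP_tag_adj (R : finType) k (s s' : gtag R k) d same conf :
  PP d same -> PP d conf -> PP d (fun x e => tag_adj s s' (same x e) (conf x e)).
Proof.
move=> hs hc; case: s s' => [r j|r j|i|i|i|i] [r' j'|r' j'|i'|i'|i'|i'] /=;
  try exact: PP_const; first exact: PP_neg.
- by apply: PP_and; [exact: PP_const | apply: PP_and => //; exact: PP_const].
- by apply: PP_and; [exact: PP_const | apply: PP_and => //; exact: PP_const].
by apply: PP_neg; apply: PP_and => //; exact: PP_const.
Qed.

Section Reduction.
Variables (M : TM) (pV qV : {poly nat}) (k : nat).

Notation rule := (rule M).
Notation tag := (gtag rule k).

Definition ntime n := (tlen pV qV n).+1.
Definition npl n := npos pV qV n.
Definition nvert n := #|{: tag}| * ntime n * npl n.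

Definition litconf (x : seq bool) (s s' : tag) (t p t' p' : nat) : bool :=
  match s, s' with
  | GA r j, GA r' j' =>
      [&& guard pV qV x r t p, guard pV qV x r' t' p',
          (lit_at pV qV (size x) r j t p).1 != (lit_at pV qV (size x) r' j' t' p').1 &
          (lit_at pV qV (size x) r j t p).2 == (lit_at pV qV (size x) r' j' t' p').2]
  | _, _ => false
  end.

Definition vcode n (s : tag) (t p : nat) : nat :=
  (enum_rank s * ntime n + t) * npl n + p.

(** Vertex numbers are decoded by searching for their codes, so that sums and products are the only
    arithmetic needed. *)
Definition nadj (x : seq bool) (i j : nat) : bool :=
  let n := size x in
  has (fun s : tag => has (fun s' : tag =>
    exb (ntime n) (fun t => exb (npl n) (fun p =>
    exb (ntime n) (fun t' => exb (npl n) (fun p' =>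
      [&& i == vcode n s t p, j == vcode n s' t' p',
          ~~ [&& s == s', t == t' & p == p'] &
          tag_adj s s' ((t == t') && (p == p')) (litconf x s s' t p t' p')])))))
    (enum {: tag})) (enum {: tag}).

(** Neither disjunct applies to m = N, which yields the 0 that ends the unary prefix. *)
Definition outbit (x : seq bool) (m : nat) : bool :=
  let N := nvert (size x) in
  (m < N) || exb N (fun i => exb N (fun j => (m == N.+1 + (i * N + j)) && nadj x i j)).

Definition reduction (x : seq bool) : seq bool :=
  let N := nvert (size x) in mkseq (outbit x) (N.+1 + N * N).

Section Computable.
Variable d : nat.

Lemma TT_ylen : TT d (fun x _ => ylen qV (size x)).
Proof. exact: TT_poly (TT_size d). Qed.

Lemma TT_tlen : TT d (fun x _ => tlen pV qV (size x)).
Proof.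
have hy := TT_ylen; have hs := TT_size d.
by apply: (@TT_poly d pV (fun x e => 2 * size x + 2 + ylen qV (size x))); tt.
Qed.

Lemma TT_ctr : TT d (fun x _ => ctr pV qV (size x)).
Proof. exact: TT_S TT_tlen. Qed.

Lemma TT_npos : TT d (fun x _ => npos pV qV (size x)).
Proof.
have hy := TT_ylen; have hs := TT_size d; have ht := TT_tlen; have hc := TT_ctr.
by rewrite /npos; tt.
Qed.

Lemma TT_ntime : TT d (fun x _ => ntime (size x)).
Proof. exact: TT_S TT_tlen. Qed.

Lemma TT_nvert : TT d (fun x _ => nvert (size x)).
Proof.
have h1 := TT_npos; have h2 := TT_ntime.
by rewrite /nvert /npl; tt.
Qed.

End Computable.

Lemma PP_bitpos d p b : TT d p -> PP d (fun x e => bitpos pV qV x (p x e) b).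
Proof.
move=> hp; have hs := TT_size d; have hc := TT_ctr d; have hc1 := TT_ctr d.+1.
by rewrite /bitpos; pp.
Qed.

Lemma PP_guard d (r : rule) t p : TT d t -> TT d p ->
  PP d (fun x e => guard pV qV x r (t x e) (p x e)).
Proof.
move=> ht hp; have hs := TT_size d; have hc := TT_ctr d; have hy := TT_ylen d.
have hl := TT_tlen d; have hb := PP_bitpos.
case: r => [[[[[[tg h] q] s] s'] i] a]; rewrite /guard.
do 10?[case: tg h => [|tg] h /=; first by pp].
by pp.
Qed.

Lemma PP_litconf d (s s' : tag) t p t' p' :
  TT d t -> TT d p -> TT d t' -> TT d p' ->
  PP d (fun x e => litconf x s s' (t x e) (p x e) (t' x e) (p' x e)).
Proof.
move=> ht hp ht' hp'; case: s s' => [r j|r j|i|i|i|i] [r' j'|r' j'|i'|i'|i'|i'] /=;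
  try exact: PP_const.
have hg := PP_guard; have hc := TT_ctr d.
apply: PP_and; first exact: PP_guard.
apply: PP_and; first exact: PP_guard.
rewrite /lit_at; set l := nth _ _ _; set l' := nth _ _ _; rewrite /place /=.
apply: PP_and; first exact: PP_const.
case: l l' => [b [[kd dt] o]] [b' [[kd' dt'] o']] /=.
have hpos (o1 : option bool) p1 : TT d p1 ->
    TT d (fun x e => if o1 is Some b then p1 x e + b else ctr pV qV (size x)).
  by case: o1 => [b1|] h //; tt.
apply: (@PP_ext d (fun x e => (kd == kd') && (t x e + dt == t' x e + dt') &&
   ((if o is Some b then p x e + b else ctr pV qV (size x)) ==
    (if o' is Some b then p' x e + b else ctr pV qV (size x))))).
  by move=> x e; rewrite !xpair_eqE.
apply: PP_and; last by apply: PP_eqn; exact: hpos.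
by pp.
Qed.

Lemma PP_nadj d i j : TT d i -> TT d j -> PP d (fun x e => nadj x (i x e) (j x e)).
Proof.
move=> hi hj; rewrite /nadj.
refine (@PP_has_const _ d (fun s x e => _) _ _) => s.
refine (@PP_has_const _ d (fun s' x e => _) _ _) => s'.
have hT m : TT m (fun x _ => ntime (size x)) by exact: TT_ntime.
have hP m : TT m (fun x _ => npl (size x)) by exact: TT_npos.
have T0 := hT d; have T1 := hT d.+1; have T2 := hT d.+2; have T3 := hT d.+3.
have P1 := hP d.+1; have P3 := hP d.+3; have P4 := hP d.+4; have T4 := hT d.+4.
have conf := @PP_litconf; have adj := PP_tag_adj.
rewrite /vcode.
apply: (@PP_exb d (fun x _ => ntime (size x)) (fun x e t => _)) => //; cbv beta.
apply: (@PP_exb d.+1 (fun x _ => npl (size x)) (fun x e p => _)) => //; cbv beta.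
apply: (@PP_exb d.+2 (fun x _ => ntime (size x)) (fun x e t' => _)) => //; cbv beta.
apply: (@PP_exb d.+3 (fun x _ => npl (size x)) (fun x e p' => _)) => //; cbv beta.
apply: PP_and; first by pp.
apply: PP_and; first by pp.
apply: PP_and; first by pp.
apply: PP_tag_adj; first by pp.
by apply: PP_litconf; tt.
Qed.

Lemma polytime_reduction : polytime reduction.
Proof.
have h := @polytime_mkseq (fun x e => outbit x (head 0 e))
  (fun x _ => (nvert (size x)).+1 + nvert (size x) * nvert (size x)).
apply: h.
  by have h := TT_nvert 0; tt.
have h1 := TT_nvert 1; have h2 := TT_nvert 2; have h3 := TT_nvert 3; have ha := PP_nadj.
by rewrite /outbit; pp.
Qed.

End Reduction.

Lemma divmod_inj d a b a' b' : b < d -> b' < d -> a * d + b = a' * d + b' ->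
  a = a' /\ b = b'.
Proof.
move=> h h' e; have d0 : 0 < d by apply: leq_ltn_trans h.
split; first by have := congr1 (divn^~ d) e; rewrite !divnMDl // !divn_small // !addn0.
by have := congr1 (modn^~ d) e; rewrite /= !modnMDl !modn_small.
Qed.

Lemma divmod_lt a b c d : a < c -> b < d -> a * d + b < c * d.
Proof.
move=> ac bd; apply: leq_trans (_ : a.+1 * d <= _); last by rewrite leq_mul2r ac orbT.
by rewrite mulSn addnC ltn_add2r.
Qed.

Section Hardness.
Variables (M : TM) (pV qV : {poly nat}) (k : nat).
Hypothesis k4 : 4 <= k.
Variable x : seq bool.

Let n := size x.
Let T := ntime pV qV n.
Let P := npl pV qV n.
Let N := nvert M pV qV k n.

Definition vplace : finType := ('I_T * 'I_P)%type.
Definition vguard (r : rule M) (y : vplace) := guard pV qV x r y.1 y.2.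
Definition vlit (r : rule M) (j : 'I_3) (y : vplace) : bool * (kind M * nat * nat) :=
  lit_at pV qV n r j y.1 y.2.

Definition gd : sgraph := gadget k vguard vlit.

Lemma vcode_inj (s s' : gtag (rule M) k) t p t' p' : t < T -> p < P -> t' < T -> p' < P ->
  vcode pV qV n s t p = vcode pV qV n s' t' p' -> [/\ s = s', t = t' & p = p'].
Proof.
move=> tT pP tT' pP' /(divmod_inj pP pP')[/(divmod_inj tT tT')[e -> ->]].
by split=> //; apply: enum_rank_inj; apply: val_inj.
Qed.

Lemma vcode_lt (s : gtag (rule M) k) t p : t < T -> p < P -> vcode pV qV n s t p < N.
Proof. by move=> tT pP; rewrite !divmod_lt. Qed.

Definition vnum (v : gd) : 'I_N := Ordinal (vcode_lt v.1 (ltn_ord v.2.1) (ltn_ord v.2.2)).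

Lemma vnum_bij : bijective vnum.
Proof.
apply: inj_card_bij; last by rewrite card_ord card_prod card_prod !card_ord mulnA.
move=> [s [t p]] [s' [t' p']] /(congr1 val) /= /vcode_inj[]; rewrite ?ltn_ord //= => -> et ep.
by congr (_, (_, _)); apply: val_inj.
Qed.

Lemma nadj_vnum (v w : gd) : nadj M pV qV k x (vnum v) (vnum w) = adj v w.
Proof.
case: v w => [s [t p]] [s' [t' p']] /=.
have conf : litconf pV qV x s s' t p t' p' = tag_conf vguard vlit s s' (t, p) (t', p').
  by case: s; case: s'.
have ne : ~~ [&& s == s', t == t' :> nat & p == p' :> nat] =
    ((s, (t, p)) != (s', (t', p')) :> (gtag (rule M) k * vplace)).
  by rewrite !xpair_eqE.
have same : (t == t' :> nat) && (p == p' :> nat) = ((t, p) == (t', p') :> vplace).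
  by rewrite xpair_eqE.
rewrite /nadj /gadj /= -conf -ne -same -/n.
apply/hasP/idP => [[s1 _ /hasP[s2 _]]|/andP[h1 h2]].
  case/exbP=> t1 h1 /exbP[p1 h2 /exbP[t2 h3 /exbP[p2 h4 /and4P[/eqP e1 /eqP e2]]]].
  have [-> -> ->] := vcode_inj (ltn_ord t) (ltn_ord p) h1 h2 e1.
  have [-> -> ->] := vcode_inj (ltn_ord t') (ltn_ord p') h3 h4 e2.
  by move=> -> ->.
exists s; first by rewrite mem_enum.
apply/hasP; exists s'; first by rewrite mem_enum.
apply/exbP; exists t => //; apply/exbP; exists p => //.
apply/exbP; exists t' => //; apply/exbP; exists p' => //.
by rewrite /vcode !eqxx h1 h2.
Qed.

Definition vadj : rel 'I_N := fun i j => nadj M pV qV k x i j.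

Lemma vadj_sym : symmetric vadj.
Proof.
have [g _ gK] := vnum_bij; move=> i j; rewrite -(gK i) -(gK j) /vadj !nadj_vnum.
exact: adj_sym.
Qed.

Lemma vadj_irr : irreflexive vadj.
Proof.
by have [g _ gK] := vnum_bij; move=> i; rewrite -(gK i) /vadj nadj_vnum; apply: adj_irr.
Qed.

Lemma reduction_code : reduction M pV qV k x = graph_code vadj.
Proof.
have sz : size (reduction M pV qV k x) = gsize N by rewrite size_mkseq.
apply: (@eq_from_nth _ false); first by rewrite sz size_code.
rewrite sz => m hm; rewrite nth_mkseq // /outbit -/n -/N.
have [c1 c2 c3] := nth_code vadj.
case: (ltngtP m N) => [h|h|->] /=; first by rewrite c1.
  have [m' em] : exists m', m = N.+1 + m' by exists (m - N.+1); lia.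
  move: hm; rewrite em /gsize ltn_add2l c3 => hm.
  have N0 : 0 < N by case: (N) hm.
  have h1 : m' %/ N < N by rewrite ltn_divLR.
  have h2 : m' %% N < N by rewrite ltn_mod.
  rewrite {2}(divn_eq m' N) (nth_bits vadj (Ordinal h1) (Ordinal h2)) /vadj /=.
  apply/exbP/idP => [[i iN /exbP[j jN]]|ha].
    rewrite eqn_add2l {1}(divn_eq m' N) => /andP[/eqP /(divmod_inj h2 jN)[-> ->]].
    exact.
  exists (m' %/ N) => //; apply/exbP; exists (m' %% N) => //.
  by rewrite -divn_eq eqxx.
rewrite c2; apply/negbTE/negP => /exbP[i _ /exbP[j _ /andP[/eqP e _]]].
by move: e; lia.
Qed.

Lemma reduction_tree_alpha :
  graph_problem (fun G => tree_alpha G <= k) (reduction M pV qV k x) <->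
  exists A : var M -> bool, tabsat pV qV x A.
Proof.
have y0 : vplace by split; [exact: (Ordinal (ltn0Sn _)) |
  apply: (@Ordinal P 0); rewrite /P /npl /npos addn2].
have r0 : rule M := (ord0, tm_start M, [ffun=> None], [ffun=> None], ord0, None).
have hsat (A : kind M * nat * nat -> bool) : satisfies vguard vlit A <-> tabsat pV qV x A.
  split=> [h r t p tT pP hg|h r [t p] hg].
    apply/holds_lit; exact: (h r (Ordinal tT, Ordinal pP) hg).
  by apply/holds_lit; apply: h => //; apply: ltn_ord.
have hgd : tree_alpha gd <= k <-> exists A : var M -> bool, tabsat pV qV x A.
  apply: iff_trans (gadget_tree_alpha vguard vlit k4 r0 y0) _.
  by split=> -[A /hsat h]; exists A.
rewrite -hgd; have [g fK gK] := vnum_bij; split=> [[N' [e [es [ei [ec hk]]]]]|hk].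
  (* [graph_problem] supplies some graph with this code; injectivity of the code identifies it with
     that of [vadj]. *)
  rewrite reduction_code in ec; have [h he] := graph_code_inj ec.
  apply: (@tree_alpha_iso gd (SGraph es ei) (cast_ord h \o vnum)) hk => [|u v].
    apply: bij_comp vnum_bij; exists (cast_ord (esym h)); [exact: cast_ordK | exact: cast_ordKV].
  by rewrite /= -he /vadj nadj_vnum.
exists N, vadj, vadj_sym, vadj_irr; split; first exact: reduction_code.
apply: (@tree_alpha_iso (SGraph vadj_sym vadj_irr) gd g) hk => [|i j].
  by exists vnum.
by rewrite -nadj_vnum !gK.
Qed.

End Hardness.

Theorem tree_alpha_NP_hard k : 4 <= k ->
  NP_hard (graph_problem (fun G : sgraph => tree_alpha G <= k)).
Proof.
move=> k4 L [V [q [[M [p hV]] hL]]].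
exists (reduction M p q k); split; first exact: polytime_reduction.
by move=> x; rewrite hL -(tableauP q hV) (reduction_tree_alpha _ _ _ k4).
Qed.

Theorem theorem2 (k : nat) (hk : 4 <= k) :
  NP_complete (graph_problem (fun G : sgraph => tree_alpha G <= k)).
Proof. by split; [exact: tree_alpha_in_NP | exact: tree_alpha_NP_hard]. Qed.
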